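(* Fix $L\in(0,1)$. For $r>0$ with $L^2+r^2<1$, let $\Omega_r=(-L,L)\times(-r,r)$ be the Euclidean rectangle with vertices $(\pm L,\pm r)$ in the Poincaré disk model of the hyperbolic plane. Then the fundamental gap of $\Omega_r$ with respect to the hyperbolic metric satisfies $\Gamma(\Omega_r)\to 0$ as $r\to0^+$. In particular there are domains in the hyperbolic plane that are convex with respect to the Euclidean geometry of the Poincaré disk model and have arbitrarily small fundamental gap.
   Context: The Poincaré disk model is the unit disk $\{\|x\|<1\}\subset\mathbb{R}^2$ with metric $\frac{4}{(1-\|x\|^2)^2}g_{\mathbb{R}^2}$. The fundamental gap is $\Gamma(\Omega)=\lambda_2(\Omega)-\lambda_1(\Omega)$, where $\lambda_1(\Omega)<\lambda_2(\Omega)\le\cdots$ are the Dirichlet eigenvalues of minus the hyperbolic Laplacian on $\Omega$. *)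

(* Defs.v *)
From mathcomp Require Import all_boot all_order all_algebra.
From mathcomp Require Import all_classical all_reals all_analysis.

Set Implicit Arguments.
Unset Strict Implicit.
Unset Printing Implicit Defensive.

Import Order.TTheory GRing.Theory Num.Theory.
Import numFieldNormedType.Exports.

Local Open Scope classical_set_scope.
Local Open Scope ring_scope.

Definition coord_dir (R : realType) (i : 'I_2) : R * R :=
  if i == ord0 then (1, 0) else (0, 1).

(* The product norm on [R * R] is the sup norm, hence the explicit squares. *)
Definition sqnorm (R : realType) (p : R * R) : R := p.1 ^+ 2 + p.2 ^+ 2.

Definition unit_disk (R : realType) : set (R * R) := [set p | sqnorm p < 1].

Definition poincare_metric (R : realType) (p : R * R) : 'M[R]_2 :=
  (4 / (1 - sqnorm p) ^+ 2)%:M.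

(* Delta_g u = |g|^(-1/2) sum_i d_i (|g|^(1/2) sum_j g^(ij) d_j u) *)
Definition laplace_beltrami (R : realType) (g : R * R -> 'M[R]_2)
    (u : R * R -> R) (p : R * R) : R :=
  (Num.sqrt (\det (g p)))^-1 *
  \sum_(i < 2) 'D_(coord_dir R i) (fun q : R * R => Num.sqrt (\det (g q)) *
    \sum_(j < 2) invmx (g q) i j * 'D_(coord_dir R j) u q) p.

Definition hyperbolic_laplacian (R : realType) (u : R * R -> R) (p : R * R) : R :=
  laplace_beltrami (@poincare_metric R) u p.

(* u is of class C^k on the open set Omega; its values outside Omega are
   irrelevant. *)
Fixpoint class_C (R : realType) (k : nat) (Omega : set (R * R))
    (u : R * R -> R) : Prop :=
  (forall p, Omega p -> {for p, continuous u}) /\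
  (if k is k'.+1 then
     forall i : 'I_2,
       (forall p, Omega p -> derivable u p (coord_dir R i)) /\
       class_C k' Omega ('D_(coord_dir R i) u)
   else True).

(* Classical Dirichlet eigenfunctions, of class C^2 inside and continuous up to
   the boundary.  For a domain with compact closure in the disk all of whose
   boundary points are regular (in particular a convex one), they are the
   eigenfunctions of the Friedrichs extension (weak solutions in H^1_0). *)
Definition dirichlet_eigenfunction (R : realType) (Omega : set (R * R))
    (lambda : R) (u : R * R -> R) : Prop :=
  [/\ class_C 2 Omega u,
      {within closure Omega, continuous u},
      (forall p, (closure Omega `\` Omega) p -> u p = 0),
      (forall p, Omega p -> - hyperbolic_laplacian u p = lambda * u p) &
      (exists2 p, Omega p & u p != 0)].

Definition lin_indep_on (R : realType) (Omega : set (R * R)) (k : nat)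
    (u : 'I_k -> R * R -> R) : Prop :=
  forall c : 'I_k -> R,
    (forall p, Omega p -> \sum_(i < k) c i * u i p = 0) -> forall i, c i = 0.

(* The eigenvalues at most t, counted with multiplicity, are at least k in
   number. *)
Definition eigenvalue_count_ge (R : realType) (Omega : set (R * R))
    (k : nat) (t : R) : Prop :=
  exists (u : 'I_k -> R * R -> R) (mu : 'I_k -> R),
    lin_indep_on Omega u /\
    (forall i, dirichlet_eigenfunction Omega (mu i) (u i) /\ mu i <= t).

(* lambda is the k-th term, k >= 1, of the nondecreasing list of the Dirichlet
   eigenvalues repeated according to multiplicity. *)
Definition is_dirichlet_eigenvalue (R : realType) (Omega : set (R * R))
    (k : nat) (lambda : R) : Prop :=
  eigenvalue_count_ge Omega k lambda /\
  (forall t, eigenvalue_count_ge Omega k t -> lambda <= t).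

(* A relation rather than a total function, so that asserting it includes the
   existence of the first two eigenvalues. *)
Definition is_fundamental_gap (R : realType) (Omega : set (R * R))
    (gamma : R) : Prop :=
  exists lambda1 lambda2 : R,
    [/\ is_dirichlet_eigenvalue Omega 1 lambda1,
        is_dirichlet_eigenvalue Omega 2 lambda2 &
        gamma = lambda2 - lambda1].

Definition open_rectangle (R : realType) (L r : R) : set (R * R) :=
  `]- L, L[%classic `*` `]- r, r[%classic.

Definition euclidean_convex (R : realType) (Omega : set (R * R)) : Prop :=
  convex_set (Omega : set (convex_lmodType (R * R)%type)).

(* Compactness of the closure in the disk means boundedness for the hyperbolic
   distance. *)
Definition bounded_hyperbolic_domain (R : realType) (Omega : set (R * R)) : Prop :=
  [/\ open Omega, connected Omega, Omega !=set0 &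
      closure Omega `<=` @unit_disk R].

(* Main.v *)
Require Import Defs.
From mathcomp Require Import all_boot all_order all_algebra.
From mathcomp Require Import all_classical all_reals all_analysis.
From mathcomp Require Import ring lra.

Set Implicit Arguments.
Unset Strict Implicit.
Unset Printing Implicit Defensive.

Import Order.TTheory GRing.Theory Num.Theory.
Import numFieldNormedType.Exports.

Local Open Scope classical_set_scope.
Local Open Scope ring_scope.

(** In dimension two the hyperbolic Laplacian is the Euclidean one divided by the
    density w = 4 / (1 - |x|^2)^2 (conformal_flux), so the eigenvalue problem
    reads - Delta u = lambda w u on the rectangle, with u = 0 on its boundary.

    For small r almost all of the first eigenvalue pays for the transversal
    frequency b = pi / (2 r), and the ground state u1 spares energy by sitting
    where w is largest on the long axis, that is near the two ends x = L and
    x = - L.  Let theta = pi (x + L) / (2 L), which runs from 0 to pi along the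
    axis.  The function cos theta * u1 is orthogonal to u1 by parity, and an
    integration by parts in theta shows that its energy exceeds lambda1 times its
    weighted mass only by a multiple of the integral of sin^2 theta * u1^2
    (gap_rayleigh).  As sin theta vanishes at both ends, this is small relative to
    the mass of u1, and so is the gap.

    The concentration is measured by the depth L^2 - x^2, to which the loss of
    weight away from the ends is comparable (wt_upper, wt_lower).  Trial functions
    sin theta (1 - cos theta)^k sin eta, with k large, give an upper bound of
    lambda1 (ground_upper, trial_concentrates); the lower bound
    b^2 * (mass of u1) for the energy of u1 (transversal_bound) then leaves room
    only for a small mean depth (depth_algebra), and compactness of the axis turns
    this into smallness of the mean of sin^2 theta (gap_bound, gap_small).

    The fundamental gap refers to classical eigenfunctions, of class C^2 inside
    and continuous up to the boundary, counted with multiplicity.  They are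
    produced in the orthonormal basis of the Dirichlet sine functions.  After
    rescaling the coefficients by the square roots of the Laplace eigenvalues, the
    Dirichlet integral becomes the l2 inner product and integration against w
    becomes a symmetric Hilbert-Schmidt form (hsmat_hilbert_schmidt), which has a
    first and a second eigenvector (hs_top_eigenvector, hs_second_eigenvector).
    The bridge to functions has two directions.  Multiplication by w, a power
    series in x^2 and y^2, preserves absolutely convergent sine series (wt_row,
    summ_coef_wt_usr), so eigenvectors are smooth eigenfunctions (eigen_of_vec,
    class_C2_usr).  Conversely a classical solution of Poisson's equation is the
    sum of its sine series: its coefficients are the expected ones by the maximum
    principle and the uniform density of sine polynomials (sine_density,
    poisson_coef).  Hence the two eigenvalues have a variational characterisation
    against all such solutions (bottom_exists), which identifies them as the first
    two Dirichlet eigenvalues (gap_of_bottom) and admits the trial functions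
    above. *)

(** * Absolutely convergent series *)

Section Series.
Variable R : realType.
Implicit Types (f g : nat -> R) (M e : R).

Definition summ f := exists M, forall n, \sum_(i < n) `|f i| <= M.
Definition ssum f : R := limn (fun n => \sum_(i < n) f i).
Definition tail f n : R := ssum (fun i => `|f i|) - \sum_(i < n) `|f i|.

Lemma cauchy_schwarz (I : Type) (s : seq I) (a b : I -> R) :
  (\sum_(i <- s) a i * b i) ^+ 2 <=
  (\sum_(i <- s) a i ^+ 2) * (\sum_(i <- s) b i ^+ 2).
Proof.
set A := \sum_(i <- s) a i ^+ 2; set B := \sum_(i <- s) a i * b i.
set C := \sum_(i <- s) b i ^+ 2.
have H x y : 0 <= x ^+ 2 * A + 2 * (x * y) * B + y ^+ 2 * C.
  rewrite /A /B /C !big_distrr /= -!big_split /=.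
  by apply: sumr_ge0 => i _; rewrite (_ : _ + _ = (x * a i + y * b i) ^+ 2) ?sqr_ge0//; ring.
have A0 : 0 <= A by apply: sumr_ge0 => i _; exact: sqr_ge0.
have C0 : 0 <= C by apply: sumr_ge0 => i _; exact: sqr_ge0.
have [C1|] := ltP 0 C.
  rewrite -subr_ge0 -(pmulr_rge0 _ C1).
  by rewrite (_ : C * (_ - _) = C ^+ 2 * A + 2 * (C * - B) * B + (- B) ^+ 2 * C) //; ring.
move=> C1; have {}C0 : C = 0 by apply/eqP; rewrite eq_le C0 C1.
have [A1|A1] := ltP 0 A.
  rewrite -subr_ge0 -(pmulr_rge0 _ A1).
  by rewrite (_ : A * (_ - _) = (- B) ^+ 2 * A + 2 * (- B * A) * B + A ^+ 2 * C) //; ring.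
have {}A0 : A = 0 by apply/eqP; rewrite eq_le A0 A1.
by have := H 1 (- B); rewrite A0 C0; nra.
Qed.

Lemma psum_nondecreasing f : (forall i, 0 <= f i) ->
  nondecreasing_seq (fun n => \sum_(i < n) f i).
Proof.
move=> f0; apply/nondecreasing_seqP => n.
by rewrite big_ord_recr /= lerDl.
Qed.

Lemma summ_cvg f : summ f -> (\sum_(i < n) f i) @[n --> \oo] --> ssum f.
Proof.
move=> [M fM].
have E (h : nat -> R) : (fun n => \sum_(i < n) h i) = series h.
  by apply/funext => n; rewrite /series /= big_mkord.
suff : cvgn (series f) by rewrite /ssum E.
apply: normed_cvg; apply: nondecreasing_is_cvgn.
  apply/nondecreasing_seqP => n.
  change (\sum_(0 <= k < n) `|f k| <= \sum_(0 <= k < n.+1) `|f k|).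
  rewrite big_nat_recr//= lerDl.
  exact: normr_ge0.
exists M => _ [n _ <-]; rewrite /= /series /= big_mkord; exact: fM.
Qed.

Lemma summ_norm f : summ f -> summ (fun i => `|f i|).
Proof. by move=> [M fM]; exists M => n; under eq_bigr do rewrite normr_id. Qed.

Lemma summ_le f g : (forall i, `|f i| <= g i) -> summ g -> summ f.
Proof.
move=> fg [M gM]; exists M => n; apply: le_trans (gM n).
by apply: ler_sum => i _; apply: le_trans (fg i) (ler_norm _).
Qed.

Lemma summD f g : summ f -> summ g -> summ (fun i => f i + g i).
Proof.
move=> [M fM] [N gN]; exists (M + N) => n.
apply: le_trans (lerD (fM n) (gN n)); rewrite -big_split /=.
by apply: ler_sum => i _; exact: ler_normD.
Qed.

Lemma summZ f k : summ f -> summ (fun i => k * f i).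
Proof.
move=> [M fM]; exists (`|k| * M) => n.
under eq_bigr do rewrite normrM.
by rewrite -big_distrr /=; apply: ler_wpM2l (fM n).
Qed.

Lemma summ_eq f g : f =1 g -> summ f -> summ g.
Proof. by move=> fg sf; have <- : f = g by apply/funext. Qed.

Lemma summ_nneg f M : (forall i, 0 <= f i) -> (forall n, \sum_(i < n) f i <= M) ->
  summ f.
Proof.
move=> f0 fM; exists M => n.
by under eq_bigr do rewrite ger0_norm //.
Qed.

Lemma ssumD f g : summ f -> summ g ->
  ssum (fun i => f i + g i) = ssum f + ssum g.
Proof.
move=> sf sg; apply: cvg_lim => //.
under eq_fun do rewrite big_split /=.
by apply: cvgD; exact: summ_cvg.
Qed.

Lemma ssumZ f k : summ f -> ssum (fun i => k * f i) = k * ssum f.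
Proof.
move=> sf; apply: cvg_lim => //.
under eq_fun do rewrite -big_distrr /=.
by apply: cvgM; [exact: cvg_cst|exact: summ_cvg].
Qed.

Lemma ssum_le f M : summ f -> (forall n, \sum_(i < n) f i <= M) -> ssum f <= M.
Proof.
move=> sf fM; have h := summ_cvg sf; rewrite -(cvg_lim _ h)//.
by apply: limr_le; [apply/cvg_ex; eexists; exact: h|apply: nearW].
Qed.

Lemma psum_le_ssum f n : (forall i, 0 <= f i) -> summ f ->
  \sum_(i < n) f i <= ssum f.
Proof.
move=> f0 sf; apply: (@nondecreasing_cvgn_le _ (fun n => \sum_(i < n) f i)).
  exact: psum_nondecreasing.
by apply/cvg_ex; eexists; apply: summ_cvg.
Qed.

Lemma ler_ssum f g : summ f -> summ g -> (forall i, f i <= g i) ->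
  ssum f <= ssum g.
Proof.
move=> sf sg fg; have hf := summ_cvg sf; have hg := summ_cvg sg.
rewrite -(cvg_lim _ hf)// -(cvg_lim _ hg)//.
apply: ler_lim; [by apply/cvg_ex; eexists; exact: hf|by apply/cvg_ex; eexists; exact: hg|].
by apply: nearW => n; exact: ler_sum.
Qed.

Lemma ssum_ge0 f : (forall i, 0 <= f i) -> summ f -> 0 <= ssum f.
Proof. by move=> f0 sf; have := psum_le_ssum 0 f0 sf; rewrite big_ord0. Qed.

Lemma tail_ge0 f n : summ f -> 0 <= tail f n.
Proof.
move=> sf; rewrite subr_ge0; apply: psum_le_ssum => [i|]; first exact: normr_ge0.
exact: summ_norm.
Qed.

Lemma tail_cvg0 f : summ f -> tail f n @[n --> \oo] --> (0 : R).
Proof.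
move=> sf; rewrite -(subrr (ssum (fun i => `|f i|))).
by apply: cvgB; [exact: cvg_cst|apply: summ_cvg; exact: summ_norm].
Qed.

Lemma tail_small f e : summ f -> 0 < e -> exists n, tail f n < e.
Proof.
move=> sf e0; have /cvgrPdist_lt/(_ _ e0)[n _ /(_ n (leqnn n))] := tail_cvg0 sf.
by rewrite sub0r normrN => h; exists n; apply: le_lt_trans (ler_norm _) h.
Qed.

Lemma psum_diff_tail f m n : summ f -> (n <= m)%N ->
  `|\sum_(i < m) f i - \sum_(i < n) f i| <= tail f n.
Proof.
move=> sf nm.
have E (h : nat -> R) : \sum_(i < m) h i = \sum_(i < n) h i + \sum_(n <= i < m) h i.
  by rewrite -!(big_mkord xpredT) (@big_cat_nat _ _ _ n).
have S : \sum_(i < m) `|f i| <= ssum (fun i => `|f i|).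
  by apply: psum_le_ssum => //; apply: summ_norm.
rewrite E addrC addKr /tail lerBrDl.
apply: le_trans S; rewrite (E (fun i => `|f i|)) lerD2l; exact: ler_norm_sum.
Qed.

Lemma ssum_tail f n : summ f -> `|ssum f - \sum_(i < n) f i| <= tail f n.
Proof.
move=> sf.
have h : `|\sum_(i < m) f i - \sum_(i < n) f i| @[m --> \oo] -->
    `|ssum f - \sum_(i < n) f i|.
  by apply: cvg_norm; apply: cvgB; [exact: summ_cvg|exact: cvg_cst].
rewrite -(cvg_lim _ h)//; apply: limr_le; first by apply/cvg_ex; eexists; exact: h.
by exists n => // m /= nm; exact: psum_diff_tail.
Qed.

Lemma tail_le f g n : (forall i, `|f i| <= g i) -> summ g -> tail f n <= tail g n.
Proof.
move=> fg sg; have sf := summ_le fg sg.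
have E : forall i, 0 <= g i by move=> i; apply: le_trans (fg i).
have S : summ (fun i => `|g i| - `|f i|).
  apply: summ_le (summD (summ_norm sg) (summ_norm sf)) => i.
  by rewrite (le_trans (ler_normB _ _)) // !normr_id.
rewrite -subr_ge0 /tail.
have -> : ssum (fun i => `|g i|) = ssum (fun i => `|g i| - `|f i|) + ssum (fun i => `|f i|).
  rewrite -ssumD//; last exact: summ_norm.
  by congr ssum; apply/funext => i; rewrite subrK.
rewrite (_ : _ - _ = ssum (fun i => `|g i| - `|f i|) - \sum_(i < n) (`|g i| - `|f i|)).
  rewrite subr_ge0; apply: psum_le_ssum => // i.
  by rewrite subr_ge0 (ger0_norm (E i)).
by rewrite sumrB; lra.
Qed.

Lemma summ_sqr_mul f g : summ (fun i => f i ^+ 2) -> summ (fun i => g i ^+ 2) ->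
  summ (fun i => f i * g i).
Proof.
move=> sf sg; apply: summ_le (summD sf sg) => i.
have : `|f i * g i| * 2 <= `|f i| ^+ 2 + `|g i| ^+ 2 by rewrite normrM; have := sqr_ge0 (`|f i| - `|g i|); lra.
rewrite !real_normK ?num_real// => h.
have := sqr_ge0 (f i); have := sqr_ge0 (g i); have := normr_ge0 (f i * g i); lra.
Qed.

Lemma summ_sqrD f g : summ (fun i => f i ^+ 2) -> summ (fun i => g i ^+ 2) ->
  summ (fun i => (f i + g i) ^+ 2).
Proof.
move=> sf sg; apply: summ_le (summZ 2 (summD sf sg)) => i.
rewrite ger0_norm ?sqr_ge0//.
by have := sqr_ge0 (f i - g i); nra.
Qed.

Lemma summ_sqrZ f k : summ (fun i => f i ^+ 2) -> summ (fun i => (k * f i) ^+ 2).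
Proof.
move=> sf; apply: summ_eq (summZ (k ^+ 2) sf) => i; by rewrite exprMn.
Qed.

End Series.

Lemma continuous_eq (T U : topologicalType) (f g : T -> U) :
  f =1 g -> continuous f -> continuous g.
Proof. by move=> fg cf; have <- : f = g by apply/funext. Qed.

(** * Hilbert-Schmidt forms on square-summable sequences *)

Section HilbertSchmidt.
Variable R : realType.
Implicit Types (a b c : nat -> R).

Lemma cauchy_tail_cvgn (u t : nat -> R) : t n @[n --> \oo] --> (0 : R) ->
  (forall n m, (n <= m)%N -> `|u m - u n| <= t n) -> cvgn u.
Proof.
move=> t0 ut; apply/cauchy_cvgP/cauchy_ballP => e e0.
have e2 : 0 < e / 2 by rewrite divr_gt0.
have /cvgrPdist_lt/(_ _ e2)[n _ Hn] := t0.
have Hn' m : (n <= m)%N -> `|u m - u n| < e / 2.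
  move=> nm; apply: le_lt_trans (ut _ _ nm) _.
  by have := Hn n (leqnn n); rewrite sub0r normrN; apply: le_lt_trans; exact: ler_norm.
exists ([set u m | m in [set m | (n <= m)%N]], [set u m | m in [set m | (n <= m)%N]]).
  by split => /=; exists n => // m /= nm; exists m.
move=> [_ _] [/= [p np <-] [q nq <-]]; rewrite /ball /= /ball_.
rewrite (_ : u p - u q = (u p - u n) - (u q - u n)); last by ring.
by apply: le_lt_trans (ler_normB _ _) _; rewrite [e]splitr ltrD ?Hn'.
Qed.

Definition l2 a := summ (fun i => a i ^+ 2).
Definition dot a b : R := ssum (fun i => a i * b i).

Lemma l2D a b : l2 a -> l2 b -> l2 (fun i => a i + b i).
Proof. exact: summ_sqrD. Qed.

Lemma l2Z a k : l2 a -> l2 (fun i => k * a i).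
Proof. exact: summ_sqrZ. Qed.

Lemma dotC a b : dot a b = dot b a.
Proof. by congr ssum; apply/funext => i; rewrite mulrC. Qed.

Lemma dotDl a b c : l2 a -> l2 b -> l2 c ->
  dot (fun i => a i + b i) c = dot a c + dot b c.
Proof.
move=> la lb lc; rewrite -ssumD; [|exact: summ_sqr_mul..].
by congr ssum; apply/funext => i; rewrite mulrDl.
Qed.

Lemma dotZl a b k : l2 a -> l2 b -> dot (fun i => k * a i) b = k * dot a b.
Proof.
move=> la lb; rewrite -ssumZ; last exact: summ_sqr_mul.
by congr ssum; apply/funext => i; rewrite mulrA.
Qed.

Lemma dot_expand a b t : l2 a -> l2 b ->
  dot (fun i => a i + t * b i) (fun i => a i + t * b i) =
  dot a a + 2 * t * dot b a + t ^+ 2 * dot b b.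
Proof.
move=> la lb; have ltb : l2 (fun i => t * b i) by exact: l2Z.
have lc : l2 (fun i => a i + t * b i) by exact: l2D.
rewrite (dotDl la ltb lc) (dotZl t lb lc) (dotC a) (dotC b).
rewrite (dotDl la ltb la) (dotDl la ltb lb) !(dotZl t lb) // (dotC a b); ring.
Qed.

Lemma dot_ge0 a : l2 a -> 0 <= dot a a.
Proof. by move=> la; apply: ssum_ge0 la => i; exact: sqr_ge0. Qed.

Lemma psum_le_dot a n : l2 a -> \sum_(i < n) a i ^+ 2 <= dot a a.
Proof.
by move=> la; apply: (psum_le_ssum (f := fun i => a i ^+ 2)) => // i; exact: sqr_ge0.
Qed.

Lemma dot_eq0 a : l2 a -> dot a a = 0 -> forall i, a i = 0.
Proof.
move=> la a0 i; apply/eqP; rewrite -sqrf_eq0 eq_le sqr_ge0 andbT -a0.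
apply: le_trans (psum_le_dot i.+1 la); rewrite big_ord_recr /= lerDr.
by apply: sumr_ge0 => j _; exact: sqr_ge0.
Qed.

Lemma sqsum_widen (F : nat -> nat -> R) n m : (n <= m)%N ->
  \sum_(i < m) \sum_(j < m) F i j = \sum_(i < n) \sum_(j < n) F i j +
  \sum_(i < m) \sum_(j < m) (if (i < n)%N && (j < n)%N then 0 else F i j).
Proof.
move=> nm.
have E (G : nat -> R) : \sum_(i < n) G i = \sum_(i < m) (if (i < n)%N then G i else 0).
  by rewrite (big_ord_widen _ _ nm) big_mkcond.
rewrite (E (fun i => \sum_(j < n) F i j)) -big_split /=; apply: eq_bigr => i _.
case: ifP => ni /=; last by rewrite add0r.
rewrite (E (F i)) -big_split /=; apply: eq_bigr => j _.
by case: ifP; rewrite ?addr0 ?add0r.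
Qed.

Section Form.
Variable S : nat -> nat -> R.

Definition hs n := \sum_(i < n) \sum_(j < n) S i j ^+ 2.
Definition hilbert_schmidt := exists M, forall n, hs n <= M.
Definition bform n a b := \sum_(i < n) \sum_(j < n) S i j * (a i * b j).
Definition blim a b : R := limn (fun n => bform n a b).

Lemma hs_nondecreasing : nondecreasing_seq hs.
Proof.
move=> n m nm; rewrite /hs (sqsum_widen (fun i j => S i j ^+ 2) nm) lerDl.
by apply: sumr_ge0 => i _; apply: sumr_ge0 => j _; case: ifP => // _; exact: sqr_ge0.
Qed.

(** Cauchy-Schwarz over the entries outside the smaller square. *)
Lemma bform_diff a b n m : (n <= m)%N ->
  (bform m a b - bform n a b) ^+ 2 <=
  (hs m - hs n) * ((\sum_(i < m) a i ^+ 2) * (\sum_(i < m) b i ^+ 2)).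
Proof.
move=> nm.
pose c i j := if (i < n)%N && (j < n)%N then 0 else S i j.
have -> : bform m a b - bform n a b = \sum_(i < m) \sum_(j < m) c i j * (a i * b j).
  rewrite /bform (sqsum_widen (fun i j => S i j * (a i * b j)) nm) addrAC subrr add0r.
  by apply: eq_bigr => i _; apply: eq_bigr => j _; rewrite /c; case: ifP; rewrite ?mul0r.
have -> : hs m - hs n = \sum_(i < m) \sum_(j < m) c i j ^+ 2.
  rewrite /hs (sqsum_widen (fun i j => S i j ^+ 2) nm) addrAC subrr add0r.
  by apply: eq_bigr => i _; apply: eq_bigr => j _; rewrite /c; case: ifP; rewrite ?expr0n.
rewrite !pair_big /=; apply: le_trans (cauchy_schwarz _ _ _) _.
rewrite ler_wpM2l//; first by apply: sumr_ge0 => i _; exact: sqr_ge0.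
rewrite big_distrl /= -(pair_big xpredT xpredT (fun i j : 'I_m => (a i * b j) ^+ 2)) /=.
apply: ler_sum => i _; rewrite big_distrr /=.
by apply: ler_sum => j _; rewrite exprMn.
Qed.

Hypothesis HS : hilbert_schmidt.

Definition htail n : R := limn hs - hs n.

Lemma hs_cvg : cvgn hs.
Proof.
have [M HM] := HS; apply: nondecreasing_is_cvgn; first exact: hs_nondecreasing.
by exists M => _ [n _ <-].
Qed.

Lemma hs_diff n m : hs m - hs n <= htail n.
Proof.
by rewrite lerD2r; apply: nondecreasing_cvgn_le; [exact: hs_nondecreasing|exact: hs_cvg].
Qed.

Lemma htail_cvg0 : htail n @[n --> \oo] --> (0 : R).
Proof.
rewrite -(subrr (limn hs)); apply: cvgB; first exact: cvg_cst.
exact: hs_cvg.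
Qed.

Lemma bform_diff_le a b A B n m : (n <= m)%N -> 0 <= A -> 0 <= B ->
  (forall k, \sum_(i < k) a i ^+ 2 <= A) -> (forall k, \sum_(i < k) b i ^+ 2 <= B) ->
  `|bform m a b - bform n a b| <= Num.sqrt (htail n * (A * B)).
Proof.
move=> nm A0 B0 aA bB; rewrite -sqrtr_sqr ler_wsqrtr//.
apply: le_trans (bform_diff _ _ nm) _; apply: ler_pM.
- by rewrite subr_ge0; exact: hs_nondecreasing.
- by rewrite mulr_ge0// sumr_ge0// => i _; exact: sqr_ge0.
- exact: hs_diff.
- by apply: ler_pM; rewrite ?aA ?bB ?sumr_ge0// => i _; exact: sqr_ge0.
Qed.

Lemma sqrt_htail_cvg0 A : Num.sqrt (htail n * A) @[n --> \oo] --> (0 : R).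
Proof.
rewrite -[X in _ --> X](@sqrtr0 R) -[X in Num.sqrt X](mul0r A).
apply: continuous_cvg; first exact: sqrt_continuous.
by apply: cvgM; [exact: htail_cvg0|exact: cvg_cst].
Qed.

Lemma blim_cvg a b : l2 a -> l2 b -> bform n a b @[n --> \oo] --> blim a b.
Proof.
move=> la lb; rewrite /blim.
suff : cvgn (fun n => bform n a b) by [].
apply: (cauchy_tail_cvgn (sqrt_htail_cvg0 (dot a a * dot b b))) => n m nm.
by apply: bform_diff_le => //; rewrite ?dot_ge0// => k; exact: psum_le_dot.
Qed.

Lemma blimDl a b c : l2 a -> l2 b -> l2 c ->
  blim (fun i => a i + b i) c = blim a c + blim b c.
Proof.
move=> la lb lc; apply: cvg_lim => //.
under eq_fun => n.
  rewrite /bform (eq_bigr (fun i : 'I_n => \sum_(j < n) S i j * (a i * c j) + \sum_(j < n) S i j * (b i * c j))); last first.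
    by move=> i _; rewrite -big_split; apply: eq_bigr => j _ /=; ring.
  rewrite big_split /=.
  over.
by apply: cvgD; exact: blim_cvg.
Qed.

Lemma blimZl a b k : l2 a -> l2 b -> blim (fun i => k * a i) b = k * blim a b.
Proof.
move=> la lb; apply: cvg_lim => //.
under eq_fun => n.
  rewrite /bform (eq_bigr (fun i : 'I_n => k * \sum_(j < n) S i j * (a i * b j))); last first.
    by move=> i _; rewrite big_distrr; apply: eq_bigr => j _ /=; ring.
  rewrite -big_distrr /=.
  over.
by apply: cvgM; [exact: cvg_cst|exact: blim_cvg].
Qed.

Hypothesis symS : forall i j, S i j = S j i.

Lemma blimC a b : blim a b = blim b a.
Proof.
congr (limn _); apply/funext => n; rewrite /bform exchange_big /=.
by apply: eq_bigr => i _; apply: eq_bigr => j _; rewrite symS (mulrC (a _)).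
Qed.

(** Real sequences with the topology of pointwise convergence. *)
Local Notation seqT := (prod_topology (fun _ : nat => R)).
Lemma blim_expand a b t : l2 a -> l2 b ->
  blim (fun i => a i + t * b i) (fun i => a i + t * b i) =
  blim a a + 2 * t * blim b a + t ^+ 2 * blim b b.
Proof.
move=> la lb; have ltb : l2 (fun i => t * b i) by exact: l2Z.
have lc : l2 (fun i => a i + t * b i) by exact: l2D.
rewrite (blimDl la ltb lc) (blimZl t lb lc) (blimC a) (blimC b).
rewrite (blimDl la ltb la) (blimDl la ltb lb) !(blimZl t lb) // (blimC a b); ring.
Qed.

Definition l2ball : set seqT :=
  [set a : seqT | forall n, \sum_(i < n) a i ^+ 2 <= 1].

Lemma l2ball_l2 a : l2ball a -> l2 a.
Proof. by move=> ha; apply: (summ_nneg (M := 1)) => // i; exact: sqr_ge0. Qed.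

Lemma l2ball_dot a : l2ball a -> dot a a <= 1.
Proof. by move=> ha; apply: ssum_le => //; exact: l2ball_l2. Qed.

Lemma coord_continuous (i : nat) : continuous (fun a : seqT => a i).
Proof. exact: (@proj_continuous nat (fun=> R)). Qed.

Lemma psum_continuous n (F : nat -> seqT -> R) :
  (forall i, continuous (F i)) -> continuous (fun a : seqT => \sum_(i < n) F i a).
Proof.
move=> cF; elim: n => [|n IH].
  apply: (continuous_eq (f := cst 0)); last exact: cst_continuous.
  by move=> b; rewrite big_ord0.
apply: (continuous_eq (f := (fun b : seqT => \sum_(i < n) F i b) \+ F n)).
  by move=> b; rewrite big_ord_recr.
move=> a; exact: (continuousD (IH a) (cF n a)).
Qed.

(** A closed subset of a product of segments. *)
Lemma l2ball_compact : compact l2ball.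
Proof.
apply: (subclosed_compact (B := [set a : seqT | forall i, `[-1, 1]%classic (a i)])).
- rewrite (_ : l2ball = \bigcap_n [set a : seqT | \sum_(i < n) a i ^+ 2 <= 1]); last first.
    by apply/seteqP; split => a h; [move=> n _; exact: h|move=> n; exact: (h n I)].
  apply: closed_bigI => n _.
  have c : continuous (fun a : seqT => \sum_(i < n) a i ^+ 2).
    apply: (psum_continuous (F := fun (i : nat) (a : seqT) => a i ^+ 2)) => i x.
    exact: (continuousM (@coord_continuous i x) (@coord_continuous i x)).
  by have /continuous_closedP/(_ _ (@closed_le R 1)) := c.
- by apply: (@tychonoff nat (fun=> R) (fun=> `[-1, 1]%classic)) => i; exact: segment_compact.
- move=> a ha i /=; rewrite in_itv /=; rewrite -ler_norml.
  rewrite -(ler_pXn2r (n := 2)) ?nnegrE//= expr1n real_normK ?num_real//.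
  apply: (le_trans _ (ha i.+1)); rewrite big_ord_recr /= lerDr.
  by apply: sumr_ge0 => j _; exact: sqr_ge0.
Qed.

Lemma bform_continuous n : continuous (fun a : seqT => bform n a a).
Proof.
apply: (psum_continuous (F := fun (i : nat) (a : seqT) => \sum_(j < n) S i j * (a i * a j))) => i.
apply: (psum_continuous (F := fun (j : nat) (a : seqT) => S i j * (a i * a j))) => j a.
apply: (@continuousM R seqT (fun=> S i j) (fun a : seqT => a i * a j)).
  exact: cst_continuous.
exact: (continuousM (@coord_continuous i a) (@coord_continuous j a)).
Qed.

(** Uniformity over the ball is what makes the limiting form continuous for
    pointwise convergence. *)
Lemma bform_unif (e : R) : 0 < e -> \forall n \near \oo,
  forall a, l2ball a -> `|blim a a - bform n a a| < e.
Proof.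
move=> e0; have /cvgrPdist_lt/(_ _ e0)[n _ Hn] := sqrt_htail_cvg0 (1 * 1).
exists n => // m /= nm a ha.
have la := l2ball_l2 ha.
have h : `|bform k a a - bform m a a| @[k --> \oo] --> `|blim a a - bform m a a|.
  by apply: cvg_norm; apply: cvgB; [exact: blim_cvg|exact: cvg_cst].
rewrite -(cvg_lim _ h)//; apply: (@le_lt_trans _ _ (Num.sqrt (htail m * (1 * 1)))); last first.
  by have := Hn m nm; rewrite sub0r normrN; apply: le_lt_trans; exact: ler_norm.
apply: limr_le; first by apply/cvg_ex; eexists; exact: h.
by exists m => // k /= mk; exact: bform_diff_le.
Qed.

Lemma blim_continuous :
  {within (l2ball : set seqT), continuous (fun a : seqT => blim a a : R)}.
Proof.
apply/subspace_continuousP => a ha; apply/cvgrPdist_lt => e e0.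
have e3 : 0 < e / 3 by rewrite divr_gt0.
have [n _ /(_ n (leqnn n)) Hn] := bform_unif e3.
have c := @bform_continuous n a.
have /cvgrPdist_lt/(_ _ e3) C := c.
apply: (filterS _ C) => b h3 hb.
have h1 := Hn a ha; have h2 := Hn b hb.
rewrite (_ : blim a a - blim b b = (blim a a - bform n a a) +
  (bform n a a - bform n b b) - (blim b b - bform n b b)); last by ring.
apply: le_lt_trans (ler_normB _ _) _.
have := ler_normD (blim a a - bform n a a) (bform n a a - bform n b b).
by move: h1 h2 h3; lra.
Qed.

(** The quadratic form of a Hilbert-Schmidt matrix is continuous for pointwise
    convergence on the unit ball, which is compact for that topology, so it
    attains its maximum there; the first variation at a maximiser gives the
    eigenvector equation. *)
Theorem hs_top_eigenvector c : l2 c -> 0 < blim c c ->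
  exists (x : nat -> R) (q : R),
    [/\ 0 < q, l2 x, dot x x = 1,
        forall a, l2 a -> blim a x = q * dot a x &
        forall a, l2 a -> blim a a <= q * dot a a].
Proof.
move=> lc Qc.
have ball0 : (l2ball : set seqT) !=set0.
  by exists (fun=> 0) => n; rewrite big1// => i _; rewrite expr0n.
have [x xK Hx] := compact_EVT_max ball0 l2ball_compact blim_continuous.
have {}xK : l2ball x by move: xK; rewrite inE.
have lx := l2ball_l2 xK; set q := blim x x in Hx.
have scale a : l2 a -> blim a a <= q * dot a a.
  move=> la; have [a0|a0] := ltP 0 (dot a a); last first.
    have a00 : dot a a = 0 by apply/eqP; rewrite eq_le a0 dot_ge0.
    have -> : blim a a = blim (fun i => 0 * a i) a.
      by congr blim; apply/funext => i; rewrite (dot_eq0 la a00) mulr0.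
    by rewrite a00 mulr0 (blimZl 0 la la) mul0r.
  pose k := (Num.sqrt (dot a a))^-1.
  have kk : k * k * dot a a = 1.
    by rewrite -expr2 /k exprVn sqr_sqrtr ?dot_ge0// mulVf// gt_eqF.
  have lka : l2 (fun i => k * a i) by exact: l2Z.
  have : l2ball (fun i => k * a i).
    move=> n; apply: le_trans (psum_le_dot n lka) _.
    by rewrite (dotZl _ la lka) dotC (dotZl _ la la) mulrA kk.
  move/mem_set/Hx; rewrite (blimZl _ la lka) blimC (blimZl _ la la) mulrA => h.
  have -> : blim a a = k * k * blim a a * dot a a by rewrite mulrAC kk mul1r.
  by apply: ler_wpM2r; [exact: dot_ge0|exact: h].
have q0 : 0 < q.
  have h := scale _ lc; have := lt_le_trans Qc h.
  by rewrite pmulr_lgt0//; have := dot_ge0 lc; rewrite le_eqVlt => /orP[/eqP e|//]; move: (lt_le_trans Qc h); rewrite -e mulr0 ltxx.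
have xx : dot x x = 1.
  apply/eqP; rewrite eq_le l2ball_dot//=.
  by have := scale _ lx; rewrite -/q -{1}[q]mulr1 ler_pM2l.
exists x, q; split => // a la.
pose d := blim a x - q * dot a x.
have key t : 2 * t * d <= t ^+ 2 * (q * dot a a - blim a a).
  have lta : l2 (fun i => t * a i) by exact: l2Z.
  have := scale _ (l2D lx lta).
  rewrite (blim_expand t lx la) (dot_expand t lx la) xx -/q /d.
  by move=> h; lra.
set s := q * dot a a - blim a a in key.
suff : d = 0 by move/eqP; rewrite subr_eq0 => /eqP.
have s0 : 0 <= s by rewrite subr_ge0; exact: scale.
apply/eqP; rewrite -sqrf_eq0 eq_le sqr_ge0 andbT.
have h := key (d / (s + 1)).
have s1 : 0 < s + 1 by rewrite ltr_wpDl.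
have e : d = (d / (s + 1)) * (s + 1) by rewrite divfK// gt_eqF.
move: h e; set u := d / (s + 1) => h e; nra.
Qed.

End Form.
(** Subtracting the top eigenprojection leaves a Hilbert-Schmidt matrix whose
    form agrees with the original one on the orthogonal of the eigenvector, so
    that a second eigenvector comes from the same variational argument. *)
Theorem hs_second_eigenvector S x q c :
  hilbert_schmidt S -> (forall i j, S i j = S j i) ->
  l2 x -> dot x x = 1 -> (forall a, l2 a -> blim S a x = q * dot a x) ->
  l2 c -> dot c x = 0 -> 0 < blim S c c ->
  exists (y : nat -> R) (q2 : R),
    [/\ 0 < q2, l2 y, dot y y = 1 /\ dot y x = 0,
        forall a, l2 a -> blim S a y = q2 * dot a y &
        forall a, l2 a -> dot a x = 0 -> blim S a a <= q2 * dot a a].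
Proof.
move=> HS symS lx xx Sx lc cx Qc.
pose T i j := S i j - q * (x i * x j).
have symT i j : T i j = T j i by rewrite /T symS (mulrC (x i)).
have HT : hilbert_schmidt T.
  have [M HM] := HS; exists (2 * M + 2 * q ^+ 2) => n.
  have X : \sum_(i < n) x i ^+ 2 <= 1 by rewrite -xx psum_le_dot.
  have X0 : 0 <= \sum_(i < n) x i ^+ 2 by rewrite sumr_ge0// => i _; exact: sqr_ge0.
  have : 2 * hs S n + 2 * q ^+ 2 * ((\sum_(i < n) x i ^+ 2) * (\sum_(i < n) x i ^+ 2)) <= 2 * M + 2 * q ^+ 2.
    apply: lerD; first by rewrite ler_wpM2l.
    have X1 := ler_pM X0 X0 X X; have q2 := sqr_ge0 q.
    by move: X1; rewrite mulr1 => X1; rewrite -[leRHS]mulr1 ler_wpM2l// mulr_ge0.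
  apply: le_trans; rewrite /hs big_distrl /= !big_distrr -big_split /=.
  apply: ler_sum => i _; rewrite !big_distrr -big_split /=.
  apply: ler_sum => j _; rewrite /T.
  have := sqr_ge0 (S i j + q * (x i * x j)).
  by set u := S i j; set v := x i; set w := x j => h; nra.
have TE a b : l2 a -> l2 b -> blim T a b = blim S a b - q * (dot a x * dot b x).
  move=> la lb; apply: cvg_lim => //.
  have E : (fun n => bform T n a b) = (fun n => bform S n a b -
      q * ((\sum_(i < n) a i * x i) * (\sum_(i < n) b i * x i))).
    apply/funext => n; rewrite /bform big_distrl big_distrr -sumrB /=.
    apply: eq_bigr => i _; rewrite !big_distrr -sumrB /=.
    by apply: eq_bigr => j _; rewrite /T; ring.
  rewrite E; apply: cvgB; first exact: blim_cvg.
  apply: cvgM; first exact: cvg_cst.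
  by apply: cvgM; apply: summ_cvg; exact: summ_sqr_mul.
have [|y [q2 [q20 ly yy Ty maxT]]] := hs_top_eigenvector HT symT lc.
  by rewrite TE// cx mul0r mulr0 subr0.
have yx : dot y x = 0.
  have : blim T x y = q2 * dot x y by exact: Ty.
  rewrite TE// (blimC symS) Sx// xx mul1r subrr (dotC x) => /esym/eqP.
  by rewrite mulf_eq0 gt_eqF//= => /eqP.
exists y, q2; split => // a la.
  by rewrite -Ty// TE// yx !mulr0 subr0.
by move=> ax; have := maxT a la; rewrite TE// ax mul0r mulr0 subr0.
Qed.

End HilbertSchmidt.

(** * Rules of continuity and differentiation *)

Section Calculus.
Variable R : realType.

Section Continuity.
Variable T : topologicalType.
Implicit Types f g : T -> R.

Lemma contD f g : continuous f -> continuous g -> continuous (fun x => f x + g x).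
Proof. by move=> cf cg x; exact: (continuousD (cf x) (cg x)). Qed.

Lemma contN f : continuous f -> continuous (fun x => - f x).
Proof. by move=> cf x; exact: (continuousN (cf x)). Qed.

Lemma contB f g : continuous f -> continuous g -> continuous (fun x => f x - g x).
Proof. by move=> cf cg; apply: contD => //; exact: contN. Qed.

Lemma contM f g : continuous f -> continuous g -> continuous (fun x => f x * g x).
Proof. by move=> cf cg x; exact: (continuousM (cf x) (cg x)). Qed.

Lemma contX f n : continuous f -> continuous (fun x => f x ^+ n).
Proof.
move=> cf; elim: n => [|n IH]; first exact: (@cst_continuous T R 1).
apply: (continuous_eq (f := fun x => f x * f x ^+ n)) => [x|]; first by rewrite exprS.
exact: contM.
Qed.

Lemma contcomp (U : topologicalType) (f : T -> U) (g : U -> R) :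
  continuous g -> continuous f -> continuous (fun x => g (f x)).
Proof. by move=> cg cf x; apply: continuous_comp; [exact: cf|exact: cg]. Qed.

Lemma contabs f : continuous f -> continuous (fun x => `|f x|).
Proof. by apply: contcomp; exact: norm_continuous. Qed.

Lemma contcst (c : R) : continuous (fun _ : T => c).
Proof. exact: cst_continuous. Qed.

Lemma contsum n (F : nat -> T -> R) : (forall i, continuous (F i)) ->
  continuous (fun x => \sum_(i < n) F i x).
Proof.
move=> cF; elim: n => [|n IH].
  by apply: (continuous_eq (f := cst 0)) => [b|]; [rewrite big_ord0|exact: cst_continuous].
apply: (continuous_eq (f := fun x => (\sum_(i < n) F i x) + F n x)) => [b|].
  by rewrite big_ord_recr.
exact: contD.
Qed.

(** Where f is at least e the function g has a positive minimum, and f is bounded. *)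
Lemma compact_domination (K : set T) f g (e : R) : compact K -> continuous f ->
  continuous g -> (forall k, K k -> 0 <= g k) ->
  (forall k, K k -> g k = 0 -> f k <= 0) -> 0 < e ->
  exists2 A, 0 <= A & forall k, K k -> f k <= e + A * g k.
Proof.
move=> cK cf cg g0 fg e0.
pose K' := K `&` f @^-1` [set y | e <= y].
have cK' : compact K'.
  apply: compact_closedI => //.
  by have /continuous_closedP/(_ _ (@closed_ge R e)) := cf.
have [[k0 Kk0]|noK] := pselect (K' !=set0); last first.
  exists 0 => // k Kk; rewrite mul0r addr0 leNgt; apply/negP => h.
  by apply: noK; exists k; split => //=; exact: ltW.
have K0 : K' !=set0 by exists k0.
have [c /set_mem[Kc fc] Hc] := compact_EVT_min K0 cK' (continuous_subspaceT cg).
have [d /set_mem[Kd fd] Hd] := compact_EVT_max K0 cK' (continuous_subspaceT cf).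
have gc : 0 < g c.
  rewrite lt_neqAle g0// andbT; apply/eqP => /esym h.
  by have := fg _ Kc h; rewrite leNgt (lt_le_trans e0).
have fd0 : 0 <= f d by apply: le_trans fd; exact: ltW.
exists (f d / g c) => [|k Kk]; first by rewrite divr_ge0// ltW.
have [h|h] := leP e (f k); last first.
  by rewrite (le_trans (ltW h))// lerDl mulr_ge0 ?g0// divr_ge0// ltW.
have K'k : K' k by [].
have h1 := Hd k (mem_set K'k); have h2 := Hc k (mem_set K'k).
apply: le_trans (_ : f d / g c * g k <= _); last by rewrite lerDr ltW.
by rewrite mulrAC ler_pdivlMr// (le_trans (ler_wpM2r (ltW gc) h1))// ler_wpM2l.
Qed.

Lemma compact_ubound (K : set T) f : compact K -> continuous f ->
  exists2 M, 0 <= M & forall k, K k -> `|f k| <= M.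
Proof.
move=> cK cf.
have one0 k : K k -> 1 = 0 :> R -> `|f k| <= 0 by move=> _ /eqP; rewrite oner_eq0.
have [A A0 HA] := compact_domination cK (contabs cf) (@contcst 1)
  (fun _ _ => ler01) one0 ltr01.
by exists (1 + A) => [|k Kk]; [rewrite addr_ge0|have := HA k Kk; rewrite mulr1].
Qed.

End Continuity.

Lemma contsin (T : topologicalType) (f : T -> R) : continuous f -> continuous (fun x => sin (f x)).
Proof. by apply: contcomp; exact: continuous_sin. Qed.

Lemma contcos (T : topologicalType) (f : T -> R) : continuous f -> continuous (fun x => cos (f x)).
Proof. by apply: contcomp; exact: continuous_cos. Qed.

Lemma contid : continuous (fun x : R => x).
Proof. by move=> x. Qed.

Lemma contfst : continuous (fun p : R * R => p.1).
Proof. by move=> p; exact: cvg_fst. Qed.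

Lemma contsnd : continuous (fun p : R * R => p.2).
Proof. by move=> p; exact: cvg_snd. Qed.

Lemma contpair (T : topologicalType) (f g : T -> R) : continuous f -> continuous g ->
  continuous (fun x => (f x, g x)).
Proof. by move=> cf cg x; exact: (cvg_pair (cf x) (cg x)). Qed.

Section Derivation.
Variable V : normedModType R.
Implicit Types (f g : V -> R) (p v : V).

Lemma derD f g p v a b : is_derive p v f a -> is_derive p v g b ->
  is_derive p v (fun x => f x + g x) (a + b).
Proof. exact: is_deriveD. Qed.

Lemma derB f g p v a b : is_derive p v f a -> is_derive p v g b ->
  is_derive p v (fun x => f x - g x) (a - b).
Proof. exact: is_deriveB. Qed.

Lemma derM f g p v a b : is_derive p v f a -> is_derive p v g b ->
  is_derive p v (fun x => f x * g x) (f p * b + g p * a).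
Proof. exact: is_deriveM. Qed.

Lemma dercst (c : R) p v : is_derive p v (fun _ => c) 0.
Proof. exact: is_derive_cst. Qed.

Lemma derZ f p v a k : is_derive p v f a -> is_derive p v (fun x => k * f x) (k * a).
Proof.
move=> h; have := derM (dercst k p v) h.
by rewrite mulr0 addr0.
Qed.

Lemma derE f p v a b : is_derive p v f a -> a = b -> is_derive p v f b.
Proof. by move=> + <-. Qed.

Lemma dersum n (F : nat -> V -> R) (d : nat -> R) p v :
  (forall i, is_derive p v (F i) (d i)) ->
  is_derive p v (fun x => \sum_(i < n) F i x) (\sum_(i < n) d i).
Proof.
move=> h; elim: n => [|n IH].
  rewrite big_ord0; have <- : (fun=> 0) = (fun x : V => \sum_(i < 0) F i x).
    by apply/funext => x; rewrite big_ord0.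
  exact: dercst.
rewrite big_ord_recr /=.
have <- : (fun x => (\sum_(i < n) F i x) + F n x) = (fun x : V => \sum_(i < n.+1) F i x).
  by apply/funext => x; rewrite big_ord_recr.
exact: derD.
Qed.

End Derivation.

Lemma derid (x : R) : is_derive x 1 (fun t : R => t) 1.
Proof. exact: is_derive_id. Qed.

Lemma dercomp (f g : R -> R) (x a b : R) : is_derive (g x) 1 f a -> is_derive x 1 g b ->
  is_derive x 1 (fun t => f (g t)) (a * b).
Proof. exact: is_derive1_comp. Qed.

Lemma dersin (x : R) : is_derive x 1 (@sin R) (cos x).
Proof. exact: is_derive_sin. Qed.

Lemma dercos (x : R) : is_derive x 1 (@cos R) (- sin x).
Proof. exact: is_derive_cos. Qed.

Lemma derpow n (f : R -> R) (x a : R) : is_derive x 1 f a ->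
  is_derive x 1 (fun t => f t ^+ n) (n%:R * f x ^+ n.-1 * a).
Proof.
move=> h; have E : (f ^+ n : R -> R) = (fun t => f t ^+ n).
  by apply/funext => t; elim: n => [//|n IH]; rewrite !exprS -IH.
by rewrite -E; exact: (is_deriveX n h).
Qed.

End Calculus.

Ltac cont1 :=
  lazymatch goal with
  | |- continuous (fun x => (@?a x + @?b x)%R) => refine (contD (f := a) (g := b) _ _)
  | |- continuous (fun x => (- @?a x)%R) => refine (contN (f := a) _)
  | |- continuous (fun x => (@?a x * @?b x)%R) => refine (contM (f := a) (g := b) _ _)
  | |- continuous (fun x => (@?a x ^+ ?n)%R) => refine (contX (f := a) (n := n) _)
  | |- continuous (fun x => sin (@?a x)) => refine (contsin (f := a) _)
  | |- continuous (fun x => cos (@?a x)) => refine (contcos (f := a) _)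
  | |- continuous (fun x => (`|@?a x|)%R) => refine (contabs (f := a) _)
  | |- continuous (fun x => (@?a x, @?b x)) => refine (contpair (f := a) (g := b) _ _)
  | |- _ => first [assumption | exact: contid | exact: contfst | exact: contsnd | exact: contcst]
  end.
Ltac cont := repeat cont1.

(** * Integration over [0, pi] *)

Section Mean.
Variable R : realType.
Implicit Types (f g F : R -> R).
Local Notation mu := (@lebesgue_measure R).
Local Notation pi := (@trigo.pi R).
Local Notation I0pi := (`[0, pi]%classic : set R).

(** Normalised so that the functions sin(m x), m >= 1, have unit mean square. *)
Definition mean f : R := 2 / pi * (\int[mu]_(x in I0pi) f x)%R.

Let pi0 : 0 < pi := pi_gt0 R.

Lemma mean_integrable f : continuous f -> mu.-integrable I0pi (EFin \o f).
Proof.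
move=> cf; apply: continuous_compact_integrable; first exact: segment_compact.
exact: continuous_subspaceT.
Qed.

Lemma eq_mean f g : (forall x, 0 <= x <= pi -> f x = g x) -> mean f = mean g.
Proof.
move=> fg; congr (_ * _); apply: eq_Rintegral => x.
by rewrite inE /= in_itv /= => /fg.
Qed.

Lemma meanD f g : continuous f -> continuous g ->
  mean (fun x => f x + g x) = mean f + mean g.
Proof.
by move=> cf cg; rewrite /mean RintegralD ?mulrDr//; exact: mean_integrable.
Qed.

Lemma meanZ f k : continuous f -> mean (fun x => k * f x) = k * mean f.
Proof.
move=> cf; rewrite /mean (RintegralZl k _ (mean_integrable cf))//.
by rewrite mulrCA.
Qed.

Lemma meanN f : continuous f -> mean (fun x => - f x) = - mean f.
Proof.
move=> cf; rewrite -mulN1r -meanZ//; apply: eq_mean => x _; by rewrite mulN1r.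
Qed.

Lemma meanB f g : continuous f -> continuous g ->
  mean (fun x => f x - g x) = mean f - mean g.
Proof. by move=> cf cg; rewrite meanD ?meanN//; exact: contN. Qed.

Lemma mean_ge0 f : (forall x, 0 <= x <= pi -> 0 <= f x) -> 0 <= mean f.
Proof.
move=> f0; rewrite mulr_ge0 ?divr_ge0// ?pi_ge0//; apply: Rintegral_ge0 => x.
by rewrite /= in_itv /= => /f0.
Qed.

Lemma ler_mean f g : continuous f -> continuous g ->
  (forall x, 0 <= x <= pi -> f x <= g x) -> mean f <= mean g.
Proof.
move=> cf cg fg; rewrite -subr_ge0 -meanB//; apply: mean_ge0 => x /fg.
by rewrite subr_ge0.
Qed.

Lemma mean_FTC F f : continuous f ->
  (forall x, 0 <= x <= pi -> is_derive x 1 F (f x)) ->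
  mean f = 2 / pi * (F pi - F 0).
Proof.
move=> cf dF; congr (_ * _).
have dc x : 0 <= x <= pi -> {for x, continuous F}.
  move=> hx; apply: differentiable_continuous; apply/derivable1_diffP.
  by have := dF x hx => -[].
rewrite /Rintegral (@continuous_FTC2 _ f F 0 pi)//.
- exact: continuous_subspaceT.
- split.
  + by move=> x; rewrite in_itv /= => /andP[a b]; have := dF x; rewrite !ltW// => /(_ isT) [].
  + by apply: cvg_at_right_filter; apply: dc; rewrite lexx ltW.
  + by apply: cvg_at_left_filter; apply: dc; rewrite lexx ltW.
- move=> x; rewrite in_itv /= => /andP[a b]; rewrite derive1E.
  by have := dF x; rewrite !ltW// => /(_ isT) h; rewrite derive_val.
Qed.

Lemma mean_cst c : mean (fun _ => c) = 2 * c.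
Proof.
have d (x : R) (_ : 0 <= x <= pi) : is_derive x 1 (fun x => c * x) c.
  by apply: derE (derZ c (derid x)) _; rewrite mulr1.
have p0 : pi != 0 by rewrite gt_eqF.
by rewrite (mean_FTC (@contcst R R c) d); move: (pi) p0 => p p0; field.
Qed.

Lemma mean_norm_le f M : continuous f -> (forall x, 0 <= x <= pi -> `|f x| <= M) ->
  `|mean f| <= 2 * M.
Proof.
move=> cf fM; rewrite ler_norml -mulrN -!mean_cst !ler_mean//; try exact: contcst.
- by move=> x /fM; rewrite ler_norml => /andP[].
- by move=> x /fM; rewrite ler_norml => /andP[].
Qed.

Lemma antiderivative f : continuous f ->
  exists F, forall x, 0 <= x <= pi -> is_derive x 1 F (f x).
Proof.
move=> cf; exists (fun x => \int[mu]_(t in `[(-1), x]) f t)%R => x /andP[x0 xpi].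
have intf : mu.-integrable `[(-1), pi + 1] (EFin \o f).
  apply: continuous_compact_integrable; first exact: segment_compact.
  exact: continuous_subspaceT.
have xp : x < pi + 1 by rewrite ltr_pwDr.
have x1 : -1 < x by rewrite (lt_le_trans _ x0)// oppr_lt0.
have [d e] := continuous_FTC1_closed xp intf x1 (cf x).
by apply: DeriveDef; [exact: d|rewrite -derive1E; exact: e].
Qed.

Lemma mean_reflect f : continuous f -> mean (fun x => f (pi - x)) = mean f.
Proof.
move=> cf; have [F dF] := antiderivative cf.
have cg : continuous (fun x => f (pi - x)).
  by apply: (contcomp (f := fun x : R => pi - x)) => //; cont.
have d (x : R) : 0 <= x <= pi -> is_derive x 1 (fun x => - 1 * F (pi - x)) (f (pi - x)).
  move=> /andP[a b].
  have h : is_derive (pi - x) 1 F (f (pi - x)).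
    by apply: dF; rewrite subr_ge0 b lerBlDr lerDl.
  have h1 := derB (dercst pi x 1) (derid x).
  have h2 := derZ (-1) (dercomp (g := fun t : R => pi - t) h h1).
  apply: (derE h2).
  ring.
by rewrite (mean_FTC cf dF) (mean_FTC cg d) subrr subr0; ring.
Qed.

(** A primitive of f is monotone with equal end values, hence constant. *)
Lemma mean_eq0 f : continuous f -> (forall x, 0 <= x <= pi -> 0 <= f x) ->
  mean f = 0 -> forall x, 0 < x < pi -> f x = 0.
Proof.
move=> cf f0 mf x /andP[x0 xpi]; have [F dF] := antiderivative cf.
have F0pi : F pi = F 0.
  apply/eqP; rewrite -subr_eq0; move/eqP: mf; rewrite (mean_FTC cf dF) mulf_eq0.
  by rewrite gt_eqF ?divr_gt0.
have mon a b : 0 <= a -> a < b -> b <= pi -> F a <= F b.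
  move=> a0 ab bpi.
  have dab y : y \in `]a, b[ -> is_derive y 1 F (f y).
    rewrite in_itv /= => /andP[ya yb]; apply: dF.
    by rewrite (le_trans a0 (ltW ya)) (le_trans (ltW yb) bpi).
  have cF : {within `[a, b], continuous F}.
    apply: derivable_within_continuous => y; rewrite in_itv /= => /andP[ya yb].
    have hy : 0 <= y <= pi by rewrite (le_trans a0 ya) (le_trans yb bpi).
    by have [] := dF y hy.
  have [c /[!in_itv]/= /andP[ca cb] e] := MVT ab dab cF.
  rewrite -subr_ge0 e mulr_ge0 ?subr_ge0 ?(ltW ab)//; apply: f0.
  by rewrite (le_trans a0 (ltW ca)) (le_trans (ltW cb) bpi).
have Fc y : 0 < y < pi -> F y = F 0.
  move=> /andP[y0 ypi]; apply/eqP; rewrite eq_le -{1}F0pi (mon _ _ (ltW y0) ypi (lexx _)).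
  exact: (mon _ _ (lexx _) y0 (ltW ypi)).
have d1 : is_derive x 1 F (f x) by apply: dF; rewrite !ltW.
have d2 : is_derive x 1 F 0.
  apply: (near_eq_is_derive _ (dercst (F 0) x 1)).
  have : \forall y \near x, y \in `]0, pi[.
    by apply: near_in_itvoo; rewrite in_itv /= x0.
  by apply: filterS => z; rewrite in_itv /= => /Fc ->.
have [_ e1] := d1; have [_ e2] := d2; by rewrite -e1 -e2.
Qed.

(** On a compact strip the increment of F in the parameter is at most any
    positive constant plus a multiple of the increment of the parameter. *)
Lemma mean_param_continuous (F : R * R -> R) : continuous F ->
  continuous (fun y => mean (fun x => F (x, y))).
Proof.
move=> cF y.
have cFy z : continuous (fun x => F (x, z)) by apply: contcomp => //; cont.
apply/cvgrPdist_lt => e e0; have e4 : 0 < e / 4 by rewrite divr_gt0.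
pose K : set (R * R) := I0pi `*` `[y - 1, y + 1]%classic.
have cK : compact K by apply: compact_setX; exact: segment_compact.
have c1 : continuous (fun p : R * R => `|F p - F (p.1, y)|).
  by apply: contabs; apply: contB => //; apply: contcomp => //; cont.
have c2 : continuous (fun p : R * R => `|p.2 - y|) by cont.
have [||A A0 HA] := compact_domination cK c1 c2 _ _ e4.
- by move=> k _; exact: normr_ge0.
- by move=> [a b] _ /= /eqP; rewrite normr_eq0 subr_eq0 => /eqP ->; rewrite subrr normr0.
pose d := Num.min 1 (e / (4 * (A + 1))).
have A1 : 0 < A + 1 by rewrite ltr_wpDl.
have d0 : 0 < d by rewrite lt_min ltr01 divr_gt0// mulr_gt0.
have C : (fun z : R => z) z @[z --> y] --> y by exact: cvg_id.
have /cvgrPdist_lt/(_ _ d0) := C; apply: filterS => z; rewrite /d lt_min => /andP[z1 z2].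
rewrite -meanB//; apply: le_lt_trans (_ : 2 * (e / 4 + A * `|z - y|) < _).
  apply: mean_norm_le => [|x hx]; first exact: contB.
  have /= := HA (x, z); rewrite distrC; apply; split => /=; first by rewrite in_itv.
  by rewrite in_itv /=; move: z1; rewrite distrC ltr_norml; lra.
rewrite distrC; move: z2; rewrite ltr_pdivlMr ?mulr_gt0// => z2.
have : `|y - z| * A <= `|y - z| * (A + 1) by rewrite ler_wpM2l// lerDl.
by move: z2; rewrite mulrCA; lra.
Qed.

End Mean.

(** * Double series and orthogonality of sines *)

Section DoubleIndex.

Lemma idx_exists : exists e : nat -> nat * nat, bijective e.
Proof.
have /card_esym/card_set_bijP[e be] := card_nat2.
by exists e; rewrite -setTT_bijective.
Qed.

(** An enumeration of the pairs of frequencies, so that double series are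
    ordinary series. *)
Definition idx : nat -> nat * nat := sval (cid idx_exists).

Lemma idx_bij : bijective idx.
Proof. exact: (svalP (cid idx_exists)). Qed.

Lemma sum_idx_le (R : realType) (g : nat -> nat -> R) n :
  (forall i j, 0 <= g i j) -> exists K,
  \sum_(i < n) g (idx i).1 (idx i).2 <= \sum_(i < K) \sum_(j < K) g i j.
Proof.
move=> g0.
pose K := (\max_(i < n) maxn (idx i).1 (idx i).2).+1.
have lt1 (i : 'I_n) : ((idx i).1 < K)%N.
  by rewrite ltnS (leq_trans _ (leq_bigmax i))// leq_maxl.
have lt2 (i : 'I_n) : ((idx i).2 < K)%N.
  by rewrite ltnS (leq_trans _ (leq_bigmax i))// leq_maxr.
exists K; rewrite pair_big /=.
pose f (i : 'I_n) := (Ordinal (lt1 i), Ordinal (lt2 i)).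
have fI : injective f.
  move=> i j [e1 e2]; apply: val_inj; apply: (bij_inj idx_bij) => /=.
  by rewrite [LHS]surjective_pairing [RHS]surjective_pairing e1 e2.
rewrite (eq_bigr (fun i => g (f i).1 (f i).2))//.
rewrite -(big_imset (fun p : 'I_K * 'I_K => g p.1 p.2)) /=; last by move=> i j _ _; exact: fI.
rewrite big_mkcond /=; apply: ler_sum => p _; case: ifP => // _; exact: g0.
Qed.

Lemma sum_idx_prod_le (R : realType) (g h : nat -> R) A B n :
  (forall i, 0 <= g i) -> (forall i, 0 <= h i) ->
  (forall k, \sum_(i < k) g i <= A) -> (forall k, \sum_(i < k) h i <= B) ->
  \sum_(i < n) g (idx i).1 * h (idx i).2 <= A * B.
Proof.
move=> g0 h0 gA hB.
have [K] := sum_idx_le n (fun i j => mulr_ge0 (g0 i) (h0 j)).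
move/le_trans; apply.
under eq_bigr do rewrite -big_distrr /=.
by rewrite -big_distrl /=; apply: ler_pM; rewrite ?gA ?hB ?sumr_ge0.
Qed.

Lemma sum_inv_sqr (R : realType) n : \sum_(i < n) (i.+1%:R ^+ 2)^-1 <= 2 :> R.
Proof.
case: n => [|n]; first by rewrite big_ord0.
suff : \sum_(i < n.+1) (i.+1%:R ^+ 2)^-1 <= 2 - (n.+1%:R)^-1 :> R.
  by move/le_trans; apply; rewrite gerBl invr_ge0.
elim: n => [|n IH]; first by rewrite big_ord1 expr1n invr1; lra.
rewrite big_ord_recr /=; apply: le_trans (lerD IH (lexx _)) _.
have key (x : R) : 0 <= x ->
    2 - (x + 1)^-1 + ((x + 1 + 1) ^+ 2)^-1 <= 2 - (x + 1 + 1)^-1.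
  move=> x0; rewrite -subr_ge0.
  have -> : 2 - (x + 1 + 1)^-1 - (2 - (x + 1)^-1 + ((x + 1 + 1) ^+ 2)^-1) =
      (x + 1)^-1 / (x + 1 + 1) ^+ 2 by field; apply/andP; split; lra.
  by rewrite divr_ge0 ?invr_ge0 ?sqr_ge0//; lra.
by have := key n%:R (ler0n _ _); rewrite !natr1.
Qed.

End DoubleIndex.

Section Trig.
Variable R : realType.
Local Notation pi := (@trigo.pi R).

Lemma sin_npi k : sin (k%:R * pi) = 0 :> R.
Proof.
elim: k => [|k IH]; first by rewrite mul0r sin0.
by rewrite -natr1 mulrDl mul1r sinDpi IH oppr0.
Qed.

Lemma mean_cos (k : nat) : mean (fun x : R => cos (k%:R * x)) = 2 * (k == 0)%N%:R.
Proof.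
case: k => [|k] /=.
  by rewrite -[X in 2 * X]/1 -[in RHS]mean_cst; apply: eq_mean => x _; rewrite mul0r cos0.
have k0 : k.+1%:R != 0 :> R by rewrite pnatr_eq0.
have d (x : R) (_ : 0 <= x <= pi) :
    is_derive x 1 (fun x => k.+1%:R^-1 * sin (k.+1%:R * x)) (cos (k.+1%:R * x)).
  have h := derZ k.+1%:R (derid x).
  have h2 := dercomp (g := fun t : R => k.+1%:R * t) (dersin (k.+1%:R * x)) h.
  by apply: (derE (derZ k.+1%:R^-1 h2)); rewrite mulr1 mulrCA mulVf ?mulr1.
rewrite (mean_FTC _ d); last by cont.
by rewrite sin_npi !mulr0 sin0 mulr0 subrr !mulr0.
Qed.

Lemma sin_mul_sin (x y : R) : sin x * sin y = 1 / 2 * (cos (x - y) - cos (x + y)).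
Proof. by rewrite cosB cosD; lra. Qed.

Definition sn (m : nat) (x : R) : R := sin (m.+1%:R * x).

Lemma sn_cont m : continuous (sn m).
Proof. by rewrite /sn; cont. Qed.

Lemma sn_mul (m k : nat) (x : R) : (m <= k)%N ->
  sn m x * sn k x = 1 / 2 * (cos ((k - m)%N%:R * x) - cos ((m + k).+2%:R * x)).
Proof.
move=> mk; rewrite /sn sin_mul_sin -cosN; congr (_ * (cos _ - cos _)).
  rewrite natrB// -!natr1; ring.
by rewrite -!natr1 natrD; ring.
Qed.

Lemma mean_sn m k : mean (fun x => sn m x * sn k x) = (m == k)%:R.
Proof.
wlog mk : m k / (m <= k)%N.
  move=> h; case: (leqP m k) => [|/ltnW] mk; first exact: h.
  by rewrite eq_sym -h//; apply: eq_mean => x _; rewrite mulrC.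
transitivity (mean (fun x : R => 1 / 2 * (cos ((k - m)%N%:R * x) - cos ((m + k).+2%:R * x)))).
  by apply: eq_mean => x _; exact: sn_mul.
rewrite meanZ; last by cont.
rewrite meanB; [|by cont..].
rewrite !mean_cos subn_eq0 /= mulr0 subr0 (_ : (m == k) = (k <= m)%N).
  by field.
by rewrite eqn_leq mk.
Qed.

End Trig.

(** * Sine coefficients on the rectangle *)

Section Rectangle.
Variables (R : realType) (L r : R).
Hypotheses (L0 : 0 < L) (r0 : 0 < r).
Local Notation pi := (@trigo.pi R).
Implicit Types (f g : R * R -> R) (p : R * R).

Let pi_pos : 0 < pi := pi_gt0 R.
Let pi_neq0 : pi != 0 := lt0r_neq0 pi_pos.

Definition crect : set (R * R) := [set p | - L <= p.1 <= L /\ - r <= p.2 <= r].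

(** The affine bijection from [0, pi] to [-l, l]. *)
Definition unangle (l x : R) : R := l * (2 / pi * x - 1).

Lemma unangle_cont l : continuous (unangle l).
Proof. by rewrite /unangle; cont. Qed.

Lemma unangle_itv l x : 0 < l -> 0 <= x <= pi -> - l <= unangle l x <= l.
Proof.
move=> l0 /andP[x0 xpi]; rewrite /unangle.
have h1 : 0 <= 2 / pi * x by rewrite mulr_ge0// divr_ge0// ltW.
have h2 : 2 / pi * x <= 2 by rewrite mulrAC ler_pdivrMr// ler_pM2l.
by apply/andP; split; nra.
Qed.

Lemma unangleK l y : l != 0 -> unangle l (pi / 2 * (y / l + 1)) = y.
Proof.
move=> l0; rewrite /unangle; move: (pi) pi_neq0 => P P0; field.
by rewrite l0.
Qed.

Lemma angle_itv l y : 0 < l -> - l <= y <= l -> 0 <= pi / 2 * (y / l + 1) <= pi.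
Proof.
move=> l0 /andP[y1 y2].
have h1 : -1 <= y / l by rewrite ler_pdivlMr// mulN1r.
have h2 : y / l <= 1 by rewrite ler_pdivrMr// mul1r.
by apply/andP; split; have := pi_pos; nra.
Qed.

Lemma angle_itvo l y : 0 < l -> - l < y < l -> 0 < pi / 2 * (y / l + 1) < pi.
Proof.
move=> l0 /andP[y1 y2].
have h1 : -1 < y / l by rewrite ltr_pdivlMr// mulN1r.
have h2 : y / l < 1 by rewrite ltr_pdivrMr// mul1r.
by apply/andP; split; have := pi_pos; nra.
Qed.

(** Four times the average over the rectangle, so that the Dirichlet sine
    functions are orthonormal. *)
Definition Imean f : R :=
  mean (fun y => mean (fun x => f (unangle L x, unangle r y))).

Let cont_pair : continuous (fun p => (unangle L p.1, unangle r p.2)).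
Proof. by rewrite /unangle; cont. Qed.

Let cont_inner f y : continuous f -> continuous (fun x => f (unangle L x, unangle r y)).
Proof.
move=> cf; apply: (contcomp (f := fun x => (unangle L x, unangle r y))) => //.
by rewrite /unangle; cont.
Qed.

Let cont_outer f : continuous f ->
  continuous (fun y => mean (fun x => f (unangle L x, unangle r y))).
Proof.
move=> cf.
apply: (mean_param_continuous (F := fun p => f (unangle L p.1, unangle r p.2))).
exact: (contcomp cf cont_pair).
Qed.

Lemma unangle_crect x y : 0 <= x <= pi -> 0 <= y <= pi ->
  crect (unangle L x, unangle r y).
Proof. by move=> hx hy; split => /=; exact: unangle_itv. Qed.

Lemma eq_Imean f g : (forall p, crect p -> f p = g p) -> Imean f = Imean g.
Proof.
move=> fg; apply: eq_mean => y hy; apply: eq_mean => x hx.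
by apply: fg; exact: unangle_crect.
Qed.

Lemma ImeanD f g : continuous f -> continuous g ->
  Imean (fun p => f p + g p) = Imean f + Imean g.
Proof.
move=> cf cg; rewrite -meanD; [|exact: cont_outer..].
by apply: eq_mean => y _; rewrite meanD//; exact: cont_inner.
Qed.

Lemma ImeanZ f k : continuous f -> Imean (fun p => k * f p) = k * Imean f.
Proof.
move=> cf; rewrite -meanZ; last exact: cont_outer.
by apply: eq_mean => y _; rewrite meanZ//; exact: cont_inner.
Qed.

Lemma ImeanB f g : continuous f -> continuous g ->
  Imean (fun p => f p - g p) = Imean f - Imean g.
Proof.
move=> cf cg; have cN : continuous (fun p => -1 * g p) by cont.
transitivity (Imean (fun p => f p + -1 * g p)).
  by apply: eq_Imean => p _; rewrite mulN1r.
by rewrite (ImeanD cf cN) (ImeanZ _ cg) mulN1r.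
Qed.

Lemma Imean_ge0 f : (forall p, crect p -> 0 <= f p) -> 0 <= Imean f.
Proof.
move=> f0; apply: mean_ge0 => y hy; apply: mean_ge0 => x hx.
by apply: f0; exact: unangle_crect.
Qed.

Lemma ler_Imean f g : continuous f -> continuous g ->
  (forall p, crect p -> f p <= g p) -> Imean f <= Imean g.
Proof.
move=> cf cg fg; rewrite -subr_ge0 -ImeanB//; apply: Imean_ge0 => p /fg.
by rewrite subr_ge0.
Qed.

Lemma Imean_cst c : Imean (fun _ => c) = 4 * c.
Proof. by rewrite /Imean !mean_cst; ring. Qed.

Lemma Imean_norm_le f M : continuous f -> (forall p, crect p -> `|f p| <= M) ->
  `|Imean f| <= 4 * M.
Proof.
move=> cf fM; have cc c : continuous (fun _ : R * R => c : R) by exact: contcst.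
rewrite ler_norml -mulrN -!Imean_cst; apply/andP; split; apply: ler_Imean => //.
- by move=> x /fM; rewrite ler_norml => /andP[].
- by move=> x /fM; rewrite ler_norml => /andP[].
Qed.

Lemma Imean_prod (g h : R -> R) : continuous g -> continuous h ->
  Imean (fun p => g p.1 * h p.2) =
  mean (fun x => g (unangle L x)) * mean (fun y => h (unangle r y)).
Proof.
move=> cg ch.
have cgL : continuous (fun x => g (unangle L x)) by exact: (contcomp cg (@unangle_cont L)).
have chr : continuous (fun x => h (unangle r x)) by exact: (contcomp ch (@unangle_cont r)).
rewrite -meanZ//; apply: eq_mean => y _ /=.
by rewrite mulrC -meanZ//; apply: eq_mean => x _; rewrite mulrC.
Qed.

Lemma Imean_sum n (F : nat -> R * R -> R) : (forall i, continuous (F i)) ->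
  Imean (fun p => \sum_(i < n) F i p) = \sum_(i < n) Imean (F i).
Proof.
move=> cF; elim: n => [|n IH].
  rewrite big_ord0; transitivity (Imean (fun=> 0)); last by rewrite Imean_cst mulr0.
  by apply: eq_Imean => p _; rewrite big_ord0.
rewrite big_ord_recr /= -IH -(ImeanD (contsum cF) (cF n)).
by apply: eq_Imean => p _; rewrite big_ord_recr.
Qed.

Lemma orectP p : open_rectangle L r p <-> (- L < p.1 < L /\ - r < p.2 < r).
Proof. by rewrite /open_rectangle /=; split => -[/= a b]; split; move: a b => /=; rewrite ?in_itv. Qed.

Lemma orect_crect p : open_rectangle L r p -> crect p.
Proof. by move=> /orectP[/andP[a b] /andP[c d]]; split; rewrite !ltW. Qed.

Lemma Imean_eq0 f : continuous f -> (forall p, crect p -> 0 <= f p) ->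
  Imean f = 0 -> forall p, open_rectangle L r p -> f p = 0.
Proof.
move=> cf f0 If p /orectP[h1 h2].
have h1' := angle_itvo L0 h1; have h2' := angle_itvo r0 h2.
have lt_le (x : R) : 0 < x < pi -> 0 <= x <= pi by move=> /andP[a b]; rewrite !ltW.
have pos x y : 0 <= x <= pi -> 0 <= y <= pi -> 0 <= f (unangle L x, unangle r y).
  by move=> hx hy; apply: f0; exact: unangle_crect.
have pos' y : 0 <= y <= pi -> 0 <= mean (fun x => f (unangle L x, unangle r y)).
  by move=> hy; apply: mean_ge0 => x hx; exact: pos.
have E := mean_eq0 (cont_outer cf) pos' If h2'.
have := mean_eq0 (cont_inner cf) (fun x hx => pos _ _ hx (lt_le _ h2')) E h1'.
by rewrite !unangleK ?gt_eqF// -surjective_pairing.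
Qed.

Lemma crect_compact : compact crect.
Proof.
have -> : crect = (`[- L, L]%classic `*` `[- r, r]%classic).
  by apply/seteqP; split => p /=; rewrite /crect /= !in_itv.
by apply: compact_setX; exact: segment_compact.
Qed.

Lemma crect_bounded f : continuous f ->
  exists2 M, 0 <= M & forall p, crect p -> `|f p| <= M.
Proof. by move=> cf; exact: (compact_ubound crect_compact cf). Qed.

Definition ax : R := pi / (2 * L).
Definition ay : R := pi / (2 * r).
Definition fm (i : nat) : R := (idx i).1.+1%:R.
Definition fn (i : nat) : R := (idx i).2.+1%:R.
Definition trg (s : bool) : R -> R := if s then sin else cos.

(** The products of a sine or cosine in each variable; the eigenfunctions of
    the Dirichlet Laplacian of the rectangle are the sine-sine products, and
    differentiation permutes the four kinds up to factors. *)
Definition tprod (s1 s2 : bool) (i : nat) p : R :=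
  trg s1 (fm i * ax * (p.1 + L)) * trg s2 (fn i * ay * (p.2 + r)).
Definition phi : nat -> R * R -> R := tprod true true.
(** The eigenvalue of the Dirichlet Laplacian for the sine function phi i. *)
Definition kap (i : nat) : R := (fm i * ax) ^+ 2 + (fn i * ay) ^+ 2.
Definition coef f (i : nat) : R := Imean (fun p => f p * phi i p).

Lemma ax_gt0 : 0 < ax. Proof. by rewrite divr_gt0// mulr_gt0. Qed.
Lemma ay_gt0 : 0 < ay. Proof. by rewrite divr_gt0// mulr_gt0. Qed.
Lemma fm_ge1 i : 1 <= fm i. Proof. by rewrite /fm ler1n. Qed.
Lemma fn_ge1 i : 1 <= fn i. Proof. by rewrite /fn ler1n. Qed.

Lemma kap_gt0 i : 0 < kap i.
Proof.
by rewrite ltr_pwDl ?sqr_ge0// exprn_gt0// mulr_gt0 ?ax_gt0// (lt_le_trans _ (fm_ge1 i)).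
Qed.

Lemma trg_le1 s x : `|trg s x| <= 1.
Proof. by case: s; [exact: sin_max|exact: cos_max]. Qed.

Lemma tprod_le1 s1 s2 i p : `|tprod s1 s2 i p| <= 1.
Proof. by rewrite normrM -[leRHS]mulr1 ler_pM// trg_le1. Qed.

Lemma phi_le1 i p : `|phi i p| <= 1.
Proof. exact: tprod_le1. Qed.

Lemma trg_cont s : continuous (trg s).
Proof. by case: s; [exact: continuous_sin|exact: continuous_cos]. Qed.

Lemma tprod_cont s1 s2 i : continuous (tprod s1 s2 i).
Proof.
apply: contM; apply: contcomp; try exact: trg_cont; cont.
Qed.

Lemma phi_cont i : continuous (phi i).
Proof. exact: tprod_cont. Qed.

Lemma angleE l x : l != 0 -> pi / (2 * l) * (unangle l x + l) = x.
Proof.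
move=> l0; rewrite /unangle; move: (pi) pi_neq0 => P P0; field.
by rewrite ?l0 ?P0.
Qed.

Lemma Imean_phi i j : Imean (fun p => phi i p * phi j p) = (i == j)%:R.
Proof.
pose s l k i := fun t : R => sin (i * (pi / (2 * l)) * (t + k)) : R.
have sE l (m : nat) x : l != 0 -> s l l m.+1%:R (unangle l x) = sn m x.
  by move=> l0; rewrite /s /sn -mulrA angleE.
transitivity (Imean (fun p => (s L L (fm i) p.1 * s L L (fm j) p.1) *
    (s r r (fn i) p.2 * s r r (fn j) p.2))).
  by apply: eq_Imean => p _; rewrite /phi /tprod /s /= /ax /ay; ring.
have cs l k a : continuous (s l k a) by rewrite /s; cont.
rewrite (Imean_prod (g := fun x => s L L (fm i) x * s L L (fm j) x)
  (h := fun y => s r r (fn i) y * s r r (fn j) y)); [|by cont; exact: cs..].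
have E l m k : l != 0 -> mean (fun x => s l l m.+1%:R (unangle l x) *
    s l l k.+1%:R (unangle l x)) = (m == k)%:R.
  by move=> l0; rewrite -mean_sn; apply: eq_mean => x _; rewrite !sE.
rewrite /fm /fn (E L _ _ (lt0r_neq0 L0)) (E r _ _ (lt0r_neq0 r0)) -natrM mulnb; congr (_%:R).
rewrite -(inj_eq (bij_inj idx_bij) i j).
by case: (idx i) (idx j) => [a b] [c d]; rewrite xpair_eqE.
Qed.

Lemma psum_cont (c : nat -> R) n : continuous (fun p => \sum_(i < n) c i * phi i p).
Proof.
have cphi i : continuous (phi i) by exact: phi_cont.
by apply: (contsum (F := fun i p => c i * phi i p)) => i; have := cphi i => ?; cont.
Qed.

Lemma Imean_mul_psum (c : nat -> R) n (h : R * R -> R) : continuous h ->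
  Imean (fun p => h p * \sum_(i < n) c i * phi i p) = \sum_(i < n) c i * coef h i.
Proof.
move=> ch; have cphi i : continuous (phi i) by exact: phi_cont.
transitivity (Imean (fun p => \sum_(i < n) c i * (h p * phi i p))).
  by apply: eq_Imean => p _; rewrite big_distrr; apply: eq_bigr => i _ /=; ring.
have chp i : continuous (fun p => h p * phi i p) by have := cphi i => ?; cont.
have cc i : continuous (fun p => c i * (h p * phi i p)) by have := chp i => ?; cont.
by rewrite (Imean_sum _ cc); apply: eq_bigr => i _; rewrite ImeanZ.
Qed.

Lemma coef_psum (c : nat -> R) n i :
  coef (fun p => \sum_(j < n) c j * phi j p) i = if (i < n)%N then c i else 0.
Proof.
rewrite /coef.
transitivity (Imean (fun p => phi i p * \sum_(j < n) c j * phi j p)).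
  by apply: eq_Imean => p _; rewrite mulrC.
rewrite (Imean_mul_psum _ _ (@phi_cont i)).
have E (j : 'I_n) : c j * coef (phi i) j = if (j : nat) == i then c i else 0.
  rewrite /coef Imean_phi eq_sym; case: eqP => [->|_]; first by rewrite mulr1.
  by rewrite mulr0.
rewrite (eq_bigr _ (fun j _ => E j)) -big_mkcond /=.
case: ltnP => hi; first by rewrite (big_pred1 (Ordinal hi)).
by rewrite big_pred0// => j; apply: ltn_eqF; exact: leq_trans hi.
Qed.

Lemma bessel f n : continuous f ->
  \sum_(i < n) coef f i ^+ 2 <= Imean (fun p => f p ^+ 2).
Proof.
move=> cf.
pose g p := \sum_(i < n) coef f i * phi i p.
have cg : continuous g by exact: psum_cont.
have If := Imean_mul_psum (coef f) n.
have : 0 <= Imean (fun p => (f p - g p) ^+ 2) by apply: Imean_ge0 => p _; exact: sqr_ge0.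
have -> : Imean (fun p => (f p - g p) ^+ 2) =
    Imean (fun p => f p ^+ 2) - 2 * Imean (fun p => f p * g p) + Imean (fun p => g p * g p).
  rewrite -ImeanZ; last by cont.
  rewrite -ImeanB; [|by cont..].
  rewrite -ImeanD; [|by cont..].
  by apply: eq_Imean => p _; ring.
have Eg : Imean (fun p => g p * g p) = \sum_(i < n) coef f i * coef f i.
  by rewrite (If g cg); apply: eq_bigr => i _; rewrite coef_psum ltn_ord.
have <- : \sum_(i < n) coef f i * coef f i = \sum_(i < n) coef f i ^+ 2.
  by apply: eq_bigr => i _; rewrite expr2.
rewrite (If f cf) Eg; move: (Imean _) (\sum_(i < n) _) => A S; lra.
Qed.

Lemma phi_bdry i p : crect p -> ~ open_rectangle L r p -> phi i p = 0.
Proof.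
move=> [/andP[a b] /andP[c d]] np.
have tr (l y : R) (m : nat) : 0 < l -> (y == - l) || (y == l) ->
    sin (m.+1%:R * (pi / (2 * l)) * (y + l)) = 0.
  move=> l0 /orP[/eqP ->|/eqP ->]; first by rewrite addNr mulr0 sin0.
  rewrite (_ : _ * (l + l) = m.+1%:R * pi) ?sin_npi//.
  have l1 : l != 0 by rewrite gt_eqF.
  by move: (pi) => P; field.
have : [|| p.1 == - L, p.1 == L, p.2 == - r | p.2 == r].
  apply/negPn/negP; rewrite !negb_or => /and4P[h1 h2 h3 h4].
  apply: np; apply/orectP; rewrite !lt_neqAle a b c d h2 h4 !andbT.
  by rewrite eq_sym h1 eq_sym h3.
rewrite orbA => /orP[h|h]; rewrite /phi /tprod /trg.
  by rewrite (tr L)// mul0r.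
by rewrite [X in _ * X](tr r)// mulr0.
Qed.

(** The square of a sum of two squares is at least the product of the squares,
    so the double series is dominated by a product of two convergent series. *)
Lemma sum_inv_kap_sqr : exists M, forall n, \sum_(i < n) (kap i ^+ 2)^-1 <= M.
Proof.
pose c := (ax ^+ 2 * ay ^+ 2)^-1.
have ax0 := ax_gt0; have ay0 := ay_gt0.
have c0 : 0 <= c by rewrite invr_ge0 mulr_ge0// sqr_ge0.
exists (c * (2 * 2)) => n.
apply: le_trans (_ : \sum_(i < n) c * ((fm i ^+ 2)^-1 * (fn i ^+ 2)^-1) <= _).
  apply: ler_sum => i _.
  have m1 : 0 < fm i by rewrite (lt_le_trans _ (fm_ge1 i)).
  have n1 : 0 < fn i by rewrite (lt_le_trans _ (fn_ge1 i)).
  have pos : 0 < ax ^+ 2 * ay ^+ 2 * (fm i ^+ 2 * fn i ^+ 2).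
    by apply: mulr_gt0; apply: mulr_gt0; apply: exprn_gt0.
  rewrite /c -!invfM lef_pV2 ?posrE ?pos ?exprn_gt0 ?kap_gt0//.
  rewrite /kap; have := sqr_ge0 ((fm i * ax) ^+ 2 - (fn i * ay) ^+ 2).
  have := mulr_gt0 m1 ax0; have := mulr_gt0 n1 ay0.
  rewrite (_ : ax ^+ 2 * ay ^+ 2 * _ = (fm i * ax) ^+ 2 * (fn i * ay) ^+ 2); last by ring.
  by set u := fm i * ax; set v := fn i * ay => v0 u0; have := mulr_ge0 (sqr_ge0 u) (sqr_ge0 v); nra.
rewrite -big_distrr /= ler_wpM2l//.
by apply: (sum_idx_prod_le (g := fun k => (k.+1%:R ^+ 2)^-1) (h := fun k => (k.+1%:R ^+ 2)^-1));
  [move=> k; rewrite invr_ge0 sqr_ge0..|exact: sum_inv_sqr|exact: sum_inv_sqr].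
Qed.

End Rectangle.

(** * Decay of the sine coefficients of powers *)

Section GeometricPolynomial.
Variable R : realType.

Definition pgeo (d : nat) (q : R) (N : nat) : R :=
  \sum_(n < N) n.+1%:R ^+ d * q ^+ n.

Lemma pow_succ_diff d (n : nat) :
  n.+1%:R ^+ d.+1 - n%:R ^+ d.+1 <= d.+1%:R * n.+1%:R ^+ d :> R.
Proof.
elim: d => [|d IH]; first by rewrite !expr1 expr0 -natr1; lra.
rewrite (exprS _ d.+1) (exprS n%:R d.+1).
have h : n%:R ^+ d.+1 <= n.+1%:R ^+ d.+1 :> R by rewrite lerXn2r ?nnegrE// ler_nat.
have n0 : 0 <= n%:R :> R by [].
have h2 : n.+1%:R * (n.+1%:R ^+ d.+1 - n%:R ^+ d.+1) <= d.+1%:R * n.+1%:R ^+ d.+1 :> R.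
  by rewrite [X in _ <= _ * X]exprS mulrCA ler_wpM2l.
move: h h2; rewrite -(natr1 d.+1).
set A := n.+1%:R ^+ d.+1; set B := n%:R ^+ d.+1; rewrite -(natr1 n).
by move: (n%:R) (d.+1%:R : R) A B => x k A B; lra.
Qed.

(** Multiplication by 1 - q and summation by parts lower the exponent d by one. *)
Lemma pgeo_bounded d (q : R) : 0 <= q -> q < 1 -> exists C, forall N, pgeo d q N <= C.
Proof.
move=> q0 q1; have q1' : 0 < 1 - q by rewrite subr_gt0.
elim: d => [|d [C HC]].
  exists (1 - q)^-1 => N; rewrite -[leRHS]mul1r ler_pdivlMr//.
  suff : pgeo 0 q N * (1 - q) = 1 - q ^+ N by move=> ->; rewrite gerBl exprn_ge0.
  elim: N => [|N IH]; first by rewrite /pgeo big_ord0 mul0r expr0 subrr.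
  by rewrite /pgeo big_ord_recr /= mulrDl -/(pgeo 0 q N) IH expr0 exprS; ring.
exists (d.+1%:R * C / (1 - q)) => N; rewrite ler_pdivlMr//.
have E : pgeo d.+1 q N * (1 - q) + N%:R ^+ d.+1 * q ^+ N =
    \sum_(n < N) (n.+1%:R ^+ d.+1 - n%:R ^+ d.+1) * q ^+ n.
  elim: N => [|N IH]; first by rewrite /pgeo !big_ord0 mul0r expr0n /= mul0r addr0.
  rewrite big_ord_recr /= -IH /pgeo big_ord_recr /= -/(pgeo _ _ _).
  by rewrite (exprS q); ring.
apply: le_trans (_ : pgeo d.+1 q N * (1 - q) + N%:R ^+ d.+1 * q ^+ N <= _).
  by rewrite lerDl mulr_ge0// exprn_ge0.
rewrite E; apply: le_trans (ler_wpM2l (ler0n _ d.+1) (HC N)).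
rewrite /pgeo big_distrr /=; apply: ler_sum => n _; rewrite mulrA.
by rewrite ler_wpM2r ?exprn_ge0// pow_succ_diff.
Qed.

Lemma pgeo_term d (q : R) N : 0 <= q -> N.+1%:R ^+ d * q ^+ N <= pgeo d q N.+1.
Proof.
move=> q0; rewrite /pgeo big_ord_recr /= lerDr.
by apply: sumr_ge0 => i _; rewrite mulr_ge0// exprn_ge0.
Qed.

Lemma inv_sqr_series (s : R) N : s != 1 ->
  (1 - s) ^- 2 - \sum_(n < N) n.+1%:R * s ^+ n =
  s ^+ N * (N.+1%:R - N%:R * s) / (1 - s) ^+ 2.
Proof.
move=> s1; have d0 : 1 - s != 0 by rewrite subr_eq0 eq_sym.
elim: N => [|N IH].
  by rewrite big_ord0 subr0 expr0 mul0r subr0 mul1r div1r.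
rewrite big_ord_recr /= opprD addrA IH -!natr1 (exprS s N).
by move: (s ^+ N) (N%:R : R) => A x; field.
Qed.

End GeometricPolynomial.

Section Decay.
Variable R : realType.
Local Notation pi := (@trigo.pi R).

Definition decay (k : nat) : R := if k is 0 then 1 else (k%:R ^+ 2)^-1.

Lemma decay_ge0 k : 0 <= decay k.
Proof. by case: k => [|k] //=; rewrite invr_ge0 sqr_ge0. Qed.

Lemma sum_decay n : \sum_(k < n) decay k <= 3.
Proof.
case: n => [|n]; first by rewrite big_ord0.
rewrite big_ord_recl /=; have := sum_inv_sqr R n.
by rewrite /decay /=; lra.
Qed.

Lemma sum_inj_le (I : finType) (P : pred I) (f : I -> nat) (g : nat -> R) :
  {in P &, injective f} -> (forall k, 0 <= g k) ->
  exists K, \sum_(i | P i) g (f i) <= \sum_(k < K) g k.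
Proof.
move=> fI g0; pose K := (\max_i f i).+1; exists K.
have lt i : (f i < K)%N by rewrite ltnS; exact: leq_bigmax.
pose h i := Ordinal (lt i).
rewrite (eq_bigr (fun i => g (h i)))//.
rewrite -(big_imset (fun k : 'I_K => g k)) /=; last first.
  by move=> i j iP jP [e]; exact: fI.
rewrite big_mkcond /=; apply: ler_sum => p _; case: ifP => // _; exact: g0.
Qed.

Lemma sum_decay_inj (I : finType) (P : pred I) (f : I -> nat) :
  {in P &, injective f} -> \sum_(i | P i) decay (f i) <= 3.
Proof.
move=> fI; have [K] := sum_inj_le fI decay_ge0.
by move/le_trans; apply; exact: sum_decay.
Qed.

(** The affine coordinate running from -1 to 1 along the side. *)
Definition side (x : R) : R := 2 / pi * x - 1.
Local Notation z := side.

Let z_le1 x : 0 <= x <= pi -> `|z x| <= 1.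
Proof.
move=> hx; have := unangle_itv (ltr01 : 0 < (1 : R)) hx.
by rewrite /unangle mul1r ler_norml.
Qed.

Lemma side_cont : continuous z. Proof. by rewrite /side; cont. Qed.
Let z_cont := side_cont.

Let twopi : 0 <= 2 / pi <= 1.
Proof.
by rewrite divr_ge0 ?pi_ge0//= ler_pdivrMr ?pi_gt0// mul1r pi_ge2.
Qed.

Let der_z (n : nat) (x : R) : is_derive x 1 (fun t => z t ^+ n) (n%:R * z x ^+ n.-1 * (2 / pi)).
Proof.
apply: derpow; have h := derB (derZ (2 / pi) (derid x)) (dercst 1 x 1).
by apply: (derE h); rewrite mulr1 subr0.
Qed.

Let npow_le1 n x : 0 <= x <= pi -> `|z x ^+ n| <= 1.
Proof. by move=> hx; rewrite normrX exprn_ile1// z_le1. Qed.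

(** Two integrations by parts: the decay in the frequency k is quadratic, and the
    loss in the degree n only polynomial. *)
Lemma mean_pow_cos n k :
  `|mean (fun x => z x ^+ n * cos (k%:R * x))| <= 2 * n.+1%:R ^+ 2 * decay k.
Proof.
have cz := z_cont.
have n1 : 1 <= n.+1%:R ^+ 2 :> R by rewrite exprn_ege1// ler1n.
case: k => [|k].
  rewrite /= mulr1; apply: le_trans (_ : 2 * 1 <= _); last by rewrite ler_wpM2l.
  apply: mean_norm_le => [|x hx]; first by cont.
  by rewrite normrM -[leRHS]mulr1 ler_pM ?npow_le1// cos_max.
set K := k.+1%:R; have K0 : K != 0 :> R by rewrite pnatr_eq0.
pose f' x : R := n%:R * z x ^+ n.-1 * (2 / pi).
pose f'' x : R := n%:R * (n.-1%:R * z x ^+ n.-2 * (2 / pi)) * (2 / pi).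
have cf' : continuous f' by rewrite /f'; cont.
have cf'' : continuous f'' by rewrite /f''; cont.
have d x (_ : 0 <= x <= pi) : is_derive x 1
    (fun x => K^-1 * (z x ^+ n * sin (K * x)) + (K ^+ 2)^-1 * (f' x * cos (K * x)))
    (z x ^+ n * cos (K * x) + (K ^+ 2)^-1 * (f'' x * cos (K * x))).
  have dK : is_derive x 1 (fun t => K * t) K.
    by apply: (derE (derZ K (derid x))); rewrite mulr1.
  have ds := dercomp (g := fun t => K * t) (dersin (K * x)) dK.
  have dc := dercomp (g := fun t => K * t) (dercos (K * x)) dK.
  have df' : is_derive x 1 f' (f'' x).
    have h := derM (derZ n%:R (der_z n.-1 x)) (dercst (2 / pi) x 1).
    by apply: (derE h); rewrite /f'' mulr0 add0r mulrC.
  have h := derD (derZ K^-1 (derM (der_z n x) ds)) (derZ (K ^+ 2)^-1 (derM df' dc)).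
  apply: (derE h); rewrite -/(f' x) /=; move: (f' x) (f'' x) (z x ^+ n) => a b c.
  by field.
have := mean_FTC _ d; rewrite meanD; [|by cont..].
rewrite meanZ; last by cont.
move=> /(_ ltac:(by cont)).
rewrite !mulr0 sin0 cos0 (_ : sin (K * pi) = 0) ?sin_npi// !mulr0 !add0r mulr1 => E.
have {}E : mean (fun x => z x ^+ n * cos (K * x)) = (K ^+ 2)^-1 *
    (2 / pi * (f' pi * cos (K * pi) - f' 0) - mean (fun x => f'' x * cos (K * x))).
  move: E; move: (mean _) (mean _) => B A E.
  by rewrite -[A](addrK ((K ^+ 2)^-1 * B)) E; ring.
have [tp0 tp1] := andP twopi.
have pi_pi : 0 <= pi <= pi by apply/andP; split; [exact: pi_ge0|exact: lexx].
have pi_0 : 0 <= (0 : R) <= pi by apply/andP; split; [exact: lexx|exact: pi_ge0].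
have bf' x : 0 <= x <= pi -> `|f' x| <= n%:R.
  move=> hx; rewrite /f' normrM (ger0_norm tp0) normrM normr_nat.
  apply: (le_trans (ler_piMr _ tp1)); first by rewrite mulr_ge0.
  by apply: ler_piMr => //; exact: npow_le1.
have bf'' x : 0 <= x <= pi -> `|f'' x| <= n%:R ^+ 2.
  move=> hx; rewrite /f'' normrM (ger0_norm tp0) normrM normrM (ger0_norm tp0) normrM !normr_nat.
  apply: (le_trans (ler_piMr _ tp1)); first by rewrite mulr_ge0// mulr_ge0// mulr_ge0.
  rewrite expr2 ler_wpM2l//; apply: (le_trans (ler_piMr _ tp1)); first by rewrite mulr_ge0.
  apply: (@le_trans _ _ n.-1%:R); last by rewrite ler_nat leq_pred.
  by apply: ler_piMr => //; exact: npow_le1.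
rewrite E normrM ger0_norm ?invr_ge0 ?sqr_ge0// mulrC ler_wpM2r ?invr_ge0 ?sqr_ge0//.
apply: le_trans (ler_normB _ _) _.
have b2 : `|mean (fun x => f'' x * cos (K * x))| <= 2 * n%:R ^+ 2.
  apply: mean_norm_le => [|x hx]; first by cont.
  by rewrite normrM -[leRHS]mulr1 ler_pM ?bf''// cos_max.
have b1 : `|2 / pi * (f' pi * cos (K * pi) - f' 0)| <= 2 * n%:R.
  rewrite normrM ger0_norm// -[leRHS]mul1r ler_pM//.
  apply: le_trans (ler_normB _ _) _; rewrite mulr_natl mulr2n lerD ?bf'//.
  by rewrite normrM -[leRHS]mulr1 ler_pM ?bf' ?cos_max.
rewrite -natr1; have : 0 <= n%:R :> R by []. move: b1 b2; set y := n%:R : R; nra.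
Qed.

(** A product of two sines is a difference of two cosines, whose frequencies m +
    k + 2 and the distance of m and k take each value at most twice as k varies. *)
Lemma sum_mean_pow_sn n m M :
  \sum_(k < M) `|mean (fun x => z x ^+ n * (sn m x * sn k x))| <= 9 * n.+1%:R ^+ 2.
Proof.
have cz := z_cont.
pose D (k : nat) : nat := ((m - k) + (k - m))%N.
apply: le_trans (_ : \sum_(k < M) n.+1%:R ^+ 2 * (decay (D k) + decay (m + k).+2) <= _).
  apply: ler_sum => k _.
  have E x : sn m x * sn k x = 1 / 2 * (cos ((D k)%:R * x) - cos ((m + k).+2%:R * x)).
    rewrite /D; have [mk|/ltnW mk] := leqP m k.
      by rewrite sn_mul// (eqP mk) add0n.
    by rewrite mulrC sn_mul// (eqP mk) addn0 addnC.
  have -> : mean (fun x => z x ^+ n * (sn m x * sn k x)) =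
      1 / 2 * (mean (fun x => z x ^+ n * cos ((D k)%:R * x)) -
               mean (fun x => z x ^+ n * cos ((m + k).+2%:R * x))).
    rewrite -meanB; [|by cont..]. rewrite -meanZ; last by cont.
    by apply: eq_mean => x _; rewrite E; ring.
  rewrite normrM ger0_norm ?divr_ge0//.
  have h1 := mean_pow_cos n (D k); have h2 := mean_pow_cos n (m + k).+2.
  have := ler_normB (mean (fun x => z x ^+ n * cos ((D k)%:R * x)))
    (mean (fun x => z x ^+ n * cos ((m + k).+2%:R * x))).
  move: h1 h2; set a := mean _; set b := mean _; set c := `|a - b|.
  by move: (n.+1%:R ^+ 2) (decay _) (decay _) => A B C; lra.
rewrite -big_distrr big_split /= mulrC ler_wpM2r ?sqr_ge0//.
have h1 : \sum_(k < M) decay (m + k).+2 <= 3.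
  apply: (@sum_decay_inj _ xpredT (fun k : 'I_M => (m + k).+2)) => i j _ _ [/addnI e].
  exact: val_inj.
have h2 : \sum_(k < M | (k <= m)%N) decay (D k) <= 3.
  apply: (@sum_decay_inj _ (fun k : 'I_M => (k <= m)%N) (fun k : 'I_M => D k)).
  move=> i j; rewrite /D /in_mem /= => im jm; rewrite (eqP im) (eqP jm) !addn0 => e.
  by apply: val_inj => /=; rewrite -(subKn im) -(subKn jm) e.
have h3 : \sum_(k < M | ~~ (k <= m)%N) decay (D k) <= 3.
  apply: (@sum_decay_inj _ (fun k : 'I_M => ~~ (k <= m)%N) (fun k : 'I_M => D k)).
  move=> i j; rewrite /D /in_mem /= -!ltnNge => /ltnW im /ltnW jm.
  rewrite (eqP im) (eqP jm) !add0n => e.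
  by apply: val_inj => /=; rewrite -(subnK im) -(subnK jm) e.
rewrite (bigID (fun k : 'I_M => (k <= m)%N)) /=.
by move: h1 h2 h3; lra.
Qed.

End Decay.

(** * The density of hyperbolic area *)

Section Weight.
Variables (R : realType) (L r : R).
Hypotheses (L0 : 0 < L) (r0 : 0 < r) (Lr1 : L ^+ 2 + r ^+ 2 < 1).
Implicit Types (f g : R * R -> R) (p : R * R).
Local Notation pi := (@trigo.pi R).
Local Notation IM := (Imean L r).
Local Notation ph := (phi L r).
Local Notation crect := (crect L r).

(** Gives values on the whole plane to functions that matter on the closed
    rectangle only, and serves to truncate functions. *)
Definition clip (l y : R) : R := (`|y + l| - `|y - l|) / 2.

Lemma clip_cont l : continuous (clip l).
Proof. by rewrite /clip; cont. Qed.

Lemma clipE l y : - l <= y <= l -> clip l y = y.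
Proof.
move=> /andP[h1 h2]; rewrite /clip ger0_norm; last by lra.
by rewrite ler0_norm; [field|lra].
Qed.

Lemma clip_itv l y : 0 < l -> - l <= clip l y <= l.
Proof.
move=> l0; have [h1|h1] := leP y (- l).
  by rewrite /clip ler0_norm ?ler0_norm; lra.
have [h2|h2] := leP l y.
  by rewrite /clip ger0_norm ?ger0_norm; lra.
by rewrite clipE; lra.
Qed.

Definition cliprect p : R * R := (clip L p.1, clip r p.2).

Lemma cliprect_cont : continuous cliprect.
Proof.
by apply: contpair; apply: contcomp; try exact: clip_cont; cont.
Qed.

Lemma cliprect_crect p : crect (cliprect p).
Proof. by split; exact: clip_itv. Qed.

Lemma cliprectE p : crect p -> cliprect p = p.
Proof. by move=> [h1 h2]; rewrite /cliprect !clipE// -surjective_pairing. Qed.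

Lemma sqnorm_crect p : crect p -> 0 <= sqnorm p <= L ^+ 2 + r ^+ 2.
Proof.
move=> [/andP[a b] /andP[c d]]; rewrite /sqnorm.
by apply/andP; split; nra.
Qed.

Lemma sqnorm_cont : continuous (@sqnorm R).
Proof. by rewrite /sqnorm; cont. Qed.

(** The density of the hyperbolic area on the closed rectangle, continued to the
    plane by its value at the clipped point. *)
Definition wt p : R := 4 / (1 - sqnorm (cliprect p)) ^+ 2.

Lemma contV (T : topologicalType) (f : T -> R) : (forall x, f x != 0) ->
  continuous f -> continuous (fun x => (f x)^-1).
Proof. by move=> f0 cf x; apply: continuousV => //; exact: cf. Qed.

Lemma one_sub_sqnorm p : 1 - (L ^+ 2 + r ^+ 2) <= 1 - sqnorm (cliprect p) <= 1.
Proof.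
have /andP[h1 h2] := sqnorm_crect (cliprect_crect p).
by apply/andP; split; lra.
Qed.

Lemma one_sub_sqnorm_gt0 p : 0 < 1 - sqnorm (cliprect p).
Proof.
by have /andP[h1 _] := one_sub_sqnorm p; apply: lt_le_trans h1; rewrite subr_gt0.
Qed.

Lemma wt_cont : continuous wt.
Proof.
have c : continuous (fun p => sqnorm (cliprect p)) by apply: contcomp; [exact: sqnorm_cont|exact: cliprect_cont].
apply: contM; first exact: contcst.
apply: contV => [p|]; last by cont.
by rewrite sqrf_eq0 gt_eqF// one_sub_sqnorm_gt0.
Qed.

Lemma wt_ge4 p : 4 <= wt p.
Proof.
have /andP[h1 h2] := one_sub_sqnorm p.
have h0 := one_sub_sqnorm_gt0 p.
rewrite /wt ler_pdivlMr; last by rewrite exprn_gt0.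
by rewrite -[leRHS]mulr1 ler_wpM2l// expr_le1// ltW.
Qed.

Lemma wt_gt0 p : 0 < wt p.
Proof. by rewrite (lt_le_trans _ (wt_ge4 p)). Qed.

Definition wpart N p : R := 4 * \sum_(n < N) n.+1%:R * sqnorm p ^+ n.

Lemma wpart_cont N : continuous (wpart N).
Proof.
apply: contM; first exact: contcst.
apply: (contsum (F := fun n p => n.+1%:R * sqnorm p ^+ n)) => i.
have := sqnorm_cont => ?; by cont.
Qed.

Lemma wpart_cvg (e : R) : 0 < e -> exists N, forall p, crect p -> `|wt p - wpart N p| <= e.
Proof.
move=> e0; set q := L ^+ 2 + r ^+ 2.
have q0 : 0 <= q by rewrite addr_ge0 ?sqr_ge0.
have [C HC] := pgeo_bounded 2 q0 Lr1.
have C0 : 0 <= C by have := HC 0%N; rewrite /pgeo big_ord0.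
pose d := 4 / (1 - q) ^+ 2 * C.
have d0 : 0 <= d by rewrite mulr_ge0// divr_ge0// sqr_ge0.
pose N := Num.bound (d / e).
have HN : d / e < N%:R by apply: archi_boundP; rewrite divr_ge0// ltW.
exists N => p cp; have /andP[s0 sq] := sqnorm_crect cp.
have s1 : sqnorm p < 1 by exact: le_lt_trans Lr1.
rewrite /wt cliprectE// /wpart -mulrBr inv_sqr_series; last by rewrite lt_eqF.
set s := sqnorm p in s0 sq s1 *.
have dpos : 0 < (1 - s) ^+ 2 by rewrite exprn_gt0// subr_gt0.
have num0 : 0 <= N.+1%:R - N%:R * s by rewrite -natr1; have := ler0n R N; move: (N%:R) => x; nra.
have dpos' := ltW dpos; have sN : 0 <= s ^+ N by exact: exprn_ge0.
rewrite ger0_norm; last by rewrite mulr_ge0// divr_ge0// mulr_ge0.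
have h1 : s ^+ N * (N.+1%:R - N%:R * s) <= N.+1%:R * q ^+ N.
  rewrite mulrC; apply: ler_pM => //.
    by rewrite gerBl mulr_ge0.
  by rewrite lerXn2r ?nnegrE.
have h2 : N.+1%:R * (N.+1%:R * q ^+ N) <= C.
  by apply: le_trans (HC N.+1); rewrite mulrA -expr2; exact: pgeo_term.
have h3 : ((1 - s) ^+ 2)^-1 <= ((1 - q) ^+ 2)^-1.
  rewrite lef_pV2 ?posrE// ?exprn_gt0 ?subr_gt0//.
  have q1 : 0 <= 1 - q by rewrite subr_ge0 ltW.
  have s2 : 0 <= 1 - s by rewrite subr_ge0 ltW.
  by rewrite ler_pXn2r ?nnegrE// lerD2l lerN2.
have N1 : 0 < N.+1%:R :> R by [].
apply: (@le_trans _ _ (d / N.+1%:R)).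
  have h4 : s ^+ N * (N.+1%:R - N%:R * s) <= C / N.+1%:R.
    by rewrite ler_pdivlMr// mulrC; apply: le_trans h2; rewrite ler_wpM2l.
  rewrite (_ : d / N.+1%:R = 4 * (C / N.+1%:R / (1 - q) ^+ 2)).
    rewrite ler_wpM2l//; apply: ler_pM => //; first by rewrite mulr_ge0.
    by rewrite invr_ge0.
  by rewrite /d; move: ((1 - q) ^+ 2) (N.+1%:R : R) => x y; ring.
rewrite ler_pdivrMr// mulrC -ler_pdivrMr//; apply: ltW.
by apply: lt_trans HN _; rewrite ltr_nat.
Qed.

Lemma phi_angle i x y :
  ph i (unangle L x, unangle r y) = sn (idx i).1 x * sn (idx i).2 y.
Proof.
rewrite /phi /tprod /trg /sn /fm /fn /ax /ay /=.
by rewrite -[X in sin X * _]mulrA -[X in _ * sin X]mulrA !angleE ?gt_eqF.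
Qed.

Lemma mean_side_row l c m n : 0 < l ->
  \sum_(k < n) `|mean (fun x : R => (l * side x) ^+ c * (sn m x * sn k x))| <=
  l ^+ c * (9 * c.+1%:R ^+ 2).
Proof.
move=> l0; have cs := @side_cont R.
apply: le_trans (_ : \sum_(k < n) l ^+ c * `|mean (fun x => side x ^+ c * (sn m x * sn k x))| <= _).
  apply: ler_sum => k _; have cm := @sn_cont R m; have ck := @sn_cont R k.
  rewrite -[X in X * _]ger0_norm ?exprn_ge0 ?(ltW l0)// -normrM -meanZ; last by cont.
  rewrite le_eqVlt; apply/orP; left; apply/eqP; congr (`|_|).
  by apply: eq_mean => x _; rewrite exprMn mulrA.
rewrite -big_distrr /= ler_wpM2l ?exprn_ge0 ?(ltW l0)//.
exact: sum_mean_pow_sn.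
Qed.

(** For a monomial the matrix entry is a product of two one-dimensional ones. *)
Lemma mono_row a b i n :
  \sum_(j < n) `|IM (fun p => p.1 ^+ a * p.2 ^+ b * (ph i p * ph j p))| <=
  (L ^+ a * (9 * a.+1%:R ^+ 2)) * (r ^+ b * (9 * b.+1%:R ^+ 2)).
Proof.
pose G l (c m k : nat) := mean (fun x : R => (l * side x) ^+ c * (sn m x * sn k x)).
have cs := @side_cont R.
have E j : IM (fun p => p.1 ^+ a * p.2 ^+ b * (ph i p * ph j p)) =
    G L a (idx i).1 (idx j).1 * G r b (idx i).2 (idx j).2.
  have c1 := @sn_cont R (idx i).1; have c2 := @sn_cont R (idx j).1.
  have c3 := @sn_cont R (idx i).2; have c4 := @sn_cont R (idx j).2.
  rewrite /G /Imean -meanZ; last by cont.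
  apply: eq_mean => y _; rewrite mulrC -meanZ; last by cont.
  by apply: eq_mean => x _; rewrite !phi_angle /unangle /side /=; ring.
under eq_bigr do rewrite E normrM.
by apply: (sum_idx_prod_le (g := fun k => `|G L a (idx i).1 k|)
  (h := fun k => `|G r b (idx i).2 k|)) => // k; exact: mean_side_row.
Qed.

(** Expanding the m-th power of the squared radius into monomials costs a fourth
    power of m, which the geometric factor (L^2 + r^2)^m absorbs. *)
Lemma wpart_row : exists C, forall N i n,
  \sum_(j < n) `|IM (fun p => wpart N p * (ph i p * ph j p))| <= C.
Proof.
set q := L ^+ 2 + r ^+ 2.
have q0 : 0 <= q by rewrite addr_ge0 ?sqr_ge0.
have [C HC] := pgeo_bounded 5 q0 Lr1.
have [K [K0 KE]] : exists K : R, 0 <= K /\ 81 * 16 = K.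
  by exists (81 * 16); split => //; rewrite mulr_ge0.
exists (4 * (K * C)) => N i n.
pose T (m k : nat) := 'C(m, k)%:R * ((L ^+ 2) ^+ (m - k) * (r ^+ 2) ^+ k) : R.
pose H j (m k : nat) := IM (fun p => p.1 ^+ (2 * (m - k)) * p.2 ^+ (2 * k) * (ph i p * ph j p)).
have cphi j : continuous (ph j) by exact: phi_cont.
have E j : IM (fun p => wpart N p * (ph i p * ph j p)) =
    4 * \sum_(m < N) m.+1%:R * \sum_(k < m.+1) 'C(m, k)%:R * H j m k.
  have ci := cphi i; have cj := cphi j.
  pose F (m k : nat) p := 'C(m, k)%:R * (p.1 ^+ (2 * (m - k)) * p.2 ^+ (2 * k) * (ph i p * ph j p)) : R.
  have cF m k : continuous (F m k) by rewrite /F; cont.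
  pose F2 (m : nat) p := m.+1%:R * \sum_(k < m.+1) F m k p : R.
  have cS m : continuous (fun p => \sum_(k < m.+1) F m k p) by exact: contsum.
  have cF2 m : continuous (F2 m) by have := cS m => ?; rewrite /F2; cont.
  transitivity (IM (fun p => 4 * \sum_(m < N) F2 m p)).
    apply: eq_Imean => // p _; rewrite /wpart -mulrA; congr (_ * _).
    rewrite big_distrl; apply: eq_bigr => m _ /=; rewrite /F2 -mulrA; congr (_ * _).
    rewrite /sqnorm exprDn big_distrl; apply: eq_bigr => k _ /=.
    by rewrite /F -mulr_natl !exprM; ring.
  rewrite ImeanZ//; last exact: contsum.
  congr (_ * _); rewrite Imean_sum//; apply: eq_bigr => m _.
  rewrite ImeanZ//; congr (_ * _); rewrite Imean_sum//; apply: eq_bigr => k _.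
  by rewrite ImeanZ//; cont.
apply: (@le_trans _ _ (4 * \sum_(m < N) m.+1%:R * \sum_(k < m.+1) 'C(m, k)%:R * \sum_(j < n) `|H j m k|)).
  apply: (@le_trans _ _ (\sum_(j < n) 4 * \sum_(m < N) m.+1%:R * \sum_(k < m.+1) 'C(m, k)%:R * `|H j m k|)).
    apply: ler_sum => j _; rewrite E normrM ger0_norm// ler_wpM2l//.
    apply: le_trans (ler_norm_sum _ _ _) _; apply: ler_sum => m _.
    rewrite normrM ger0_norm// ler_wpM2l//.
    apply: le_trans (ler_norm_sum _ _ _) _; apply: ler_sum => k _.
    by rewrite normrM ger0_norm.
  rewrite -big_distrr /= exchange_big /= ler_wpM2l//; apply: ler_sum => m _.
  rewrite -big_distrr /= exchange_big /= ler_wpM2l//; apply: ler_sum => k _.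
  by rewrite -big_distrr.
rewrite ler_wpM2l//; apply: le_trans (ler_wpM2l K0 (HC N)).
rewrite /pgeo big_distrr /=; apply: ler_sum => m _.
apply: (@le_trans _ _ (m.+1%:R * \sum_(k < m.+1) (K * m.+1%:R ^+ 4) * T m k)).
  rewrite ler_wpM2l//; apply: ler_sum => k _.
  apply: le_trans (ler_wpM2l _ (mono_row _ _ i n)) _ => //.
  rewrite /T !exprM [leRHS]mulrCA ler_wpM2l//.
  set A := (L ^+ 2) ^+ _; set B := (r ^+ 2) ^+ _.
  have A0 : 0 <= A * B by rewrite mulr_ge0// exprn_ge0// sqr_ge0.
  have b1 (j : nat) : (j <= m)%N -> (2 * j).+1%:R ^+ 2 <= 4 * m.+1%:R ^+ 2 :> R.
    move=> jm; rewrite -!natrX -natrM ler_nat.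
    rewrite -(expnMn 2 m.+1 2) leq_exp2r// mulnS add2n ltnS.
    by rewrite (leq_trans _ (leqnSn _))// leq_mul2l jm orbT.
  have h1 := b1 _ (leq_subr k m); have h2 := b1 k (ltn_ord k).
  rewrite (_ : A * (9 * _) * (B * (9 * _)) = (A * B) * (81 * ((2 * (m - k)).+1%:R ^+ 2 * (2 * k).+1%:R ^+ 2))); last by ring.
  rewrite mulrC ler_wpM2r//.
  have := ler_pM (sqr_ge0 _) (sqr_ge0 _) h1 h2.
  rewrite (_ : 4 * _ * (4 * _) = 16 * m.+1%:R ^+ 4); last by ring.
  by rewrite -KE -mulrA ler_pM2l.
rewrite -big_distrr /=.
have -> : \sum_(k < m.+1) T m k = q ^+ m.
  by rewrite /q exprDn; apply: eq_bigr => k _; rewrite /T mulr_natl.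
by rewrite le_eqVlt; apply/orP; left; apply/eqP; ring.
Qed.

(** Multiplication by the weight is bounded on absolutely summable sine
    series: the rows of its matrix are uniformly summable, since the weight is
    a power series in the squares of the coordinates whose sum of moduli
    converges for squared radius below one. *)
Theorem wt_row : exists2 C, 0 <= C & forall i n,
  \sum_(j < n) `|IM (fun p => wt p * (ph i p * ph j p))| <= C.
Proof.
have [C HC] := wpart_row.
have C0 : 0 <= C by have := HC 0%N 0%N 0%N; rewrite big_ord0.
exists C => // i n; apply/ler_addgt0Pr => e e0.
pose d := e / (4 * n.+1%:R).
have n1 : 0 < n.+1%:R :> R by [].
have d0 : 0 < d by rewrite divr_gt0// mulr_gt0.
have [N HN] := wpart_cvg d0.
have cw := wt_cont; have cp := @wpart_cont N.
apply: (@le_trans _ _ (\sum_(j < n) (`|IM (fun p => wpart N p * (ph i p * ph j p))| + 4 * d))).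
  apply: ler_sum => j _.
  have ci := @phi_cont R L r i; have cj := @phi_cont R L r j.
  rewrite -lerBlDl; apply: le_trans (lerB_dist _ _) _.
  rewrite -ImeanB//; [|by cont..].
  apply: Imean_norm_le => // [|p hp]; first by cont.
  rewrite -mulrBl normrM -[leRHS]mulr1 ler_pM// ?HN//.
  by rewrite normrM -[leRHS]mulr1 ler_pM// phi_le1.
rewrite big_split /= lerD ?HC//.
rewrite big_const_ord iter_addr_0 -[_ *+ n]mulr_natr /d.
apply: (@le_trans _ _ (4 * (e / (4 * n.+1%:R)) * n.+1%:R)).
  by rewrite ler_wpM2l ?ler_nat// mulr_ge0// ltW.
by rewrite le_eqVlt; apply/orP; left; apply/eqP; move: (n.+1%:R : R) n1 => x n1; field; rewrite gt_eqF.
Qed.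

End Weight.

(** * Uniform density of sine polynomials *)

Section Bernstein.
Variable R : realType.
Implicit Types (F G : nat -> R) (t : R).

(** The expectation of F under the binomial law of parameters n and t. *)
Fixpoint bern (n : nat) (t : R) (F : nat -> R) : R :=
  if n is n'.+1 then t * bern n' t (fun i => F i.+1) + (1 - t) * bern n' t F
  else F 0%N.

Lemma bernD n t F G : bern n t (fun i => F i + G i) = bern n t F + bern n t G.
Proof. by elim: n F G => [|n IH] F G //=; rewrite !IH; ring. Qed.

Lemma bernZ n t k F : bern n t (fun i => k * F i) = k * bern n t F.
Proof. by elim: n F => [|n IH] F //=; rewrite !IH; ring. Qed.

Lemma bern_cst n t k : bern n t (fun=> k) = k.
Proof. by elim: n => [|n IH] //=; rewrite !IH; ring. Qed.

Lemma eq_bern n t F G : (forall i, (i <= n)%N -> F i = G i) -> bern n t F = bern n t G.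
Proof.
elim: n F G => [|n IH] F G FG /=; first exact: FG.
rewrite (IH (fun i => F i.+1) (fun i => G i.+1)) ?(IH F G)// => i ?; apply: FG => //.
exact: leqW.
Qed.

Lemma ler_bern n t F G : 0 <= t <= 1 -> (forall i, (i <= n)%N -> F i <= G i) ->
  bern n t F <= bern n t G.
Proof.
move=> /andP[t0 t1]; elim: n F G => [|n IH] F G FG /=; first exact: FG.
apply: lerD; rewrite ler_wpM2l ?subr_ge0//; apply: IH => i ?; apply: FG => //.
exact: leqW.
Qed.

Lemma bern_mean n t : bern n t (fun i => i%:R - n%:R * t) = 0.
Proof.
elim: n => [|n IH] /=; first by rewrite mul0r subr0.
have -> : (fun i => i.+1%:R - n.+1%:R * t) = (fun i => (i%:R - n%:R * t) + (1 - t)).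
  by apply/funext => i; rewrite -!natr1; ring.
have -> : (fun i => i%:R - n.+1%:R * t) = (fun i => (i%:R - n%:R * t) + (- t)).
  by apply/funext => i; rewrite -!natr1; ring.
rewrite !(bernD n t (fun i => i%:R - n%:R * t)) IH !bern_cst; ring.
Qed.

Lemma bern_var n t : bern n t (fun i => (i%:R - n%:R * t) ^+ 2) = n%:R * (t * (1 - t)).
Proof.
elim: n => [|n IH] /=; first by rewrite !mul0r subr0 expr0n.
pose D i := i%:R - n%:R * t.
have E k : bern n t (fun i => (D i + k) ^+ 2) = n%:R * (t * (1 - t)) + k ^+ 2.
  have -> : (fun i => (D i + k) ^+ 2) = (fun i => D i ^+ 2 + (2 * k * D i + k ^+ 2)).
    by apply/funext => i; ring.
  rewrite (bernD n t (fun i => D i ^+ 2)) IH (bernD n t (fun i => 2 * k * D i)).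
  by rewrite (bernZ n t _ D) bern_mean bern_cst; ring.
have -> : (fun i => (i.+1%:R - n.+1%:R * t) ^+ 2) = (fun i => (D i + (1 - t)) ^+ 2).
  by apply/funext => i; rewrite /D -!natr1; ring.
have -> : (fun i => (i%:R - n.+1%:R * t) ^+ 2) = (fun i => (D i + (- t)) ^+ 2).
  by apply/funext => i; rewrite /D -!natr1; ring.
by rewrite !E -natr1; ring.
Qed.

Lemma bern_norm n t F : 0 <= t <= 1 -> `|bern n t F| <= bern n t (fun i => `|F i|).
Proof.
move=> t01; rewrite ler_norml; apply/andP; split.
  rewrite -mulN1r -bernZ; apply: ler_bern => // i _.
  by rewrite mulN1r lerNl -normrN ler_norm.
by apply: ler_bern => // i _; exact: ler_norm.
Qed.

(** By recursion on the degree; applied to the class of sine polynomials. *)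
Lemma bern_closed (T : Type) (Q : (T -> R) -> Prop) (tau : T -> R) n (F : nat -> T -> R) :
  (forall f g, Q f -> Q g -> Q (fun x => f x + g x)) ->
  (forall f, Q f -> Q (fun x => tau x * f x)) ->
  (forall f, Q f -> Q (fun x => (1 - tau x) * f x)) ->
  (forall i, Q (F i)) -> Q (fun x => bern n (tau x) (fun i => F i x)).
Proof.
move=> QD Qt Qt'; elim: n F => [|n IH] F QF /=; first exact: QF.
by apply: QD; [apply: Qt; apply: IH|apply: Qt'; exact: IH].
Qed.

End Bernstein.

Section BernsteinCos.
Variable R : realType.
Local Notation pi := (@trigo.pi R).

(** The node whose cosine is 2 i / n - 1. *)
Definition node (n i : nat) : R := acos (2 * i%:R / n%:R - 1).

Lemma node_arg n i : (0 < n)%N -> (i <= n)%N ->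
  -1 <= (2 * i%:R / n%:R - 1 : R) <= 1.
Proof.
move=> n0 ni; have n0' : 0 < n%:R :> R by rewrite ltr0n.
have h1 : 0 <= 2 * i%:R / n%:R :> R by rewrite divr_ge0// mulr_ge0.
have h2 : 2 * i%:R / n%:R <= 2 :> R.
  by rewrite ler_pdivrMr// ler_pM2l// ler_nat.
by apply/andP; split; lra.
Qed.

Lemma node_itv n i : (0 < n)%N -> (i <= n)%N -> 0 <= node n i <= pi.
Proof.
by move=> n0 ni; rewrite acos_ge0 ?acos_lepi//; exact: node_arg.
Qed.

Lemma bern_cos_var n (c : R) : (0 < n)%N -> -1 <= c <= 1 ->
  bern n ((1 + c) / 2) (fun i => (c - cos (node n i)) ^+ 2) <= n%:R^-1.
Proof.
move=> n0 /andP[c0 c1]; have n0' : 0 < n%:R :> R by rewrite ltr0n.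
set t := (1 + c) / 2.
have ct : c = 2 * t - 1 by rewrite /t; field.
have -> : bern n t (fun i => (c - cos (node n i)) ^+ 2) =
    bern n t (fun i => (2 / n%:R) ^+ 2 * (i%:R - n%:R * t) ^+ 2).
  apply: eq_bern => i ni; rewrite /node acosK ?in_itv/= ?node_arg//.
  by rewrite ct; move: (n%:R : R) n0' (i%:R : R) => x x0 y; field; rewrite gt_eqF.
rewrite bernZ bern_var.
rewrite (_ : _ * _ = 4 * (t * (1 - t)) * n%:R^-1); last first.
  by move: (n%:R : R) n0' => x x0; field; rewrite gt_eqF.
rewrite -[leRHS]mul1r ler_wpM2r ?invr_ge0//.
by have := sqr_ge0 (2 * t - 1); lra.
Qed.

(** Bernstein approximation in the variables cos x and cos y: by compactness the
    increments of g are at most a small constant plus a multiple of the squared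
    increments of the cosines, and the latter have small expectation. *)
Lemma bernstein_cos (g : R * R -> R) (e : R) : continuous g -> 0 < e ->
  exists n, forall x y, 0 <= x <= pi -> 0 <= y <= pi ->
  `|g (x, y) - bern n ((1 + cos x) / 2) (fun i => bern n ((1 + cos y) / 2)
      (fun j => g (node n i, node n j)))| <= e.
Proof.
move=> cg e0; pose I0pi : set R := `[0, pi]%classic.
pose K : set ((R * R) * (R * R)) := (I0pi `*` I0pi) `*` (I0pi `*` I0pi).
have cI : compact I0pi by exact: segment_compact.
have cK : compact K by do ![apply: compact_setX].
pose G (k : (R * R) * (R * R)) := (cos k.1.1 - cos k.2.1) ^+ 2 + (cos k.1.2 - cos k.2.2) ^+ 2.
have cf1 : continuous (fun k : (R * R) * (R * R) => k.1) by move=> k; exact: cvg_fst.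
have cf2 : continuous (fun k : (R * R) * (R * R) => k.2) by move=> k; exact: cvg_snd.
have c11 : continuous (fun k : (R * R) * (R * R) => k.1.1) by exact: contcomp (@contfst R) cf1.
have c12 : continuous (fun k : (R * R) * (R * R) => k.1.2) by exact: contcomp (@contsnd R) cf1.
have c21 : continuous (fun k : (R * R) * (R * R) => k.2.1) by exact: contcomp (@contfst R) cf2.
have c22 : continuous (fun k : (R * R) * (R * R) => k.2.2) by exact: contcomp (@contsnd R) cf2.
have cG : continuous G by rewrite /G; cont.
have cF : continuous (fun k : (R * R) * (R * R) => `|g k.1 - g k.2|).
  by apply: contabs; apply: contB; [exact: contcomp cg cf1|exact: contcomp cg cf2].
have G0 k : K k -> 0 <= G k by move=> _; rewrite addr_ge0// sqr_ge0.
have GF k : K k -> G k = 0 -> `|g k.1 - g k.2| <= 0.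
  move: k => [[a b] [c d]] [[/= h1 h2] [/= h3 h4]] /eqP.
  rewrite paddr_eq0 ?sqr_ge0// !sqrf_eq0 !subr_eq0 /= => /andP[/eqP e1 /eqP e2].
  by rewrite (cos_inj h1 h3 e1) (cos_inj h2 h4 e2) subrr normr0.
have e2 : 0 < e / 2 by rewrite divr_gt0.
have [A A0 HA] := compact_domination cK cF cG G0 GF e2.
pose n := (Num.bound (4 * A / e)).+1.
have n1 : 4 * A / e < n%:R.
  apply: lt_trans (archi_boundP _) _; last by rewrite ltr_nat.
  by rewrite divr_ge0 ?mulr_ge0// ltW.
have n0 : 0 < n%:R :> R by rewrite ltr0n.
exists n => x y hx hy.
have t01 (z : R) : 0 <= (1 + cos z) / 2 <= 1.
  by have := cos_geN1 z; have := cos_le1 z; move=> a b; apply/andP; split; lra.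
set t := (1 + cos x) / 2; set s := (1 + cos y) / 2.
have E : g (x, y) - bern n t (fun i => bern n s (fun j => g (node n i, node n j))) =
    bern n t (fun i => bern n s (fun j => g (x, y) - g (node n i, node n j))).
  transitivity (bern n t (fun i => g (x, y) + -1 * bern n s (fun j => g (node n i, node n j)))).
    by rewrite bernD bernZ bern_cst mulN1r.
  apply: eq_bern => i _; rewrite -bernZ -{1}(bern_cst n s (g (x, y))) -bernD.
  by apply: eq_bern => j _; rewrite mulN1r.
rewrite E; apply: le_trans (bern_norm _ _ (t01 x)) _.
apply: (@le_trans _ _ (bern n t (fun i => e / 2 + A * (cos x - cos (node n i)) ^+ 2 + A * n%:R^-1))).
  apply: ler_bern => // i ni; apply: le_trans (bern_norm _ _ (t01 y)) _.
  apply: (@le_trans _ _ (bern n s (fun j => (e / 2 + A * (cos x - cos (node n i)) ^+ 2) +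
      A * (cos y - cos (node n j)) ^+ 2))).
    apply: ler_bern => // j nj.
    have := HA ((x, y), (node n i, node n j)); rewrite /G /= mulrDr addrA; apply.
    by split; split; rewrite /I0pi /= in_itv /= ?node_itv.
  rewrite (bernD n s (fun=> e / 2 + A * (cos x - cos (node n i)) ^+ 2)) bern_cst bernZ lerD2l ler_wpM2l//.
  by apply: bern_cos_var => //; rewrite cos_geN1 cos_le1.
rewrite (bernD n t (fun i => e / 2 + A * (cos x - cos (node n i)) ^+ 2)) (bernD n t (fun=> e / 2)).
rewrite !bern_cst bernZ.
have h : bern n t (fun i => (cos x - cos (node n i)) ^+ 2) <= n%:R^-1.
  by apply: bern_cos_var => //; rewrite cos_geN1 cos_le1.
have h2 := ler_wpM2l A0 h.
have h3 : A * n%:R^-1 <= e / 4.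
  by rewrite ler_pdivrMr//; move: n1; rewrite ltr_pdivrMr//; lra.
by move: h2 h3; lra.
Qed.

End BernsteinCos.

Section Density.
Variables (R : realType) (L r : R).
Hypotheses (L0 : 0 < L) (r0 : 0 < r).
Local Notation pi := (@trigo.pi R).
Local Notation ph := (phi L r).
Implicit Types (f g : R * R -> R) (p : R * R).

Definition sine_poly f := exists (N : nat) (c : nat -> R),
  forall p, f p = \sum_(i < N) c i * ph i p.

Lemma sine_polyD f g : sine_poly f -> sine_poly g -> sine_poly (fun p => f p + g p).
Proof.
move=> [N [c fE]] [M [d gE]].
pose cut K (a : nat -> R) i := if (i < K)%N then a i else 0.
have cutE K (a : nat -> R) p : (K <= N + M)%N ->
    \sum_(i < K) a i * ph i p = \sum_(i < N + M) cut K a i * ph i p.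
  move=> hK; rewrite (big_ord_widen _ (fun i => a i * ph i p) hK) big_mkcond /=.
  by apply: eq_bigr => i _; rewrite /cut; case: ifP; rewrite ?mul0r.
exists (N + M)%N, (fun i => cut N c i + cut M d i) => p.
rewrite fE gE (cutE N) ?leq_addr// (cutE M) ?leq_addl// -big_split.
by apply: eq_bigr => i _; rewrite mulrDl.
Qed.

Lemma sine_polyZ f k : sine_poly f -> sine_poly (fun p => k * f p).
Proof.
move=> [N [c fE]]; exists N, (fun i => k * c i) => p.
by rewrite fE big_distrr; apply: eq_bigr => i _ /=; rewrite mulrA.
Qed.

Lemma eq_sine_poly f g : f =1 g -> sine_poly f -> sine_poly g.
Proof. by move=> fg [N [c fE]]; exists N, c => p; rewrite -fg. Qed.

Lemma sine_poly_phi i : sine_poly (ph i).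
Proof.
exists i.+1, (fun j => (j == i)%:R) => p.
rewrite big_ord_recr /= eqxx mul1r big1 ?add0r// => j _.
by rewrite (ltn_eqF (ltn_ord j)) mul0r.
Qed.

Lemma sine_poly_sum n (F : nat -> R * R -> R) : (forall i, sine_poly (F i)) ->
  sine_poly (fun p => \sum_(i < n) F i p).
Proof.
move=> hF; elim: n => [|n IH].
  by exists 0%N, (fun=> 0) => p; rewrite !big_ord0.
by apply: eq_sine_poly (sine_polyD IH (hF n)) => p; rewrite big_ord_recr.
Qed.

Let ang1 p := ax L * (p.1 + L).
Let ang2 p := ay r * (p.2 + r).
Let sns (m n : nat) p : R := sin (m%:R * ang1 p) * sin (n%:R * ang2 p).

Let sine_poly_sns m n : sine_poly (sns m n).
Proof.
case: m => [|m].
  by exists 0%N, (fun=> 0) => p; rewrite big_ord0 /sns !mul0r sin0 mul0r.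
case: n => [|n].
  by exists 0%N, (fun=> 0) => p; rewrite big_ord0 /sns !mul0r sin0 mulr0.
have [inv _ invK] := idx_bij.
apply: eq_sine_poly (sine_poly_phi (inv (m, n))) => p.
by rewrite /phi /tprod /fm /fn invK /= /sns /ang1 /ang2 !mulrA.
Qed.

Lemma sin_mul_cos (x y : R) : cos y * sin x = 1 / 2 * (sin (x + y) + sin (x - y)).
Proof. by rewrite sinD sinB; lra. Qed.

(** Multiplication by the cosine shifts the frequency by one in both directions;
    the frequency zero contributes the zero function. *)
Lemma sine_poly_cos1 f : sine_poly f -> sine_poly (fun p => cos (ax L * (p.1 + L)) * f p).
Proof.
move=> [N [c fE]].
pose F i p : R := c i * (1 / 2 * (sns (idx i).1.+2 (idx i).2.+1 p + sns (idx i).1 (idx i).2.+1 p)).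
have hF i : sine_poly (F i).
  by apply: sine_polyZ; apply: sine_polyZ; apply: sine_polyD; exact: sine_poly_sns.
apply: eq_sine_poly (sine_poly_sum N hF) => p.
rewrite fE big_distrr; apply: eq_bigr => i _ /=; rewrite /F [RHS]mulrCA; congr (_ * _); apply/esym.
rewrite /phi /tprod /trg.
have -> : fm R i * ax L * (p.1 + L) = (idx i).1.+1%:R * ang1 p by rewrite /fm -mulrA.
have -> : fn R i * ay r * (p.2 + r) = (idx i).2.+1%:R * ang2 p by rewrite /fn -mulrA.
rewrite -/(ang1 p) mulrA sin_mul_cos /sns.
set m := (idx i).1.
rewrite (_ : m.+2%:R * ang1 p = m.+1%:R * ang1 p + ang1 p); last by rewrite -!natr1; ring.
rewrite (_ : m%:R * ang1 p = m.+1%:R * ang1 p - ang1 p); last by rewrite -!natr1; ring.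
by ring.
Qed.

Lemma sine_poly_cos2 f : sine_poly f -> sine_poly (fun p => cos (ay r * (p.2 + r)) * f p).
Proof.
move=> [N [c fE]].
pose F i p : R := c i * (1 / 2 * (sns (idx i).1.+1 (idx i).2.+2 p + sns (idx i).1.+1 (idx i).2 p)).
have hF i : sine_poly (F i).
  by apply: sine_polyZ; apply: sine_polyZ; apply: sine_polyD; exact: sine_poly_sns.
apply: eq_sine_poly (sine_poly_sum N hF) => p.
rewrite fE big_distrr; apply: eq_bigr => i _ /=; rewrite /F [RHS]mulrCA; congr (_ * _); apply/esym.
rewrite /phi /tprod /trg.
have -> : fm R i * ax L * (p.1 + L) = (idx i).1.+1%:R * ang1 p by rewrite /fm -mulrA.
have -> : fn R i * ay r * (p.2 + r) = (idx i).2.+1%:R * ang2 p by rewrite /fn -mulrA.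
rewrite -/(ang2 p) mulrCA sin_mul_cos /sns.
set m := (idx i).2.
rewrite (_ : m.+2%:R * ang2 p = m.+1%:R * ang2 p + ang2 p); last by rewrite -!natr1; ring.
rewrite (_ : m%:R * ang2 p = m.+1%:R * ang2 p - ang2 p); last by rewrite -!natr1; ring.
by ring.
Qed.

(** The clipping of a number to [0, pi]. *)
Let q (x : R) : R := clip (pi / 2) (x - pi / 2) + pi / 2.
Let q_itv x : 0 <= q x <= pi.
Proof.
have h : 0 < pi / 2 by rewrite divr_gt0// pi_gt0.
by have := clip_itv (x - pi / 2) h; rewrite /q => /andP[a b]; apply/andP; split; lra.
Qed.
Let qE x : 0 <= x <= pi -> q x = x.
Proof.
move=> /andP[a b]; rewrite /q clipE ?subrK//.
by apply/andP; split; lra.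
Qed.
Let q_cont : continuous q.
Proof.
rewrite /q; apply: contD; last exact: contcst.
by apply: contcomp; [exact: clip_cont|cont].
Qed.

Let sin_pos_bdry x : 0 <= x <= pi -> sin x = 0 -> x = 0 \/ x = pi.
Proof.
move=> /andP[x0 xpi] sx.
move: x0; rewrite le_eqVlt => /orP[/eqP<-|x0]; first by left.
move: xpi; rewrite le_eqVlt => /orP[/eqP->|xpi]; first by right.
by have := @sin_gt0_pi R x; rewrite x0 xpi sx ltxx => /(_ isT).
Qed.

(** A continuous function vanishing on the boundary is first truncated to
    vanish near the boundary; then it can be divided by the product of the
    sines, and Bernstein approximation of the quotient in the cosines gives a
    sine polynomial. *)
Theorem sine_density f (e : R) : continuous f ->
  (forall p, crect L r p -> ~ open_rectangle L r p -> f p = 0) -> 0 < e ->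
  exists2 g, sine_poly g & forall p, crect L r p -> `|f p - g p| <= e.
Proof.
move=> cf f0 e0; pose d := e / 2; have d0 : 0 < d by rewrite divr_gt0.
pose U (k : R * R) := (unangle L (q k.1), unangle r (q k.2)).
have cU : continuous U.
  apply: contpair; apply: contcomp; try exact: unangle_cont.
    exact: contcomp q_cont (@contfst R).
  exact: contcomp q_cont (@contsnd R).
pose Nm k := f (U k) - clip d (f (U k)).
pose D (k : R * R) := sin (q k.1) * sin (q k.2).
have cfU : continuous (fun k => f (U k)) by exact: contcomp cf cU.
have cN : continuous Nm.
  by apply: contB => //; apply: contcomp cfU; exact: clip_cont.
have cD : continuous D.
  apply: contM; apply: contsin; first exact: contcomp q_cont (@contfst R).
  exact: contcomp q_cont (@contsnd R).
have D0 k : D k = 0 -> f (U k) = 0.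
  move=> /eqP; rewrite mulf_eq0 => h; apply: f0.
    by apply: unangle_crect.
  move=> /orectP[/= h1 h2].
  have un0 (l : R) : unangle l 0 = - l by rewrite /unangle mulr0 sub0r mulrN1.
  have unpi (l : R) : unangle l pi = l.
    by rewrite /unangle divfK ?gt_eqF ?pi_gt0//; lra.
  by case/orP: h => /eqP /(sin_pos_bdry (q_itv _)) [] e1; move: h1 h2; rewrite e1 ?un0 ?unpi; lra.
have cg : continuous (fun k => Nm k / D k).
  move=> k; have [Dk|Dk] := eqVneq (D k) 0; last first.
    by apply: continuousM; [exact: cN|apply: continuousV => //; exact: cD].
  have near0 : \forall z \near k, Nm z / D z = 0.
    have /cvgrPdist_lt/(_ _ d0) := cfU k; apply: filterS => z.
    rewrite D0// sub0r normrN ltr_norml => /andP[z1 z2].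
    by rewrite /Nm clipE ?subrr ?mul0r// !ltW.
  rewrite /continuous_at Dk invr0 mulr0.
  by apply: cvg_near_cst; exact: near0.
have [n Hn] := bernstein_cos cg d0.
pose B (x y : R) := bern n ((1 + cos x) / 2) (fun i => bern n ((1 + cos y) / 2)
      (fun j => Nm (node R n i, node R n j) / D (node R n i, node R n j))).
exists (fun p => bern n ((1 + cos (ang1 p)) / 2) (fun i => bern n ((1 + cos (ang2 p)) / 2)
      (fun j => Nm (node R n i, node R n j) / D (node R n i, node R n j) * sns 1 1 p))).
  have closed (tau : R * R -> R) : (forall h, sine_poly h -> sine_poly (fun p => cos (tau p) * h p)) ->
     (forall h, sine_poly h -> sine_poly (fun p => (1 + cos (tau p)) / 2 * h p)) /\
     (forall h, sine_poly h -> sine_poly (fun p => (1 - (1 + cos (tau p)) / 2) * h p)).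
    move=> ht; split => h hh.
      apply: eq_sine_poly (sine_polyD (sine_polyZ (1 / 2) hh) (sine_polyZ (1 / 2) (ht _ hh))) => p.
      by field.
    apply: eq_sine_poly (sine_polyD (sine_polyZ (1 / 2) hh) (sine_polyZ (- 1 / 2) (ht _ hh))) => p.
    by field.
  have [a1 a2] := closed _ sine_poly_cos1; have [b1 b2] := closed _ sine_poly_cos2.
  apply: (bern_closed (tau := fun p => (1 + cos (ang1 p)) / 2) n sine_polyD a1 a2) => i.
  apply: (bern_closed (tau := fun p => (1 + cos (ang2 p)) / 2) n sine_polyD b1 b2) => j.
  by apply: sine_polyZ; exact: sine_poly_sns.
move=> p [p1 p2]; have hx := angle_itv L0 p1; have hy := angle_itv r0 p2.
set x := pi / 2 * (p.1 / L + 1) in hx; set y := pi / 2 * (p.2 / r + 1) in hy.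
have ex : ang1 p = x.
  rewrite /ang1 /x /ax; have L1 : L != 0 by rewrite gt_eqF.
  by move: (pi) => P; field.
have ey : ang2 p = y.
  rewrite /ang2 /y /ay; have r1 : r != 0 by rewrite gt_eqF.
  by move: (pi) => P; field.
have pU : p = U (x, y).
  by rewrite /U /= !qE// !unangleK ?gt_eqF// -surjective_pairing.
have gE : bern n ((1 + cos (ang1 p)) / 2) (fun i => bern n ((1 + cos (ang2 p)) / 2)
      (fun j => Nm (node R n i, node R n j) / D (node R n i, node R n j) * sns 1 1 p)) =
    D (x, y) * B x y.
  rewrite ex ey /B -bernZ; apply: eq_bern => i _; rewrite -bernZ; apply: eq_bern => j _.
  by rewrite mulrC /sns ex ey !mul1r [in RHS]/D /= (qE hx) (qE hy).
have fE : Nm (x, y) = D (x, y) * (Nm (x, y) / D (x, y)).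
  have [Dk|Dk] := eqVneq (D (x, y)) 0; last by rewrite mulrC divfK.
  have c0 : clip d 0 = 0 by apply: clipE; rewrite oppr_le0 andbb ltW.
  by rewrite Dk mul0r /Nm D0// c0 subrr.
rewrite gE.
have -> : f p - D (x, y) * B x y = clip d (f p) + D (x, y) * (Nm (x, y) / D (x, y) - B x y).
  by rewrite mulrBr -fE /Nm -pU; ring.
apply: le_trans (ler_normD _ _) _; rewrite [e](splitr e) -/d.
apply: lerD.
  by rewrite ler_norml; apply: clip_itv.
rewrite normrM -[leRHS]mul1r; apply: ler_pM => //; last exact: Hn.
by rewrite /D normrM -[leRHS]mulr1 ler_pM// sin_max.
Qed.

End Density.

(** * Derivatives of trigonometric series *)

Section TermwiseDerivation.
Variable R : realType.

Lemma is_deriveP (V : normedModType R) (f : V -> R) (p v : V) (d : R) :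
  is_derive p v f d <->
  h^-1 *: (f (h *: v + p) - f p) @[h --> 0^'] --> d.
Proof.
split=> [[dv <-]|h]; first exact: dv.
by apply: DeriveDef; [apply/cvg_ex; exists d|exact: cvg_lim].
Qed.

Lemma lipschitz_of_derive (F D : R -> R) (B x y : R) :
  (forall t : R, is_derive t 1 F (D t)) -> (forall t, `|D t| <= B) ->
  `|F y - F x| <= `|y - x| * B.
Proof.
move=> dF DB; wlog xy : x y / x <= y.
  move=> H; have [/H//|/ltW/H] := leP x y.
  by rewrite distrC [`|y - x|]distrC.
have cF : {within `[x, y], continuous F}.
  by apply: derivable_within_continuous => t _; have [] := dF t.
have [c _ ->] := MVT_segment xy (fun t _ => dF t) cF.
by rewrite normrM mulrC ler_wpM2l.
Qed.

(** By the mean value inequality the tail of the series of difference quotients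
    is at most the tail of the dominating series. *)
Lemma series_derive (F D : nat -> R -> R) (b : nat -> R) :
  (forall i (x : R), is_derive x 1 (F i) (D i x)) -> summ b ->
  (forall i x, `|D i x| <= b i) -> (forall x, summ (F^~ x)) ->
  forall x : R, is_derive x 1 (fun x => ssum (F^~ x)) (ssum (D^~ x)).
Proof.
move=> dF sb Db sF x; apply/is_deriveP.
have sD : summ (D^~ x) by exact: summ_le (Db^~ x) sb.
apply/cvgrPdist_lt => e e0; have e4 : 0 < e / 4 by rewrite divr_gt0.
have [n Hn] := tail_small sb e4.
have /is_deriveP/cvgrPdist_lt/(_ _ e4) dn := dersum n (fun i => dF i x).
have h0 : \forall h \near (0 : R)^', h != 0 by exact: nbhs_dnbhs_neq.
near=> h.
have : `|\sum_(i < n) D i x - h^-1 *: (\sum_(i < n) F i (h *: 1 + x) - \sum_(i < n) F i x)| < e / 4.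
  by near: h; exact: dn.
have hn0 : h != 0 by near: h.
set y := h *: 1 + x.
have yx : y - x = h by rewrite /y addrK /GRing.scale /= mulr1.
move=> dnh.
have dF' : `|(ssum (F^~ y) - ssum (F^~ x)) - (\sum_(i < n) F i y - \sum_(i < n) F i x)| <= `|h| * tail b n.
  have sG : summ (fun i => F i y - F i x).
    apply: summ_eq (summD (sF y) (summZ (-1) (sF x))) => i; by rewrite mulN1r.
  have -> : ssum (F^~ y) - ssum (F^~ x) = ssum (fun i => F i y - F i x).
    rewrite -mulN1r -ssumZ// -ssumD//; last exact: summZ.
    by congr ssum; apply/funext => i; rewrite mulN1r.
  rewrite -sumrB; apply: le_trans (ssum_tail n sG) _.
  have bh i : `|F i y - F i x| <= `|h| * b i.
    by rewrite -yx; exact: lipschitz_of_derive.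
  apply: le_trans (tail_le n bh (summZ _ sb)) _.
  rewrite /tail; under eq_bigr do rewrite normrM normr_id.
  have -> : (fun i => `| `|h| * b i|) = (fun i => `|h| * `|b i|).
    by apply/funext => i; rewrite normrM normr_id.
  by rewrite ssumZ ?mulrBr ?big_distrr//; exact: summ_norm.
have dD : `|ssum (D^~ x) - \sum_(i < n) D i x| < e / 4.
  by apply: le_lt_trans (ssum_tail n sD) _; apply: le_lt_trans (tail_le n (Db^~ x) sb) Hn.
set A := ssum (F^~ y) - ssum (F^~ x) in dF' *.
set B := \sum_(i < n) F i y - \sum_(i < n) F i x in dF' dnh.
have hA : `|h^-1 *: A - h^-1 *: B| < e / 4.
  rewrite -scalerBr /GRing.scale /= normrM normfV mulrC ltr_pdivrMr ?normr_gt0//.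
  apply: le_lt_trans dF' _; rewrite mulrC ltr_pM2r ?normr_gt0//.
move: dD dnh hA; set X := ssum _; set Y := \sum_(i < n) _; set Z := h^-1 *: A; set W := h^-1 *: B.
move=> h1 h2 h3.
rewrite (_ : X - Z = (X - Y) + (Y - W) - (Z - W)); last by ring.
apply: le_lt_trans (ler_normB _ _) _; have := ler_normD (X - Y) (Y - W).
by move: h1 h2 h3 e0; lra.
Unshelve. all: by end_near. Qed.

Definition e1 : R * R := (1, 0).
Definition e2 : R * R := (0, 1).

Lemma is_derive_e1 (u : R * R -> R) p d :
  is_derive p e1 u d <-> is_derive p.1 1 (fun t => u (t, p.2)) d.
Proof.
rewrite !is_deriveP; have -> //: (fun h : R => h^-1 *: (u (h *: e1 + p) - u p)) =
  (fun h : R => h^-1 *: (u (h *: 1 + p.1, p.2) - u (p.1, p.2))).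
apply/funext => h; rewrite -surjective_pairing; congr (_ *: (u _ - _)).
by rewrite [LHS]surjective_pairing /e1 /= scaler0 add0r.
Qed.

Lemma is_derive_e2 (u : R * R -> R) p d :
  is_derive p e2 u d <-> is_derive p.2 1 (fun t => u (p.1, t)) d.
Proof.
rewrite !is_deriveP; have -> //: (fun h : R => h^-1 *: (u (h *: e2 + p) - u p)) =
  (fun h : R => h^-1 *: (u (p.1, h *: 1 + p.2) - u (p.1, p.2))).
apply/funext => h; rewrite -surjective_pairing; congr (_ *: (u _ - _)).
by rewrite [LHS]surjective_pairing /e2 /= scaler0 add0r.
Qed.

Lemma coord_dir0 : coord_dir R ord0 = e1. Proof. by []. Qed.
Lemma coord_dir1 (i : 'I_2) : i != ord0 -> coord_dir R i = e2.
Proof. by rewrite /coord_dir => /negbTE ->. Qed.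

End TermwiseDerivation.

Section TrigSeries.
Variables (R : realType) (L r : R).
Hypotheses (L0 : 0 < L) (r0 : 0 < r).
Implicit Types (c : nat -> R) (p : R * R).
Local Notation tp := (tprod L r).

Definition tser (s1 s2 : bool) c p : R := ssum (fun i => c i * tp s1 s2 i p).

Lemma tser_term_le s1 s2 c p i : `|c i * tp s1 s2 i p| <= `|c i|.
Proof. by rewrite normrM ler_piMr// tprod_le1. Qed.

Lemma tser_summ s1 s2 c p : summ c -> summ (fun i => c i * tp s1 s2 i p).
Proof. by move=> sc; apply: summ_le (summ_norm sc) => i; exact: tser_term_le. Qed.

Lemma tail_norm c n : tail (fun i => `|c i|) n = tail c n.
Proof. by rewrite /tail; congr (ssum _ - _); [apply/funext => i; rewrite normr_id|apply: eq_bigr => i _; rewrite normr_id]. Qed.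

Lemma tser_tail s1 s2 c p n : summ c ->
  `|tser s1 s2 c p - \sum_(i < n) c i * tp s1 s2 i p| <= tail c n.
Proof.
move=> sc; apply: le_trans (ssum_tail n (tser_summ s1 s2 p sc)) _.
rewrite -(tail_norm c); apply: tail_le; last exact: summ_norm.
by move=> i; exact: tser_term_le.
Qed.

Lemma tser_cont s1 s2 c : summ c -> continuous (tser s1 s2 c).
Proof.
move=> sc p; apply/cvgrPdist_lt => e e0; have e3 : 0 < e / 3 by rewrite divr_gt0.
have [n Hn] := tail_small sc e3.
have cn : continuous (fun p => \sum_(i < n) c i * tp s1 s2 i p).
  apply: (contsum (F := fun i p => c i * tp s1 s2 i p)) => i.
  by have := @tprod_cont R L r s1 s2 i => ?; cont.
have /cvgrPdist_lt/(_ _ e3) := cn p; apply: filterS => q.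
have h1 := le_lt_trans (tser_tail s1 s2 p n sc) Hn.
have h2 := le_lt_trans (tser_tail s1 s2 q n sc) Hn.
set X := tser _ _ _ _ in h1 *; set Y := tser _ _ _ _ in h2 *.
set A := \sum_(i < n) _ in h1 *; set B := \sum_(i < n) _ in h2 *.
move=> h3; rewrite (_ : X - Y = (X - A) + (A - B) - (Y - B)); last by ring.
apply: le_lt_trans (ler_normB _ _) _; have := ler_normD (X - A) (A - B).
by move: h1 h2 h3; lra.
Qed.

Definition sg (s : bool) : R := if s then 1 else -1.

Lemma trg_derive s (a x0 x : R) :
  is_derive x 1 (fun t => trg s (a * (t + x0))) (sg s * a * trg (~~ s) (a * (x + x0))).
Proof.
have h : is_derive x 1 (fun t => a * (t + x0)) a.
  by apply: (derE (derZ a (derD (derid x) (dercst x0 x 1)))); rewrite addr0 mulr1.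
case: s => /=.
  by apply: (derE (dercomp (g := fun t => a * (t + x0)) (dersin _) h)); rewrite mul1r mulrC.
by apply: (derE (dercomp (g := fun t => a * (t + x0)) (dercos _) h)); rewrite mulN1r mulrC mulrN mulNr.
Qed.

(** The factor sg s is the sign that the derivative of a cosine produces. *)
Definition d1c s c i : R := sg s * (fm R i * ax L) * c i.
Definition d2c s c i : R := sg s * (fn R i * ay r) * c i.

Lemma tser_derive1 s1 s2 c p : summ c -> summ (d1c s1 c) ->
  is_derive p (@e1 R) (tser s1 s2 c) (tser (~~ s1) s2 (d1c s1 c) p).
Proof.
move=> sc sd; apply/is_derive_e1.
pose F i t : R := c i * tp s1 s2 i (t, p.2).
pose D i t : R := d1c s1 c i * tp (~~ s1) s2 i (t, p.2).
have := @series_derive R F D (fun i => `|d1c s1 c i|) _ (summ_norm sd) _ _ p.1.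
rewrite /F /D -surjective_pairing; apply.
- move=> i x; have h := trg_derive s1 (fm R i * ax L) L x.
  have h2 := derZ (c i) (derM h (dercst (trg s2 (fn R i * ay r * (p.2 + r))) x 1)).
  by apply: (derE h2); rewrite /tprod /d1c /=; ring.
- by move=> i x; exact: tser_term_le.
- by move=> x; exact: tser_summ.
Qed.

Lemma tser_derive2 s1 s2 c p : summ c -> summ (d2c s2 c) ->
  is_derive p (@e2 R) (tser s1 s2 c) (tser s1 (~~ s2) (d2c s2 c) p).
Proof.
move=> sc sd; apply/is_derive_e2.
pose F i t : R := c i * tp s1 s2 i (p.1, t).
pose D i t : R := d2c s2 c i * tp s1 (~~ s2) i (p.1, t).
have := @series_derive R F D (fun i => `|d2c s2 c i|) _ (summ_norm sd) _ _ p.2.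
rewrite /F /D -surjective_pairing; apply.
- move=> i x; have h := trg_derive s2 (fn R i * ay r) r x.
  have h2 := derZ (c i) (derM (dercst (trg s1 (fm R i * ax L * (p.1 + L))) x 1) h).
  by apply: (derE h2); rewrite /tprod /d2c /=; ring.
- by move=> i x; exact: tser_term_le.
- by move=> x; exact: tser_summ.
Qed.

End TrigSeries.

(** * The maximum principle *)

Section SecondDerivativeTest.
Variable R : realType.

(** A positive derivative of g1 at t, where g1 vanishes, would make g1 positive
    and g increasing just to the right of t. *)
Lemma second_derivative_at_max (g g1 : R -> R) (a b t d : R) :
  a < t < b -> (forall s, a < s < b -> is_derive s 1 g (g1 s)) ->
  is_derive t 1 g1 d -> (forall s, a < s < b -> g s <= g t) -> d <= 0.
Proof.
move=> /andP[at_ tb] dg dg1 gmax; rewrite leNgt; apply/negP => d0.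
have ab : a < b by exact: lt_trans tb.
have g1t : g1 t = 0.
  have h1 : is_derive t 1 g (g1 t) by apply: dg; rewrite at_ tb.
  have h2 : is_derive t 1 g 0.
    apply: (@derive1_at_max _ g a b t (ltW ab)).
    - by move=> s; rewrite in_itv /= => /dg [].
    - by rewrite in_itv /= at_ tb.
    - by move=> s; rewrite in_itv /= => /gmax.
  by have [_ <-] := h1; have [_ ->] := h2.
have /is_deriveP/cvgrPdist_lt/(_ _ d0) := dg1.
rewrite g1t => /nbhs_ballP [/= e e0 He].
pose h := Num.min e (b - t) / 2.
have bt : 0 < b - t by rewrite subr_gt0.
have m0 : 0 < Num.min e (b - t) by rewrite lt_min e0 bt.
have h0 : 0 < h by rewrite divr_gt0.
have he : h < e.
  rewrite ltr_pdivrMr//; apply: (@le_lt_trans _ _ e); first by rewrite ge_min lexx.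
  by rewrite mulr_natr mulr2n ltrDl.
have hb : t + h < b.
  rewrite -ltrBrDl ltr_pdivrMr//; apply: (@le_lt_trans _ _ (b - t)); first by rewrite ge_min lexx orbT.
  by rewrite mulr_natr mulr2n ltrDl.
have pos s : t < s < t + h -> 0 < g1 s.
  move=> /andP[ts sh].
  have k0 : 0 < s - t by rewrite subr_gt0.
  have := He (s - t); rewrite /ball /= sub0r normrN gtr0_norm// subr_eq0 (gt_eqF ts).
  have -> : s - t < e by apply: lt_trans he; rewrite ltrBlDl.
  move=> /(_ isT isT); rewrite /GRing.scale /= mulr1 subrK subr0 => h1.
  have : 0 < (s - t)^-1 * g1 s by move: h1; rewrite ltr_norml; lra.
  by rewrite pmulr_rgt0// invr_gt0.
have th : t < t + h by rewrite ltrDl.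
have dg' s : s \in `]t, (t + h)[ -> is_derive s 1 g (g1 s).
  rewrite in_itv /= => /andP[s1 s2]; apply: dg.
  by rewrite (lt_trans at_ s1) (lt_trans s2 hb).
have cg : {within `[t, t + h], continuous g}.
  apply: derivable_within_continuous => s; rewrite in_itv /= => /andP[s1 s2].
  have hs : a < s < b by rewrite (lt_le_trans at_ s1) (le_lt_trans s2 hb).
  by have [] := dg s hs.
have [c /[!in_itv]/= hc e1] := MVT th dg' cg.
have : g (t + h) <= g t by apply: gmax; rewrite hb (lt_trans at_ th).
by rewrite -subr_le0 e1 leNgt mulr_gt0 ?pos// subr_gt0.
Qed.

End SecondDerivativeTest.

Section Poisson.
Variables (R : realType) (L r : R).
Hypotheses (L0 : 0 < L) (r0 : 0 < r).
Implicit Types (z f : R * R -> R) (c : nat -> R) (p : R * R).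
Local Notation kp := (kap L r).
Local Notation ph := (phi L r).
Local Notation Om := (open_rectangle L r).
Local Notation crect := (crect L r).
Local Notation e1 := (@e1 R).
Local Notation e2 := (@e2 R).

(** Only the two pure second derivatives are asked for, and only inside, as a
    classical eigenfunction is merely continuous at the boundary. *)
Definition neg_laplacian z f := exists z1 z11 z2 z22 : R * R -> R, forall p, Om p ->
  [/\ is_derive p e1 z (z1 p), is_derive p e1 z1 (z11 p),
      is_derive p e2 z (z2 p), is_derive p e2 z2 (z22 p) & z11 p + z22 p = - f p].

Lemma neg_laplacianD z f z' f' : neg_laplacian z f -> neg_laplacian z' f' ->
  neg_laplacian (fun p => z p + z' p) (fun p => f p + f' p).
Proof.
move=> [z1 [z11 [z2 [z22 H]]]] [y1 [y11 [y2 [y22 G]]]].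
exists (fun p => z1 p + y1 p), (fun p => z11 p + y11 p),
  (fun p => z2 p + y2 p), (fun p => z22 p + y22 p) => p hp.
have [a1 a2 a3 a4 a5] := H p hp; have [b1 b2 b3 b4 b5] := G p hp.
by split; [exact: derD..|lra].
Qed.

Lemma neg_laplacianZ z f k : neg_laplacian z f ->
  neg_laplacian (fun p => k * z p) (fun p => k * f p).
Proof.
move=> [z1 [z11 [z2 [z22 H]]]].
exists (fun p => k * z1 p), (fun p => k * z11 p),
  (fun p => k * z2 p), (fun p => k * z22 p) => p hp.
have [a1 a2 a3 a4 a5] := H p hp.
by split; [exact: derZ..|rewrite -mulrDr a5 mulrN].
Qed.

Lemma eq_neg_laplacian z z' f f' : z =1 z' -> f =1 f' ->
  neg_laplacian z f -> neg_laplacian z' f'.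
Proof. by move=> /funext -> /funext ->. Qed.

Lemma neg_laplacian_phi i : neg_laplacian (ph i) (fun p => kp i * ph i p).
Proof.
pose a := fm R i * ax L; pose b := fn R i * ay r.
exists (fun p => a * tprod L r false true i p), (fun p => a * (- a * ph i p)),
  (fun p => b * tprod L r true false i p), (fun p => b * (- b * ph i p)) => p _.
have x1 (s : bool) := trg_derive s a L p.1; have y1 (s : bool) := trg_derive s b r p.2.
split; last by rewrite /kap -/a -/b; ring.
- apply/is_derive_e1; apply: (derE (derM (x1 true) (dercst (trg true (b * (p.2 + r))) _ _))).
  by rewrite /tprod /sg /= -/a -/b; ring.
- apply/is_derive_e1; apply: derZ.
  apply: (derE (derM (x1 false) (dercst (trg true (b * (p.2 + r))) _ _))).
  by rewrite /phi /tprod /sg /= -/a -/b; ring.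
- apply/is_derive_e2; apply: (derE (derM (dercst (trg true (a * (p.1 + L))) _ _) (y1 true))).
  by rewrite /tprod /sg /= -/a -/b; ring.
- apply/is_derive_e2; apply: derZ.
  apply: (derE (derM (dercst (trg true (a * (p.1 + L))) _ _) (y1 false))).
  by rewrite /phi /tprod /sg /= -/a -/b; ring.
Qed.

Lemma neg_laplacian_sine_poly c N :
  neg_laplacian (fun p => \sum_(i < N) c i * ph i p)
                (fun p => \sum_(i < N) c i * (kp i * ph i p)).
Proof.
elim: N => [|N IH].
  exists (fun=> 0), (fun=> 0), (fun=> 0), (fun=> 0) => p _.
  have -> : (fun p => \sum_(i < 0) c i * ph i p) = (fun=> 0).
    by apply/funext => q; rewrite big_ord0.
  by split; [exact: dercst..|rewrite big_ord0 addr0 oppr0].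
apply: eq_neg_laplacian (neg_laplacianD IH (neg_laplacianZ (c N) (neg_laplacian_phi N))) => p.
  by rewrite big_ord_recr.
by rewrite big_ord_recr.
Qed.

(** The weak maximum principle, by comparison with a parabola in x. *)
Lemma max_principle z f (e : R) : neg_laplacian z f -> continuous z ->
  (forall p, crect p -> ~ Om p -> z p <= 0) -> (forall p, Om p -> f p <= e) ->
  0 <= e -> forall p, crect p -> z p <= e * L ^+ 2.
Proof.
move=> [z1 [z11 [z2 [z22 H]]]] cz zb fe e0 p cp.
have ePos : z p <= e * (L ^+ 2 / 2) + 0 -> z p <= e * L ^+ 2.
  have := sqr_ge0 L; set A := L ^+ 2 => A0.
  by have := mulr_ge0 e0 A0; lra.
apply: ePos; apply/ler_addgt0Pr => d d0; rewrite addr0.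
have A0 : 0 < L ^+ 2 by rewrite exprn_gt0.
pose k := e + d / L ^+ 2.
have kd : 0 < d / L ^+ 2 by rewrite divr_gt0.
have k0 : 0 < k by rewrite ltr_wpDl.
pose y q := z q - k / 2 * (L ^+ 2 - q.1 ^+ 2).
have cy : continuous y by rewrite /y; cont.
have ne : crect !=set0 by exists p.
have [q /set_mem cq Hq] := compact_EVT_max ne (@crect_compact R L r) (continuous_subspaceT cy).
have y0 : y q <= 0.
  have [oq|oq] := pselect (Om q); last first.
    have [/andP[q1 q2] _] := cq; have := zb q cq oq; rewrite /y.
    have : 0 <= k / 2 * (L ^+ 2 - q.1 ^+ 2).
      by rewrite mulr_ge0 ?divr_ge0 ?(ltW k0)// subr_sqr mulr_ge0; lra.
    by lra.
  exfalso; have [qa qb] := (orectP L r q).1 oq.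
  have [a1 a2 a3 a4 a5] := H q oq.
  have s1 : z11 q + k <= 0.
    apply: (@second_derivative_at_max R (fun t => y (t, q.2))
      (fun t => z1 (t, q.2) + k * t) (- L) L q.1 _ qa).
    - move=> s hs; have op : Om (s, q.2) by apply/orectP.
      have [/is_derive_e1 /= b1 _ _ _ _] := H _ op.
      have h := derB b1 (derZ (k / 2) (derB (dercst (L ^+ 2) s 1) (derpow 2 (derid s)))).
      by apply: (derE h); rewrite /= expr1; field.
    - move/is_derive_e1: a2 => a2; have h := derD a2 (derZ k (derid q.1)).
      by apply: (derE h); rewrite mulr1.
    - move=> s hs; rewrite -surjective_pairing; apply: Hq; rewrite inE.
      by apply: orect_crect; apply/orectP.
  have s2 : z22 q <= 0.
    apply: (@second_derivative_at_max R (fun t => y (q.1, t))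
      (fun t => z2 (q.1, t)) (- r) r q.2 _ qb).
    - move=> s hs; have op : Om (q.1, s) by apply/orectP.
      have [_ _ /is_derive_e2 /= b1 _ _] := H _ op.
      have h := derB b1 (dercst (k / 2 * (L ^+ 2 - q.1 ^+ 2)) s 1).
      by apply: (derE h); rewrite subr0.
    - by move/is_derive_e2: a4.
    - move=> s hs; rewrite -surjective_pairing; apply: Hq; rewrite inE.
      by apply: orect_crect; apply/orectP.
  have := fe q oq; have : k <= f q by lra.
  by rewrite /k; lra.
have := Hq p (mem_set cp); rewrite /y => h.
have : k / 2 * (L ^+ 2 - p.1 ^+ 2) <= k / 2 * L ^+ 2.
  by rewrite ler_wpM2l ?divr_ge0 ?(ltW k0)// gerBl sqr_ge0.
have -> : k / 2 * L ^+ 2 = e * (L ^+ 2 / 2) + d / 2.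
  by rewrite /k; field; rewrite gt_eqF.
by move: h y0; rewrite /y; lra.
Qed.

End Poisson.

(** * Sine series and Poisson's equation *)

Section Expansion.
Variables (R : realType) (L r : R).
Hypotheses (L0 : 0 < L) (r0 : 0 < r).
Implicit Types (z f g : R * R -> R) (c a : nat -> R) (p : R * R).
Local Notation kp := (kap L r).
Local Notation ph := (phi L r).
Local Notation Om := (open_rectangle L r).
Local Notation crect := (crect L r).
Local Notation IM := (Imean L r).
Local Notation hat := (coef L r).

Definition usr c : R * R -> R := tser L r true true c.

Definition bdry0 f := forall p, crect p -> ~ Om p -> f p = 0.

Lemma usr_cont c : summ c -> continuous (usr c).
Proof. exact: tser_cont. Qed.

Lemma usr_tail c p n : summ c -> `|usr c p - \sum_(i < n) c i * ph i p| <= tail c n.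
Proof. exact: tser_tail. Qed.

Lemma ssum0 : ssum (fun=> 0 : R) = 0.
Proof. by apply: cvg_lim => //; under eq_fun do rewrite big1//; exact: cvg_cst. Qed.

Lemma usr_bdry c : bdry0 (usr c).
Proof.
move=> p cp np; rewrite /usr /tser -[RHS]ssum0; congr ssum; apply/funext => i.
by rewrite -/(phi L r i p) (phi_bdry L0 r0 i cp np) mulr0.
Qed.

Lemma coef_le f M i : continuous f -> (forall p, crect p -> `|f p| <= M) ->
  `|hat f i| <= 4 * M.
Proof.
move=> cf fM; have cp := @phi_cont R L r i.
apply: Imean_norm_le => // [|p hp]; first by cont.
by rewrite normrM -[leRHS]mulr1 ler_pM// ?fM// phi_le1.
Qed.

Lemma coef_bounded f : continuous f -> exists2 M, 0 <= M & forall i, `|hat f i| <= M.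
Proof.
move=> cf; have [M M0 HM] := crect_bounded L r cf.
by exists (4 * M) => [|i]; [rewrite mulr_ge0|exact: coef_le].
Qed.

Lemma eq_coef f g i : (forall p, crect p -> f p = g p) -> hat f i = hat g i.
Proof. by move=> fg; apply: eq_Imean => // p hp; rewrite fg. Qed.

Lemma coefD f g i : continuous f -> continuous g ->
  hat (fun p => f p + g p) i = hat f i + hat g i.
Proof.
move=> cf cg; have cp := @phi_cont R L r i; rewrite /coef -ImeanD; [|by cont..].
by apply: eq_Imean => // p _; rewrite mulrDl.
Qed.

Lemma coefZ f k i : continuous f -> hat (fun p => k * f p) i = k * hat f i.
Proof.
move=> cf; have cp := @phi_cont R L r i; rewrite /coef -ImeanZ; last by cont.
by apply: eq_Imean => // p _; rewrite mulrA.
Qed.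

Lemma coefB f g i : continuous f -> continuous g ->
  hat (fun p => f p - g p) i = hat f i - hat g i.
Proof.
move=> cf cg; have cp := @phi_cont R L r i; rewrite /coef -ImeanB; [|by cont..].
by apply: eq_Imean => // p _; rewrite mulrBl.
Qed.

Lemma summ_mul_bounded c (b : nat -> R) M : summ c -> (forall i, `|b i| <= M) ->
  summ (fun i => c i * b i).
Proof.
move=> sc bM; apply: summ_le (summZ M (summ_norm sc)) => i.
by rewrite normrM mulrC ler_wpM2r.
Qed.

Lemma summ_mul_coef c f : summ c -> continuous f -> summ (fun i => c i * hat f i).
Proof.
by move=> sc cf; have [M _ HM] := coef_bounded cf; exact: summ_mul_bounded HM.
Qed.

Lemma Imean_mul_usr f c : continuous f -> summ c ->
  IM (fun p => f p * usr c p) = ssum (fun i => c i * hat f i).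
Proof.
move=> cf sc; have [M M0 HM] := crect_bounded L r cf.
apply/esym/cvg_lim => //; apply/cvgrPdist_le => e e0.
have e4 : 0 < e / (4 * (M + 1)) by rewrite divr_gt0// mulr_gt0// ltr_wpDl.
have /cvgrPdist_lt/(_ _ e4) := tail_cvg0 sc; apply: filterS => n.
rewrite sub0r normrN => hn; rewrite -Imean_mul_psum//.
have cu := usr_cont sc; have cs := @psum_cont R L r c n.
rewrite -ImeanB => //; [|by cont..].
apply: le_trans (Imean_norm_le (M := M * tail c n) L0 r0 _ _) _; first by cont.
  by move=> p hp; rewrite -mulrBr normrM ler_pM// ?HM// usr_tail.
have t0 := tail_ge0 n sc; move: hn; rewrite ger0_norm// ltr_pdivlMr ?mulr_gt0 ?ltr_wpDl//.
have := mulr_ge0 M0 t0; set t := tail c n in t0 *; nra.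
Qed.

Lemma coef_usr c i : summ c -> hat (usr c) i = c i.
Proof.
move=> sc; have cp := @phi_cont R L r i.
transitivity (IM (fun p => ph i p * usr c p)).
  by apply: eq_Imean => // p _; rewrite mulrC.
rewrite Imean_mul_usr//; apply: cvg_lim => //.
have E n : (i < n)%N -> \sum_(j < n) c j * hat (ph i) j = c i.
  move=> ni; rewrite (bigD1 (Ordinal ni))//= {1}/coef Imean_phi// eqxx mulr1.
  rewrite big1 ?addr0// => j ji; rewrite /coef Imean_phi//.
  rewrite (_ : (i == j) = false) ?mulr0//; apply: negbTE; rewrite eq_sym.
  by apply: contraNN ji => /eqP e; apply/eqP/val_inj.
apply: cvg_near_cst; exists i.+1 => // n /= ni; exact: E.
Qed.

(** A continuous function vanishing on the boundary is the sum of its sine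
    series as soon as the latter converges absolutely: the difference is
    orthogonal to the uniformly dense sine polynomials. *)
Theorem sine_expansion g : continuous g -> bdry0 g -> summ (hat g) ->
  forall p, crect p -> g p = usr (hat g) p.
Proof.
move=> cg g0 sg; have cu := usr_cont sg.
pose h p := g p - usr (hat g) p.
have ch : continuous h by rewrite /h; cont.
have h0 : bdry0 h by move=> p hp np; rewrite /h g0// usr_bdry// subrr.
have hc i : hat h i = 0 by rewrite coefB// coef_usr// subrr.
have [M M0 HM] := crect_bounded L r ch.
have hh : IM (fun p => h p ^+ 2) = 0.
  apply/eqP; rewrite eq_le Imean_ge0 ?andbT//; last by move=> p _; exact: sqr_ge0.
  apply/ler_addgt0Pr => e e0; rewrite add0r.
  have e4 : 0 < e / (4 * (M + 1)) by rewrite divr_gt0// mulr_gt0// ltr_wpDl.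
  have [s [N [c sE]] Hs] := sine_density L0 r0 ch h0 e4.
  have cs := @psum_cont R L r c N.
  have -> : IM (fun p => h p ^+ 2) = IM (fun p => h p * (h p - s p)).
    have -> : IM (fun p => h p * (h p - s p)) =
        IM (fun p => h p ^+ 2) - IM (fun p => h p * \sum_(i < N) c i * ph i p).
      have c1 : continuous (fun p => h p ^+ 2) by cont.
      have c2 : continuous (fun p => h p * \sum_(i < N) c i * ph i p) by cont.
      rewrite -(ImeanB L0 r0 c1 c2).
      by apply: eq_Imean => // p _; rewrite sE mulrBr.
    by rewrite Imean_mul_psum// big1 ?subr0// => i _; rewrite hc mulr0.
  apply: le_trans (ler_norm _) _.
  apply: le_trans (Imean_norm_le (M := M * (e / (4 * (M + 1)))) L0 r0 _ _) _.
  - have : continuous (fun p => h p * (h p - \sum_(i < N) c i * ph i p)) by cont.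
    by apply: continuous_eq => p; rewrite sE.
  - by move=> p hp; rewrite normrM ler_pM// ?HM// Hs.
  rewrite mulrA [leLHS]mulrA ler_pdivrMr ?mulr_gt0 ?ltr_wpDl//.
  by have := e0; have := mulr_ge0 M0 (ltW e0); lra.
move=> p hp; have [op|op] := pselect (Om p); last by rewrite g0// usr_bdry.
have := Imean_eq0 L0 r0 (contX (n := 2) ch) (fun p _ => sqr_ge0 (h p)) hh op.
by move/eqP; rewrite sqrf_eq0 subr_eq0 => /eqP.
Qed.

Lemma summ_coef_sqr f : continuous f -> summ (fun i => hat f i ^+ 2).
Proof.
move=> cf; apply: (summ_nneg (M := IM (fun p => f p ^+ 2))) => [i|n].
  exact: sqr_ge0.
exact: bessel.
Qed.

Lemma summ_div_kap (b : nat -> R) : summ (fun i => b i ^+ 2) -> summ (fun i => (kp i)^-1 * b i).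
Proof.
have [M HM] := sum_inv_kap_sqr L0 r0.
apply: summ_sqr_mul; apply: (summ_nneg (M := M)) => [i|n]; first exact: sqr_ge0.
by under eq_bigr do rewrite exprVn; exact: HM.
Qed.

(** Poisson's equation diagonalises in the sine basis, with no regularity
    assumed up to the boundary: approximate the source uniformly by sine
    polynomials, solve for these explicitly, and compare by the maximum
    principle. *)
Theorem poisson_coef z f : neg_laplacian L r z f -> continuous z -> continuous f ->
  bdry0 z -> bdry0 f -> forall i, kp i * hat z i = hat f i.
Proof.
move=> zf cz cf' z0 f0 i; apply/eqP; rewrite -subr_eq0 -normr_le0.
have kpi : 0 < kp i by exact: kap_gt0.
apply/ler_addgt0Pr => e e0; rewrite add0r.
pose A := kp i * (4 * L ^+ 2) + 4.
have A0 : 0 < A.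
  by rewrite ltr_wpDl// mulr_ge0 ?(ltW kpi)// mulr_ge0// sqr_ge0.
pose d := e / A; have d0 : 0 < d by rewrite divr_gt0.
have [s [N [c sE]] Hs] := sine_density L0 r0 cf' f0 d0.
pose v p := \sum_(j < N) ((kp j)^-1 * c j) * ph j p.
have cv : continuous v by exact: (@psum_cont R L r (fun j => (kp j)^-1 * c j) N).
have cs : continuous s.
  have -> : s = (fun p => \sum_(j < N) c j * ph j p) by apply/funext.
  exact: psum_cont.
have k0 j : kp j != 0 by rewrite gt_eqF// kap_gt0.
have vs : neg_laplacian L r v s.
  apply: eq_neg_laplacian (neg_laplacian_sine_poly L r (fun j => (kp j)^-1 * c j) N) => // p.
  rewrite sE; apply: eq_bigr => j _; have := k0 j.
  by move: (kp j) (c j) (ph j p) => k a b k1; field.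
have zv (k : R) : (k = 1) \/ (k = -1) -> forall p, crect p -> k * (z p - v p) <= d * L ^+ 2.
  move=> hk.
  have nl := neg_laplacianZ k (neg_laplacianD zf (neg_laplacianZ (-1) vs)).
  have cc : continuous (fun p => k * (z p + -1 * v p)) by cont.
  move=> p hp; have -> : k * (z p - v p) = k * (z p + -1 * v p) by rewrite mulN1r.
  apply: (max_principle L0 nl cc) => //; last exact: ltW.
  - move=> q hq nq; rewrite z0// /v big1 ?mulr0 ?addr0 ?mulr0// => j _.
    by rewrite (phi_bdry L0 r0 _ hq nq) mulr0.
  - move=> q oq; have := Hs q (orect_crect oq); rewrite ler_norml => /andP[h1 h2].
    by case: hk => ->; lra.
have zv' p : crect p -> `|z p - v p| <= d * L ^+ 2.
  move=> hp; rewrite ler_norml; have h1 := zv 1 (or_introl erefl) p hp.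
  by have h2 := zv (-1) (or_intror erefl) p hp; apply/andP; split; lra.
have vE : kp i * hat v i = hat s i.
  rewrite (eq_coef (f := s) (g := fun p => \sum_(j < N) c j * ph j p))//.
  rewrite coef_psum// (coef_psum L0 r0 (fun j => (kp j)^-1 * c j) N i).
  by case: ifP => _; rewrite ?mulr0// mulrA mulfV// mul1r.
have split_diff (k x y x' y' : R) : k * x' = y' -> k * x - y = k * (x - x') - (y - y').
  by move=> <-; ring.
rewrite (split_diff _ _ _ _ _ vE) -(coefB i cz cv) -(coefB i cf' cs).
have b1 : `|hat (fun p => z p - v p) i| <= 4 * (d * L ^+ 2) by apply: coef_le => //; cont.
have b2 : `|hat (fun p => f p - s p) i| <= 4 * d by apply: coef_le => //; cont.
apply: le_trans (ler_normB _ _) _; rewrite normrM gtr0_norm ?kap_gt0//.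
apply: le_trans (lerD (ler_wpM2l (ltW kpi) b1) b2) _.
have -> : e = d * A by rewrite /d divfK// gt_eqF.
by rewrite /A le_eqVlt; apply/orP; left; apply/eqP; ring.
Qed.

Lemma poisson_summ z f : neg_laplacian L r z f -> continuous z -> continuous f ->
  bdry0 z -> bdry0 f -> summ (hat z).
Proof.
move=> zf cz cf' z0 f0; apply: summ_eq (summ_div_kap (summ_coef_sqr cf')) => i.
by rewrite -(poisson_coef zf)// mulrA mulVf ?mul1r// gt_eqF// kap_gt0.
Qed.

Theorem poisson_expansion z f : neg_laplacian L r z f -> continuous z -> continuous f ->
  bdry0 z -> bdry0 f -> forall p, crect p -> z p = usr (hat z) p.
Proof.
by move=> zf cz cf' z0 f0; apply: sine_expansion => //; exact: poisson_summ zf _ _ _ _.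
Qed.

End Expansion.

(** * The density in the sine basis *)

Lemma le_one_add_sqr (R : realType) (t : R) : t <= 1 + t ^+ 2.
Proof. by have := sqr_ge0 (t - 1); have := sqr_ge0 t; lra. Qed.

Section WeightMatrix.
Variables (R : realType) (L r : R).
Hypotheses (L0 : 0 < L) (r0 : 0 < r) (Lr1 : L ^+ 2 + r ^+ 2 < 1).
Implicit Types (z f g y : R * R -> R) (a b c x : nat -> R) (p : R * R).
Local Notation kp := (kap L r).
Local Notation ph := (phi L r).
Local Notation crect := (crect L r).
Local Notation IM := (Imean L r).
Local Notation hat := (coef L r).
Local Notation us := (usr L r).
Local Notation w := (wt L r).

Let cw : continuous w := wt_cont L0 r0 Lr1.
Let cph i : continuous (ph i) := @phi_cont R L r i.

Definition wmat i j : R := IM (fun p => w p * (ph i p * ph j p)).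
Definition sk i : R := Num.sqrt (kp i).
(** The generalised eigenvalue problem for the weight and the Laplace
    eigenvalues is conjugated to a symmetric one.  The entries are square-
    summable because the rows of the weight matrix are bounded and the inverse
    squares of the Laplace eigenvalues have a finite sum. *)
Definition hsmat i j : R := (sk i)^-1 * (sk j)^-1 * wmat i j.

Lemma sk_gt0 i : 0 < sk i.
Proof. by rewrite sqrtr_gt0 kap_gt0. Qed.

Lemma sk_neq0 i : sk i != 0.
Proof. by rewrite gt_eqF// sk_gt0. Qed.

Lemma sk_sqr i : sk i ^+ 2 = kp i.
Proof. by rewrite sqr_sqrtr// ltW// kap_gt0. Qed.

Lemma wmat_sym i j : wmat i j = wmat j i.
Proof. by apply: eq_Imean => // p _; rewrite (mulrC (ph i p)). Qed.

Lemma hsmat_sym i j : hsmat i j = hsmat j i.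
Proof. by rewrite /hsmat wmat_sym (mulrC (sk i)^-1). Qed.

Lemma inv_kap_bounded : exists2 B, 0 <= B & forall i, (kp i)^-1 <= B.
Proof.
exists ((ax L ^+ 2)^-1) => [|i]; first by rewrite invr_ge0 sqr_ge0.
rewrite lef_pV2 ?posrE ?kap_gt0 ?exprn_gt0 ?ax_gt0//.
apply: (@le_trans _ _ ((fm R i * ax L) ^+ 2)); last by rewrite lerDl sqr_ge0.
by rewrite [leRHS]exprMn ler_peMl ?sqr_ge0// exprn_ege1// fm_ge1.
Qed.

Lemma hsmat_hilbert_schmidt : hilbert_schmidt hsmat.
Proof.
have [C C0 HC] := wt_row L0 r0 Lr1.
have [M HM] := sum_inv_kap_sqr L0 r0.
have W2 i n : \sum_(j < n) wmat i j ^+ 2 <= C ^+ 2.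
  apply: (@le_trans _ _ (\sum_(j < n) C * `|wmat i j|)).
    apply: ler_sum => j _; rewrite -[leLHS]ger0_norm ?sqr_ge0// normrX expr2 ler_wpM2r//.
    apply: le_trans (HC i j.+1); rewrite big_ord_recr /= lerDr; exact: sumr_ge0.
  rewrite -big_distrr expr2 /= ler_wpM2l//; exact: HC.
exists (C ^+ 2 * M) => n; rewrite /hs.
apply: (@le_trans _ _ (\sum_(i < n) \sum_(j < n)
    (1 / 2 * ((kp i ^+ 2)^-1 * wmat i j ^+ 2) + 1 / 2 * ((kp j ^+ 2)^-1 * wmat i j ^+ 2)))).
  apply: ler_sum => i _; apply: ler_sum => j _.
  have -> : hsmat i j ^+ 2 = (kp i)^-1 * (kp j)^-1 * wmat i j ^+ 2.
    rewrite /hsmat -!sk_sqr; have := sk_neq0 i; have := sk_neq0 j.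
    by move: (sk i) (sk j) (wmat i j) => s t W t0 s0; field; rewrite ?t0 ?s0.
  rewrite -(exprVn (kp i)) -(exprVn (kp j)).
  have := sqr_ge0 ((kp i)^-1 - (kp j)^-1); have := sqr_ge0 (wmat i j).
  move: ((kp i)^-1) ((kp j)^-1) (wmat i j ^+ 2) => s t W W0 h.
  by have := mulr_ge0 W0 h; lra.
have half : \sum_(i < n) \sum_(j < n) (kp i ^+ 2)^-1 * wmat i j ^+ 2 <= C ^+ 2 * M.
  apply: le_trans (ler_wpM2l (sqr_ge0 C) (HM n)).
  rewrite big_distrr; apply: ler_sum => i _ /=.
  by rewrite -big_distrr /= mulrC ler_wpM2r ?W2// invr_ge0 sqr_ge0.
have half' : \sum_(i < n) \sum_(j < n) (kp j ^+ 2)^-1 * wmat i j ^+ 2 =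
    \sum_(i < n) \sum_(j < n) (kp i ^+ 2)^-1 * wmat i j ^+ 2.
  rewrite exchange_big; apply: eq_bigr => i _; apply: eq_bigr => j _.
  by rewrite wmat_sym.
have -> : \sum_(i < n) \sum_(j < n) (1 / 2 * ((kp i ^+ 2)^-1 * wmat i j ^+ 2) +
    1 / 2 * ((kp j ^+ 2)^-1 * wmat i j ^+ 2)) =
    1 / 2 * (\sum_(i < n) \sum_(j < n) (kp i ^+ 2)^-1 * wmat i j ^+ 2) +
    1 / 2 * (\sum_(i < n) \sum_(j < n) (kp j ^+ 2)^-1 * wmat i j ^+ 2).
  rewrite !big_distrr -big_split; apply: eq_bigr => i _ /=.
  by rewrite !big_distrr -big_split.
by rewrite half'; move: half; set A := \sum_(i < n) _ => h; lra.
Qed.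

Lemma coef_wt_phi i j : hat (fun p => w p * ph i p) j = wmat i j.
Proof. by apply: eq_Imean => // p _; rewrite mulrA. Qed.

Lemma coef_wt_usr c i : summ c ->
  hat (fun p => w p * us c p) i = ssum (fun j => c j * wmat i j).
Proof.
move=> sc; have ci := @cph i.
have cwi : continuous (fun p => w p * ph i p) by cont.
transitivity (IM (fun p => (w p * ph i p) * us c p)).
  by apply: eq_Imean => // p _; ring.
rewrite (Imean_mul_usr L0 r0 cwi sc).
by apply: (congr1 (@ssum R)); apply/funext => j; rewrite coef_wt_phi.
Qed.

Lemma wmat_col_le : exists2 C, 0 <= C & forall c n m,
  \sum_(i < m) `|\sum_(j < n) c j * wmat i j| <= C * \sum_(j < n) `|c j|.
Proof.
have [C C0 HC] := wt_row L0 r0 Lr1; exists C => // c n m.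
apply: (@le_trans _ _ (\sum_(j < n) \sum_(i < m) `|c j| * `|wmat j i|)).
  rewrite exchange_big /=; apply: ler_sum => i _.
  apply: le_trans (ler_norm_sum _ _ _) _; apply: ler_sum => j _.
  by rewrite normrM wmat_sym.
rewrite big_distrr; apply: ler_sum => j _ /=.
rewrite -big_distrr /= mulrC ler_wpM2r//; exact: HC.
Qed.

Lemma psum_cvg m (F : nat -> nat -> R) (l : nat -> R) :
  (forall i, F i n @[n --> \oo] --> l i) ->
  \sum_(i < m) F i n @[n --> \oo] --> \sum_(i < m) l i.
Proof.
move=> H; elim: m => [|m IH].
  by rewrite big_ord0; under eq_fun do rewrite big_ord0; exact: cvg_cst.
rewrite big_ord_recr /=; under eq_fun do rewrite big_ord_recr /=.
exact: cvgD.
Qed.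

(** Absolutely summable sine series form a module over the weight. *)
Lemma summ_coef_wt_usr c : summ c -> summ (hat (fun p => w p * us c p)).
Proof.
move=> sc; have [C C0 HC] := wmat_col_le.
exists (C * ssum (fun i => `|c i|)) => m.
have sW i : summ (fun j => c j * wmat i j).
  have ci := @cph i; have cwi : continuous (fun p => w p * ph i p) by cont.
  by apply: summ_eq (summ_mul_coef L0 r0 sc cwi) => j; rewrite coef_wt_phi.
have h : \sum_(i < m) `|\sum_(j < n) c j * wmat i j| @[n --> \oo] -->
    \sum_(i < m) `|hat (fun p => w p * us c p) i|.
  apply: (psum_cvg (F := fun i n => `|\sum_(j < n) c j * wmat i j|)
    (l := fun i => `|hat (fun p => w p * us c p) i|)) => i; rewrite coef_wt_usr//.
  by apply: cvg_norm; exact: summ_cvg.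
rewrite -(cvg_lim _ h)//; apply: limr_le; first by apply/cvg_ex; eexists; exact: h.
apply: nearW => n; apply: le_trans (HC _ _ _) _; rewrite ler_wpM2l//.
by apply: psum_le_ssum => //; exact: summ_norm.
Qed.

Lemma div_sk_bounded b : l2 b -> exists2 B, 0 <= B & forall n, \sum_(i < n) ((sk i)^-1 * b i) ^+ 2 <= B.
Proof.
move=> lb; have [K K0 HK] := inv_kap_bounded.
exists (K * dot b b) => [|n]; first by rewrite mulr_ge0// dot_ge0.
apply: le_trans (ler_wpM2l K0 (psum_le_dot n lb)); rewrite big_distrr; apply: ler_sum => i _ /=.
by rewrite exprMn exprVn sk_sqr ler_wpM2r ?sqr_ge0.
Qed.

(** The Hilbert-Schmidt form, evaluated at the rescaled coefficients of an
    absolutely convergent sine series, is integration against the weight. *)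
Lemma blim_usr b a : l2 b -> summ a ->
  bform hsmat n b (fun i => sk i * a i) - 
    \sum_(i < n) ((sk i)^-1 * b i) * hat (fun p => w p * us a p) i @[n --> \oo] --> (0 : R).
Proof.
move=> lb sa; have [B B0 HB] := div_sk_bounded lb.
have [M M0 HM] := crect_bounded L r cw.
have ca := usr_cont sa : continuous (us a).
pose K := 4 * M * (4 + B).
have K0 : 0 <= K by rewrite !mulr_ge0// addr_ge0.
have h n : `|bform hsmat n b (fun i => sk i * a i) -
    \sum_(i < n) ((sk i)^-1 * b i) * hat (fun p => w p * us a p) i| <= K * tail a n.
  pose S p := \sum_(j < n) a j * ph j p.
  pose G p := \sum_(i < n) ((sk i)^-1 * b i) * ph i p.
  have cS : continuous S by exact: psum_cont.
  have cG : continuous G by exact: (@psum_cont R L r (fun i => (sk i)^-1 * b i) n).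
  have E1 : bform hsmat n b (fun i => sk i * a i) = IM (fun p => (w p * S p) * G p).
    have cwS : continuous (fun p => w p * S p) by cont.
    rewrite (Imean_mul_psum L0 r0 (fun i => (sk i)^-1 * b i) n cwS).
    apply: eq_bigr => i _; have ci := @cph i.
    have cwi : continuous (fun p => w p * ph i p) by cont.
    have -> : hat (fun p => w p * S p) i = IM (fun p => (w p * ph i p) * S p).
      by apply: eq_Imean => // p _; ring.
    rewrite (Imean_mul_psum L0 r0 a n cwi) big_distrr; apply: eq_bigr => j _ /=.
    rewrite coef_wt_phi /hsmat; have := sk_neq0 j; move: (sk i)^-1 (sk j) (wmat i j) => s t W t0.
    by field.
  have E2 : \sum_(i < n) ((sk i)^-1 * b i) * hat (fun p => w p * us a p) i =
      IM (fun p => (w p * us a p) * G p).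
    have cwu : continuous (fun p => w p * us a p) by cont.
    by rewrite (Imean_mul_psum L0 r0 (fun i => (sk i)^-1 * b i) n cwu).
  have c1 : continuous (fun p => (w p * S p) * G p) by cont.
  have c2 : continuous (fun p => (w p * us a p) * G p) by cont.
  rewrite E1 E2 -(ImeanB L0 r0 c1 c2).
  have t0 := tail_ge0 n sa.
  have G2 : IM (fun p => G p ^+ 2) <= B.
    have -> : IM (fun p => G p ^+ 2) = \sum_(i < n) ((sk i)^-1 * b i) ^+ 2.
      transitivity (IM (fun p => G p * G p)); first by apply: eq_Imean => // p _; rewrite expr2.
      rewrite (Imean_mul_psum L0 r0 (fun i => (sk i)^-1 * b i) n cG).
      apply: eq_bigr => i _; rewrite (coef_psum L0 r0 (fun i => (sk i)^-1 * b i)) ltn_ord.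
      by rewrite expr2.
    exact: HB.
  have cg2 : continuous (fun p => M * tail a n * (1 + G p ^+ 2)) by cont.
  have c3 : continuous (fun p => w p * S p * G p - w p * us a p * G p) by cont.
  have dom p : crect p -> `|w p * S p * G p - w p * us a p * G p| <= M * tail a n * (1 + G p ^+ 2).
    move=> hp; have -> : w p * S p * G p - w p * us a p * G p = w p * (S p - us a p) * G p by ring.
    rewrite (normrM _ (G p)) (normrM (w p)); apply: ler_pM; rewrite ?mulr_ge0//.
      by apply: ler_pM => //; [exact: HM|rewrite distrC; exact: usr_tail].
    rewrite -(real_normK (num_real (G p))); move: (`|G p|) => t.
    exact: le_one_add_sqr.
  have le1 : `|IM (fun p => w p * S p * G p - w p * us a p * G p)| <= IM (fun p => M * tail a n * (1 + G p ^+ 2)).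
    rewrite ler_norml; apply/andP; split.
      rewrite -mulN1r -(@ImeanZ R L r _ _ cg2); apply: ler_Imean => //; first by cont.
      by move=> p hp; have := dom p hp; rewrite ler_norml mulN1r => /andP[].
    by apply: ler_Imean => // p hp; have := dom p hp; rewrite ler_norml => /andP[].
  apply: le_trans le1 _.
  have cG2 : continuous (fun p => G p ^+ 2) by cont.
  have c4 : continuous (fun p => 1 + G p ^+ 2) by cont.
  have co : continuous (fun _ : R * R => 1 : R) by exact: contcst.
  rewrite (@ImeanZ R L r _ _ c4) (@ImeanD R L r _ _ co cG2) Imean_cst.
  have := mulr_ge0 M0 t0; set u := M * tail a n => u0.
  rewrite (_ : K * tail a n = u * (4 * (4 + B))); last by rewrite /K /u; ring.
  rewrite ler_wpM2l//; apply: le_trans (lerD (lexx _) G2) _.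
  by rewrite mulrDr lerD// ?ler_pM2l ?ler1n// ler_peMl// ler1n.
apply/cvgrPdist_le => e e0.
have ct : K * tail a n @[n --> \oo] --> (0 : R).
  by rewrite -(mulr0 K); apply: cvgM; [exact: cvg_cst|exact: tail_cvg0].
have /cvgrPdist_le/(_ _ e0) := ct; apply: filterS => n.
rewrite !sub0r !normrN => hn; apply: le_trans (h n) _.
by apply: le_trans (ler_norm _) hn.
Qed.

Lemma blimE b a : l2 b -> summ a -> l2 (fun i => sk i * a i) ->
  summ (fun i => ((sk i)^-1 * b i) * hat (fun p => w p * us a p) i) ->
  blim hsmat b (fun i => sk i * a i) = ssum (fun i => ((sk i)^-1 * b i) * hat (fun p => w p * us a p) i).
Proof.
move=> lb sa la sW.
have h1 := blim_cvg hsmat_hilbert_schmidt lb la.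
have h2 := blim_usr lb sa; have h3 := summ_cvg sW.
have : blim hsmat b (fun i => sk i * a i) - 0 = ssum (fun i => ((sk i)^-1 * b i) * hat (fun p => w p * us a p) i).
  rewrite -(cvg_lim _ h3)//; apply/esym/cvg_lim => //.
  pose F n := bform hsmat n b (fun i => sk i * a i).
  pose G n := \sum_(i < n) ((sk i)^-1 * b i) * hat (fun p => w p * us a p) i.
  have -> : (fun n => \sum_(i < n) ((sk i)^-1 * b i) * hat (fun p => w p * us a p) i) =
      (fun n => F n - (F n - G n)).
    by apply/funext => n; rewrite subKr.
  exact: cvgB.
by rewrite subr0.
Qed.

End WeightMatrix.

(** * Regularity of sine series *)

Section Regularity.
Variables (R : realType) (L r : R).
Hypotheses (L0 : 0 < L) (r0 : 0 < r).
Implicit Types (c : nat -> R) (p : R * R) (Omega : set (R * R)).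
Local Notation kp := (kap L r).
Local Notation us := (usr L r).
Local Notation ts := (tser L r).

Let u1 i : R := fm R i * ax L.
Let u2 i : R := fn R i * ay r.

Let u1_ge i : ax L <= u1 i.
Proof. by rewrite ler_peMl ?fm_ge1// ltW// ax_gt0. Qed.
Let u2_ge i : ay r <= u2 i.
Proof. by rewrite ler_peMl ?fn_ge1// ltW// ay_gt0. Qed.

Lemma summ_kap_dom c (d : nat -> R) K : summ (fun i => kp i * c i) ->
  (forall i, `|d i| <= K * (kp i * `|c i|)) -> summ d.
Proof.
move=> sc dK; apply: summ_le (summZ K (summ_norm sc)) => i.
by rewrite normrM gtr0_norm ?kap_gt0.
Qed.

Let kap_u i : kp i = u1 i ^+ 2 + u2 i ^+ 2. Proof. by []. Qed.

Let abs_sg (s : bool) : `|sg R s| = 1.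
Proof. by case: s; rewrite /sg ?normrN normr1. Qed.

(** The Laplace eigenvalues are bounded away from zero. *)
Lemma summ_of_kap c : summ (fun i => kp i * c i) -> summ c.
Proof.
move=> sc; have [B B0 HB] := inv_kap_bounded r L0.
apply: (@summ_kap_dom c _ B sc) => i.
have k0 := kap_gt0 r L0 i.
rewrite mulrA ler_peMl// -(mulVf (lt0r_neq0 k0)) ler_wpM2r//; exact: ltW.
Qed.

Let abs_d1c s c i : `|d1c L s c i| = `|u1 i| * `|c i|.
Proof. by rewrite /d1c (normrM _ (c i)) (normrM (sg R s)) abs_sg mul1r. Qed.

Let abs_d2c s c i : `|d2c r s c i| = `|u2 i| * `|c i|.
Proof. by rewrite /d2c (normrM _ (c i)) (normrM (sg R s)) abs_sg mul1r. Qed.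

Lemma summ_d1c s c : summ (fun i => kp i * c i) -> summ (d1c L s c).
Proof.
move=> sc; have a0 := ax_gt0 L0.
apply: (@summ_kap_dom c _ (ax L)^-1 sc) => i.
rewrite abs_d1c mulrA ler_wpM2r//.
have h := u1_ge i; have h0 : 0 < u1 i by exact: lt_le_trans h.
rewrite gtr0_norm// [leRHS]mulrC ler_pdivlMr// kap_u expr2.
by apply: (@le_trans _ _ (u1 i * u1 i)); [rewrite ler_wpM2l// ltW|rewrite lerDl sqr_ge0].
Qed.

Lemma summ_d2c s c : summ (fun i => kp i * c i) -> summ (d2c r s c).
Proof.
move=> sc; have a0 := ay_gt0 r0.
apply: (@summ_kap_dom c _ (ay r)^-1 sc) => i.
rewrite abs_d2c mulrA ler_wpM2r//.
have h := u2_ge i; have h0 : 0 < u2 i by exact: lt_le_trans h.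
rewrite gtr0_norm// [leRHS]mulrC ler_pdivlMr// kap_u expr2.
by apply: (@le_trans _ _ (u2 i * u2 i)); [rewrite ler_wpM2l// ltW|rewrite lerDr sqr_ge0].
Qed.

Let quad_le (a b x y : R) : a ^+ 2 + b ^+ 2 = x -> `|a| * (`|b| * y) <= 1 * (x * y) \/ y < 0.
Proof.
move=> <-; have [y0|y0] := leP 0 y; last by right.
left; rewrite mul1r mulrA ler_wpM2r//.
rewrite -(real_normK (num_real a)) -(real_normK (num_real b)).
move: (`|a|) (`|b|) (normr_ge0 a) (normr_ge0 b) => s t s0 t0.
by have := sqr_ge0 (s - t); have := mulr_ge0 s0 t0; lra.
Qed.

Lemma summ_d11 s s' c : summ (fun i => kp i * c i) -> summ (d1c L s (d1c L s' c)).
Proof.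
move=> sc; apply: (@summ_kap_dom c _ 1 sc) => i; rewrite !abs_d1c mulrA mul1r ler_wpM2r//.
by rewrite -normrM -expr2 ger0_norm ?sqr_ge0// kap_u lerDl sqr_ge0.
Qed.

Lemma summ_d22 s s' c : summ (fun i => kp i * c i) -> summ (d2c r s (d2c r s' c)).
Proof.
move=> sc; apply: (@summ_kap_dom c _ 1 sc) => i; rewrite !abs_d2c mulrA mul1r ler_wpM2r//.
by rewrite -normrM -expr2 ger0_norm ?sqr_ge0// kap_u lerDr sqr_ge0.
Qed.

Lemma summ_d12 s s' c : summ (fun i => kp i * c i) -> summ (d1c L s (d2c r s' c)).
Proof.
move=> sc; apply: (@summ_kap_dom c _ 1 sc) => i; rewrite abs_d1c abs_d2c.
by have [//|] := quad_le (`|c i|) (esym (kap_u i)); rewrite ltNge normr_ge0.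
Qed.

Lemma summ_d21 s s' c : summ (fun i => kp i * c i) -> summ (d2c r s (d1c L s' c)).
Proof.
move=> sc; apply: (@summ_kap_dom c _ 1 sc) => i; rewrite abs_d2c abs_d1c mulrCA.
by have [//|] := quad_le (`|c i|) (esym (kap_u i)); rewrite ltNge normr_ge0.
Qed.

Lemma class_C1_tser Omega s1 s2 c : summ c ->
  (forall s, summ (d1c L s c)) -> (forall s, summ (d2c r s c)) ->
  class_C 1 Omega (ts s1 s2 c).
Proof.
move=> sc s1c s2c; split=> [p _|i]; first exact: tser_cont.
have [->|i0] := eqVneq i ord0.
  rewrite coord_dir0; have D p := tser_derive1 r s2 p sc (s1c s1).
  split=> [p _|]; first by have [] := D p.
  split=> // p _; have -> : 'D_(@e1 R) (ts s1 s2 c) = ts (~~ s1) s2 (d1c L s1 c).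
    by apply/funext => q; have [_ ->] := D q.
  exact: tser_cont.
rewrite (coord_dir1 R i0); have D p := tser_derive2 L s1 p sc (s2c s2).
split=> [p _|]; first by have [] := D p.
split=> // p _; have -> : 'D_(@e2 R) (ts s1 s2 c) = ts s1 (~~ s2) (d2c r s2 c).
  by apply/funext => q; have [_ ->] := D q.
exact: tser_cont.
Qed.

(** Twice differentiating a sine series multiplies its coefficients by at
    most the eigenvalues of the Dirichlet Laplacian. *)
Lemma class_C2_usr Omega c : summ (fun i => kp i * c i) -> class_C 2 Omega (us c).
Proof.
move=> sc; have sc0 := summ_of_kap sc.
split=> [p _|i]; first exact: tser_cont.
have [->|i0] := eqVneq i ord0.
  rewrite coord_dir0; have D p := tser_derive1 r true p sc0 (summ_d1c true sc).
  split=> [p _|]; first by have [] := D p.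
  have -> : 'D_(@e1 R) (us c) = ts false true (d1c L true c).
    by apply/funext => q; have [_ ->] := D q.
  by apply: class_C1_tser => [|s|s]; [exact: summ_d1c|exact: summ_d11|exact: summ_d21].
rewrite (coord_dir1 R i0); have D p := tser_derive2 L true p sc0 (summ_d2c true sc).
split=> [p _|]; first by have [] := D p.
have -> : 'D_(@e2 R) (us c) = ts true false (d2c r true c).
  by apply/funext => q; have [_ ->] := D q.
by apply: class_C1_tser => [|s|s]; [exact: summ_d2c|exact: summ_d12|exact: summ_d22].
Qed.

Lemma neg_laplacian_usr c : summ (fun i => kp i * c i) ->
  neg_laplacian L r (us c) (us (fun i => kp i * c i)).
Proof.
move=> sc; have sc0 := summ_of_kap sc.
exists (ts false true (d1c L true c)), (ts true true (d1c L false (d1c L true c))),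
  (ts true false (d2c r true c)), (ts true true (d2c r false (d2c r true c))) => p _.
split.
- exact: (tser_derive1 r true p sc0 (summ_d1c true sc)).
- exact: (tser_derive1 r true p (summ_d1c true sc) (summ_d11 false true sc)).
- exact: (tser_derive2 L true p sc0 (summ_d2c true sc)).
- exact: (tser_derive2 L true p (summ_d2c true sc) (summ_d22 false true sc)).
have h1 := tser_summ L r true true p (summ_d11 false true sc).
have h2 := tser_summ L r true true p (summ_d22 false true sc).
have h3 := tser_summ L r true true p sc.
rewrite /usr /tser -ssumD// -mulN1r -ssumZ//; apply: (congr1 (@ssum R)); apply/funext => i.
by rewrite /d1c /d2c /sg kap_u /u1 /u2; ring.
Qed.

End Regularity.

(** * Eigenfunctions and eigenvectors *)

Section Eigenfunctions.
Variables (R : realType) (L r : R).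
Hypotheses (L0 : 0 < L) (r0 : 0 < r) (Lr1 : L ^+ 2 + r ^+ 2 < 1).
Implicit Types (z f g y : R * R -> R) (a b c x : nat -> R) (p : R * R).
Local Notation kp := (kap L r).
Local Notation ph := (phi L r).
Local Notation crect := (crect L r).
Local Notation IM := (Imean L r).
Local Notation hat := (coef L r).
Local Notation us := (usr L r).
Local Notation w := (wt L r).
Local Notation hsm := (hsmat L r).

Let cw : continuous w := wt_cont L0 r0 Lr1.
Let kp0 i : 0 < kp i := kap_gt0 r L0 i.
Let kpn i : kp i != 0 := lt0r_neq0 (kp0 i).
Let skn i : sk L r i != 0 := sk_neq0 r L0 i.
Let sks i : sk L r i ^+ 2 = kp i := sk_sqr r L0 i.

(** The classical Dirichlet problem for - Delta z = f, with a source that also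
    vanishes on the boundary.  No control of derivatives up to the boundary is
    included. *)
Definition poisson z f :=
  [/\ neg_laplacian L r z f, continuous z, continuous f, bdry0 L r z & bdry0 L r f].

Definition eigen (mu : R) z := poisson z (fun p => mu * (w p * z p)).

(** In these coordinates the Dirichlet integral is the l2 inner product. *)
Definition vec z i : R := sk L r i * hat z i.

Lemma poissonD z f y g : poisson z f -> poisson y g ->
  poisson (fun p => z p + y p) (fun p => f p + g p).
Proof.
move=> [zf cz cf z0 f0] [yg cy cg y0 g0]; split; [exact: neg_laplacianD|by cont..| |].
  by move=> p hp np; rewrite z0// y0// addr0.
by move=> p hp np; rewrite f0// g0// addr0.
Qed.

Lemma poissonZ z f k : poisson z f -> poisson (fun p => k * z p) (fun p => k * f p).
Proof.
move=> [zf cz cf z0 f0]; split; [exact: neg_laplacianZ|by cont..| |].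
  by move=> p hp np; rewrite z0// mulr0.
by move=> p hp np; rewrite f0// mulr0.
Qed.

Section Pair.
Variables (z f : R * R -> R).
Hypothesis zf : poisson z f.

Lemma pair_coef i : kp i * hat z i = hat f i.
Proof. by case: zf => *; exact: poisson_coef. Qed.

Lemma pair_summ : summ (hat z).
Proof. by case: zf => nl *; exact: poisson_summ nl _ _ _ _. Qed.

Lemma pair_expansion p : crect p -> z p = us (hat z) p.
Proof. by case: zf => nl *; exact: poisson_expansion nl _ _ _ _ _ _. Qed.

Lemma pair_cont : continuous z. Proof. by case: zf. Qed.
Lemma pair_cont2 : continuous f. Proof. by case: zf. Qed.

Lemma pair_l2 : l2 (vec z).
Proof.
apply: summ_eq (summ_mul_coef L0 r0 pair_summ pair_cont2) => i.
by rewrite -pair_coef -sks /vec; move: (sk L r i) (hat z i) => s t; ring.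
Qed.

End Pair.

Lemma pair_dot z f y g : poisson z f -> poisson y g ->
  dot (vec z) (vec y) = IM (fun p => f p * y p).
Proof.
move=> zf yg; have cf := pair_cont2 zf.
transitivity (IM (fun p => f p * us (hat y) p)); last first.
  by apply: (eq_Imean L0 r0) => p hp; exact: (congr1 (fun t => _ * t) (esym (pair_expansion yg hp))).
rewrite (Imean_mul_usr L0 r0 cf (pair_summ yg)).
apply: (congr1 (@ssum R)); apply/funext => i.
by rewrite -(pair_coef zf) -sks /vec; move: (sk L r i) (hat z i) (hat y i) => s t u; ring.
Qed.

Lemma eq_coef_wt z f i : poisson z f -> hat (fun p => w p * us (hat z) p) i = hat (fun p => w p * z p) i.
Proof. by move=> zf; apply: eq_coef => // p hp; rewrite -(pair_expansion zf hp). Qed.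

Lemma pair_blim z f y g : poisson z f -> poisson y g ->
  blim hsm (vec y) (vec z) = IM (fun p => w p * z p * y p).
Proof.
move=> zf yg; have cz := pair_cont zf.
have cwz : continuous (fun p => w p * z p) by cont.
have E : (fun i => (sk L r i)^-1 * vec y i * hat (fun p => w p * us (hat z) p) i) =
    (fun i => hat y i * hat (fun p => w p * z p) i).
  by apply/funext => i; rewrite (eq_coef_wt i zf) /vec mulKf.
rewrite /vec (blimE L0 r0 Lr1 (pair_l2 yg) (pair_summ zf) (pair_l2 zf)); last first.
  by rewrite E; exact: summ_mul_coef (pair_summ yg) cwz.
rewrite E -(Imean_mul_usr L0 r0 cwz (pair_summ yg)).
by apply: (eq_Imean L0 r0) => p hp; exact: (congr1 (fun t => _ * t) (esym (pair_expansion yg hp))).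
Qed.

Lemma eigen_blim mu z b : 0 < mu -> eigen mu z -> l2 b ->
  blim hsm b (vec z) = mu^-1 * dot b (vec z).
Proof.
move=> mu0 ez lb; have cz := pair_cont ez.
have cwz : continuous (fun p => w p * z p) by cont.
have E : (fun i => (sk L r i)^-1 * b i * hat (fun p => w p * us (hat z) p) i) =
    (fun i => mu^-1 * (b i * vec z i)).
  apply/funext => i; rewrite (eq_coef_wt i ez).
  have : kp i * hat z i = mu * hat (fun p => w p * z p) i.
    by rewrite (pair_coef ez) -(coefZ L0 r0 mu i cwz).
  rewrite -sks /vec; have := skn i; have := lt0r_neq0 mu0.
  move: (sk L r i) (hat z i) (hat (fun p => w p * z p) i) => s t u mun sn h.
  have -> : u = mu^-1 * (s ^+ 2 * t) by rewrite h mulKf.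
  by field; rewrite sn mun.
have sb : summ (fun i => b i * vec z i) by exact: summ_sqr_mul lb (pair_l2 ez).
rewrite {1}/vec (blimE L0 r0 Lr1 lb (pair_summ ez) (pair_l2 ez)); last first.
  by rewrite E; exact: summZ.
by rewrite E ssumZ.
Qed.

Lemma eigen_summ_kap mu z : eigen mu z -> summ (fun i => kp i * hat z i).
Proof.
move=> ez; have cz := pair_cont ez.
have cwz : continuous (fun p => w p * z p) by cont.
apply: summ_eq (summZ mu (summ_coef_wt_usr L0 r0 Lr1 (pair_summ ez))) => i.
by rewrite (eq_coef_wt i ez) (pair_coef ez) -(coefZ L0 r0 mu i cwz).
Qed.

(** Eigenvectors of the Hilbert-Schmidt form are eigenfunctions.  Bessel's
    inequality for the weighted partial sums gives one extra power of decay of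
    the coefficients, which makes the sine series of the candidate absolutely
    convergent; absolute convergence is preserved by the weight, and a further
    division by the Laplace eigenvalues makes the series twice differentiable. *)
Theorem eigen_of_vec x q : l2 x -> 0 < q ->
  (forall b, l2 b -> blim hsm b x = q * dot b x) ->
  exists2 u, eigen q^-1 u & vec u = x.
Proof.
move=> lx q0 Hx; pose a i := (sk L r i)^-1 * x i.
have xE : (fun i => sk L r i * a i) = x.
  by apply/funext => i; rewrite /a mulVKf.
pose S n p := \sum_(j < n) a j * ph j p.
have cS n : continuous (S n) by exact: psum_cont.
have cwS n : continuous (fun p => w p * S n p) by have := cS n => ?; cont.
have hS n i : hat (fun p => w p * S n p) i = \sum_(j < n) a j * wmat L r i j.
  have ci := @phi_cont R L r i.
  have cwi : continuous (fun p => w p * ph i p) by cont.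
  transitivity (IM (fun p => (w p * ph i p) * S n p)).
    by apply: (eq_Imean L0 r0) => p _; ring.
  by rewrite (Imean_mul_psum L0 r0 a n cwi); apply: eq_bigr => j _; rewrite coef_wt_phi.
(* The eigenvector equation tested against the i-th unit vector. *)
have lim_row i : hat (fun p => w p * S n p) i @[n --> \oo] --> q * (kp i * a i).
  pose e j : R := (j == i)%:R.
  have le : l2 e.
    apply: (summ_nneg (M := 1)) => [j|n]; first exact: sqr_ge0.
    have [ni|ni] := leqP n i.
      rewrite big1 ?ler01// => j _; rewrite /e (_ : _ == _ = false) ?expr0n//.
      by apply/negbTE; rewrite neq_ltn (leq_trans (ltn_ord j)).
    rewrite (bigD1 (Ordinal ni))//= /e eqxx expr1n big1 ?addr0// => j ji.
    rewrite (_ : (j : nat) == i = false) ?expr0n//; apply: negbTE.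
    by apply: contraNN ji => /eqP h; apply/eqP/val_inj.
  have [M HM] := hsmat_hilbert_schmidt L0 r0 Lr1.
  have h := blim_cvg (hsmat_hilbert_schmidt L0 r0 Lr1) le lx.
  have de : dot e x = x i.
    apply: cvg_lim => //; apply: cvg_near_cst; exists i.+1 => // n /= ni.
    rewrite (bigD1 (Ordinal ni))//= /e eqxx mul1r big1 ?addr0// => j ji.
    rewrite (_ : (j : nat) == i = false) ?mul0r//; apply: negbTE.
    by apply: contraNN ji => /eqP hh; apply/eqP/val_inj.
  rewrite (Hx _ le) de in h.
  have -> : q * (kp i * a i) = sk L r i * (q * x i).
    by rewrite /a -sks; have := skn i; move: (sk L r i) (x i) => s t sn; field.
  have h2 : sk L r i * bform hsm n e x @[n --> \oo] --> sk L r i * (q * x i).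
    by apply: cvgM => //; exact: cvg_cst.
  apply: cvg_trans h2; apply: near_eq_cvg; exists i.+1 => // n /= ni.
  have -> : bform hsm n e x = \sum_(j < n) hsm i j * (e i * x j).
    rewrite /bform (bigD1 (Ordinal ni))//= [X in _ + X]big1 ?addr0// => j ji.
    rewrite big1// => k _; rewrite /e (_ : (j : nat) == i = false) ?mul0r ?mulr0//.
    by apply: negbTE; apply: contraNN ji => /eqP hh; apply/eqP/val_inj.
  rewrite hS.
  rewrite big_distrr; apply: eq_bigr => j _ /=; rewrite /e eqxx mul1r /hsmat /a.
  have := skn i; have := skn j; move: (sk L r i) (sk L r j) (x j) (wmat L r i j) => s t u v tn sn.
  by field; rewrite sn tn.
have [B B0 HB] := div_sk_bounded r L0 lx.
have [M M0 HM] := crect_bounded L r cw.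
have sb : summ (fun i => (q * (kp i * a i)) ^+ 2).
  apply: (summ_nneg (M := M ^+ 2 * B)) => [i|m]; first exact: sqr_ge0.
  have h : \sum_(i < m) hat (fun p => w p * S n p) i ^+ 2 @[n --> \oo] -->
      \sum_(i < m) (q * (kp i * a i)) ^+ 2.
    apply: (psum_cvg (F := fun i n => hat (fun p => w p * S n p) i ^+ 2)
      (l := fun i => (q * (kp i * a i)) ^+ 2)) => i.
    have h := lim_row i.
    exact: (cvgM h h).
  rewrite -(cvg_lim _ h)//; apply: limr_le; first by apply/cvg_ex; eexists; exact: h.
  apply: nearW => n; apply: le_trans (bessel L0 r0 m (cwS n)) _.
  have cS2 : continuous (fun p => S n p ^+ 2) by have := cS n => ?; cont.
  have cws2 : continuous (fun p => (w p * S n p) ^+ 2) by have := cwS n => ?; cont.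
  have cM : continuous (fun p => M ^+ 2 * S n p ^+ 2) by cont.
  apply: (@le_trans _ _ (IM (fun p => M ^+ 2 * S n p ^+ 2))).
    apply: ler_Imean => // p hp; rewrite (exprMn _ (w p)) ler_wpM2r ?sqr_ge0//.
    by rewrite -(real_normK (num_real (w p))) lerXn2r ?nnegrE// HM.
  rewrite (@ImeanZ R L r _ _ cS2) ler_wpM2l ?sqr_ge0//; apply: le_trans (HB n).
  have -> : IM (fun p => S n p ^+ 2) = IM (fun p => S n p * S n p).
    by apply: (eq_Imean L0 r0) => p _; rewrite expr2.
  rewrite (Imean_mul_psum L0 r0 a n (cS n)) le_eqVlt; apply/orP; left; apply/eqP.
  by apply: eq_bigr => i _; rewrite (coef_psum L0 r0) ltn_ord expr2.
have sa : summ a.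
  apply: summ_eq (summZ q^-1 (summ_div_kap L0 r0 sb)) => i.
  by rewrite mulrCA (mulKf (lt0r_neq0 q0)) (mulKf (kpn i)).
have cu := usr_cont sa : continuous (us a).
have cwu : continuous (fun p => w p * us a p) by cont.
have hwu i : hat (fun p => w p * us a p) i = q * (kp i * a i).
  have h := lim_row i; rewrite -(cvg_lim _ h)// coef_wt_usr//.
  by rewrite /ssum; congr (limn _); apply/funext => n; rewrite hS.
have swu := summ_coef_wt_usr L0 r0 Lr1 sa.
have ska : summ (fun i => kp i * a i).
  apply: summ_eq (summZ q^-1 swu) => i.
  by rewrite hwu (mulKf (lt0r_neq0 q0)).
have b0 : bdry0 L r (us a) by exact: usr_bdry.
have bw0 : bdry0 L r (fun p => w p * us a p) by move=> p hp np; rewrite b0// mulr0.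
have ex p : crect p -> us (fun i => kp i * a i) p = q^-1 * (w p * us a p).
  move=> hp; rewrite (sine_expansion L0 r0 cwu bw0 swu hp) /usr /tser.
  rewrite -(ssumZ _ (tser_summ L r true true p swu)); apply: (congr1 (@ssum R)).
  by apply/funext => i; rewrite hwu; have := lt0r_neq0 q0; move: (kp i) (a i) (tprod _ _ _ _ _ _) => s t v qn; field.
exists (us a); last first.
  by rewrite -[RHS]xE; apply/funext => i; rewrite /vec coef_usr.
split=> //; last first.
- by move=> p hp np; rewrite bw0// mulr0.
- by cont.
- have [z1 [z11 [z2 [z22 H]]]] := neg_laplacian_usr L0 r0 ska.
  exists z1, z11, z2, z22 => p op; have [h1 h2 h3 h4 h5] := H p op.
  by split=> //; rewrite h5 (ex p (orect_crect op)).
Qed.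

End Eigenfunctions.

(** * The first two eigenfunctions *)

Section Bottom.
Variables (R : realType) (L r : R).
Hypotheses (L0 : 0 < L) (r0 : 0 < r) (Lr1 : L ^+ 2 + r ^+ 2 < 1).
Implicit Types (z f g u : R * R -> R) (a b c x : nat -> R) (p : R * R).
Local Notation kp := (kap L r).
Local Notation ph := (phi L r).
Local Notation Om := (open_rectangle L r).
Local Notation crect := (crect L r).
Local Notation IM := (Imean L r).
Local Notation hat := (coef L r).
Local Notation w := (wt L r).
Local Notation hsm := (hsmat L r).
Local Notation poi := (poisson L r).
Local Notation eig := (eigen L r).
Local Notation vec := (vec L r).

Let cw : continuous w := wt_cont L0 r0 Lr1.

(** The inner product of the hyperbolic area, up to a constant factor. *)
Definition wdot z (y : R * R -> R) : R := IM (fun p => w p * z p * y p).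

Lemma wdotC z (y : R * R -> R) : wdot z y = wdot y z.
Proof. by apply: (eq_Imean L0 r0) => p _; exact: mulrAC. Qed.

Lemma wdotDl z (y : R * R -> R) u : continuous z -> continuous y -> continuous u ->
  wdot (fun p => z p + y p) u = wdot z u + wdot y u.
Proof.
move=> cz cy cu; have c1 : continuous (fun p => w p * z p * u p) by cont.
have c2 : continuous (fun p => w p * y p * u p) by cont.
by rewrite -(@ImeanD R L r _ _ c1 c2); apply: (eq_Imean L0 r0) => p _; rewrite (mulrDr (w p)) mulrDl.
Qed.

Lemma wdotZl z u k : continuous z -> continuous u ->
  wdot (fun p => k * z p) u = k * wdot z u.
Proof.
move=> cz cu; have c1 : continuous (fun p => w p * z p * u p) by cont.
rewrite -(@ImeanZ R L r _ k c1); apply: (eq_Imean L0 r0) => p _.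
by move: (w p) (z p) (u p) => s t v; ring.
Qed.

Lemma wdot_expand z (y : R * R -> R) s t : continuous z -> continuous y ->
  wdot (fun p => s * z p + t * y p) (fun p => s * z p + t * y p) =
  s ^+ 2 * wdot z z + 2 * (s * t) * wdot z y + t ^+ 2 * wdot y y.
Proof.
move=> cz cy; have c1 : continuous (fun p => s * z p) by cont.
have c2 : continuous (fun p => t * y p) by cont.
have c3 : continuous (fun p => s * z p + t * y p) by cont.
rewrite (wdotDl c1 c2 c3) (wdotZl s cz c3) (wdotZl t cy c3).
rewrite (wdotC z) (wdotC y) (wdotDl c1 c2 cz) (wdotDl c1 c2 cy).
rewrite (wdotZl s cz cz) (wdotZl t cy cz) (wdotZl s cz cy) (wdotZl t cy cy) (wdotC y z).
by move: (wdot z z) (wdot z y) (wdot y y) => A B C; ring.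
Qed.

Lemma wdot_ge z : continuous z -> 4 * IM (fun p => z p ^+ 2) <= wdot z z.
Proof.
move=> cz; have c1 : continuous (fun p => z p ^+ 2) by cont.
have c2 : continuous (fun p => w p * z p * z p) by cont.
have c3 : continuous (fun p => 4 * z p ^+ 2) by cont.
rewrite -(@ImeanZ R L r _ 4 c1); apply: (ler_Imean L0 r0 c3 c2) => p _.
by rewrite -mulrA -expr2 ler_wpM2r ?sqr_ge0// wt_ge4.
Qed.

Lemma wdot_ge0 z : 0 <= wdot z z.
Proof.
apply: (Imean_ge0 L0 r0) => p _.
by rewrite -mulrA -expr2 mulr_ge0 ?sqr_ge0// ltW// (wt_gt0 L0 r0 Lr1).
Qed.

Lemma wdot_gt0_coef z i : continuous z -> hat z i != 0 -> 0 < wdot z z.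
Proof.
move=> cz zi; apply: lt_le_trans (wdot_ge cz).
rewrite mulr_gt0//; apply: lt_le_trans (bessel L0 r0 i.+1 cz).
rewrite big_ord_recr /= ltr_wpDl ?sumr_ge0// => [j _|]; first exact: sqr_ge0.
by rewrite lt_def sqrf_eq0 zi sqr_ge0.
Qed.

Lemma wdot_gt0 z p : continuous z -> Om p -> z p != 0 -> 0 < wdot z z.
Proof.
move=> cz op zp; rewrite lt_def wdot_ge0 andbT; apply: contra zp => /eqP z0.
have cc : continuous (fun p => w p * z p * z p) by cont.
have w0 := wt_gt0 L0 r0 Lr1.
have h q : 0 <= w q * z q * z q by rewrite -mulrA -expr2 mulr_ge0 ?sqr_ge0// ltW.
have := Imean_eq0 L0 r0 cc (fun q _ => h q) z0 op => /=.
by move: (w p) (w0 p) (z p) => s s0 t /eqP; rewrite !mulf_eq0 (gt_eqF s0) /= orbb.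
Qed.

Lemma eigen_wdot mu u (y : R * R -> R) g : eig mu u -> poi y g ->
  dot (vec u) (vec y) = mu * wdot u y.
Proof.
move=> eu yg; have cu := pair_cont eu; have cy := pair_cont yg.
have c1 : continuous (fun p => w p * u p * y p) by cont.
rewrite (pair_dot L0 r0 eu yg) -(@ImeanZ R L r _ mu c1); apply: (eq_Imean L0 r0) => p _.
by move: (w p) (u p) (y p) => s t v; ring.
Qed.

Definition refl p : R * R := (- p.1, p.2).

Let refl_cont : continuous refl.
Proof. by apply: contpair; cont. Qed.

Lemma clipN l (y : R) : clip l (- y) = - clip l y.
Proof.
rewrite /clip -[X in X + l]opprK (_ : - - (- y) + l = - (y - l)); last by ring.
rewrite (_ : - y - l = - (y + l)); last by ring.
by rewrite !normrN -mulNr opprB.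
Qed.

Lemma wt_refl p : w (refl p) = w p.
Proof. by rewrite /wt /cliprect /refl /sqnorm /= clipN sqrrN. Qed.

Let om_refl p : Om (refl p) <-> Om p.
Proof. by rewrite !orectP /refl /=; split => -[/andP[h1 h2] h3]; split=> //; apply/andP; split; lra. Qed.

Let crect_refl p : crect p -> crect (refl p).
Proof. by move=> [/andP[h1 h2] h3]; split=> //=; apply/andP; split; lra. Qed.

Let refl_bdry z : bdry0 L r z -> bdry0 L r (fun p => z (refl p)).
Proof.
move=> z0 p hp np; apply: z0; first exact: crect_refl.
by move/om_refl.
Qed.

Let derN (h : R -> R) (t d : R) : is_derive (- t) 1 h d -> is_derive t 1 (fun s => h (- s)) (- d).
Proof.
move=> hd; have e : is_derive t 1 (fun s : R => - s) (-1 : R).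
  by have := derZ (-1) (derid t); rewrite mulr1; have -> : (fun s : R => -1 * s) = (fun s => - s) by apply/funext => s; rewrite mulN1r.
by apply: (derE (dercomp (g := fun s => - s) hd e)); rewrite mulrN1.
Qed.

Lemma poisson_refl z f : poi z f -> poi (fun p => z (refl p)) (fun p => f (refl p)).
Proof.
move=> [[z1 [z11 [z2 [z22 H]]]] cz cf z0 f0]; split.
- exists (fun p => - z1 (refl p)), (fun p => z11 (refl p)), (fun p => z2 (refl p)),
    (fun p => z22 (refl p)) => p /om_refl op.
  have [/is_derive_e1 h1 /is_derive_e1 h2 /is_derive_e2 h3 /is_derive_e2 h4 h5] := H _ op.
  split=> //.
  + by apply/is_derive_e1; exact: derN h1.
  + apply/is_derive_e1; have := derZ (-1) (derN h2); rewrite mulN1r opprK.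
    have -> : (fun s => -1 * z1 (- s, (refl p).2)) = (fun s => - z1 (refl (s, p.2))) by apply/funext => s; rewrite mulN1r.
    by [].
  + by apply/is_derive_e2.
  + by apply/is_derive_e2.
- by apply: contcomp.
- by apply: contcomp.
- exact: refl_bdry.
- exact: refl_bdry.
Qed.

Lemma eigen_refl mu u : eig mu u -> eig mu (fun p => u (refl p)).
Proof.
move=> /poisson_refl; rewrite /eigen.
by have -> : (fun p => mu * (w (refl p) * u (refl p))) = (fun p => mu * (w p * u (refl p)))
  by apply/funext => p; rewrite wt_refl.
Qed.

Lemma eigenD mu u v : eig mu u -> eig mu v -> eig mu (fun p => u p + v p).
Proof.
move=> eu ev; have := poissonD eu ev; rewrite /eigen.
have -> // : (fun p => mu * (w p * u p) + mu * (w p * v p)) = (fun p => mu * (w p * (u p + v p))).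
by apply/funext => p; move: (w p) (u p) (v p) => s t q; ring.
Qed.

Lemma eigenZ mu u k : eig mu u -> eig mu (fun p => k * u p).
Proof.
move=> eu; have := poissonZ k eu; rewrite /eigen.
have -> // : (fun p => k * (mu * (w p * u p))) = (fun p => mu * (w p * (k * u p))).
by apply/funext => p; move: (w p) (u p) => s t; ring.
Qed.

Lemma Imean_refl f : continuous f -> IM (fun p => f (refl p)) = IM f.
Proof.
move=> cf; apply: eq_mean => /= y _.
have ci : continuous (fun t : R => f (unangle L t, unangle r y)).
  by apply: (contcomp (f := fun t : R => (unangle L t, unangle r y))) => //; rewrite /unangle; cont.
rewrite -(mean_reflect ci); apply: eq_mean => t _; congr (f (_, _)) => /=.
rewrite /unangle; have := pi_gt0 R => /lt0r_neq0.
by move: (pi) => P P0; field.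
Qed.

Lemma Imean_odd f : continuous f -> (forall p, f (refl p) = - f p) -> IM f = 0.
Proof.
move=> cf fN; have := Imean_refl cf.
have -> : (fun p => f (refl p)) = (fun p => -1 * f p) by apply/funext => p; rewrite fN mulN1r.
by rewrite (@ImeanZ R L r _ (-1) cf) mulN1r; lra.
Qed.

(** An eigenvalue with an eigenfunction has one that is even or odd in the
    first variable. *)
Lemma eigen_parity mu u : eig mu u -> 0 < wdot u u ->
  exists (v : R * R -> R) (s : R), [/\ eig mu v, 0 < wdot v v, s ^+ 2 = 1 &
    forall p, v (refl p) = s * v p].
Proof.
move=> eu u0; have cu := pair_cont eu; have eu' := eigen_refl eu.
have cu' := pair_cont eu'.
pose v (s : R) p := 1 * u p + s * u (refl p).
have ev s : eig mu (v s).
  by apply: eigenD; exact: eigenZ.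
have vr s : s ^+ 2 = 1 -> forall p, v s (refl p) = s * v s p.
  move=> s1 p; rewrite /v {2}/refl /= opprK -surjective_pairing.
  by move: (u p) (u (refl p)) => a b; rewrite mulrDr (mulrA s s) -expr2 s1; ring.
suff [s s1 vs] : exists2 s : R, s ^+ 2 = 1 & 0 < wdot (v s) (v s).
  by exists (v s), s; split; [exact: ev|exact: vs|exact: s1|exact: vr].
pose u' p := u (refl p).
have vE s : wdot (v s) (v s) = _ := wdot_expand 1 s cu cu'.
have C0 : 0 <= wdot u' u' := wdot_ge0 u'.
move: vE C0; rewrite -/u'; move: (wdot u u) u0 (wdot u u') (wdot u' u') => A A0 B C vE C0.
have [B0|B0] := leP 0 B.
  exists 1; first exact: expr1n.
  by rewrite vE; clear vE; lra.
exists (-1); first by rewrite sqrrN expr1n.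
by rewrite vE; clear vE; lra.
Qed.

Lemma vec_normalize mu u : 0 < mu -> eig mu u -> 0 < wdot u u ->
  exists2 k, k != 0 & dot (vec (fun p => k * u p)) (vec (fun p => k * u p)) = 1.
Proof.
move=> mu0 eu u0; have cu := pair_cont eu; have ms : 0 < mu * wdot u u by rewrite mulr_gt0.
pose k := (Num.sqrt (mu * wdot u u))^-1; exists k.
  by rewrite invr_eq0 gt_eqF// sqrtr_gt0.
have eku := eigenZ k eu; have cku := pair_cont eku.
have kk : k ^+ 2 * (mu * wdot u u) = 1.
  by rewrite exprVn sqr_sqrtr ?ltW// mulVf// lt0r_neq0.
rewrite (eigen_wdot eku eku) (wdotZl k cu cku) wdotC (wdotZl k cu cu) -kk.
by move: (wdot u u) => t; ring.
Qed.

(** Two eigenvalues with orthogonal eigenfunctions.  The minimality is required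
    against all solutions of Poisson's equation, so that it applies to trial
    functions and not to eigenfunctions only. *)
Definition bottom (l1 l2 : R) (u1 u2 : R * R -> R) :=
  [/\ 0 < l1 <= l2, eig l1 u1 /\ eig l2 u2, 0 < wdot u1 u1 /\ 0 < wdot u2 u2,
      wdot u1 u2 = 0 &
      (forall z f, poi z f -> l1 * wdot z z <= IM (fun p => f p * z p)) /\
      (forall z f, poi z f -> wdot u1 z = 0 -> l2 * wdot z z <= IM (fun p => f p * z p))].

Lemma poisson_phi i : poi (ph i) (fun p => kp i * ph i p).
Proof.
have cp := @phi_cont R L r i.
split; [exact: neg_laplacian_phi|by []|by cont| |].
  by move=> p hp np; exact: (phi_bdry L0 r0 i hp np).
by move=> p hp np; rewrite (phi_bdry L0 r0 i hp np) mulr0.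
Qed.

(** The ground state is taken even or odd in x from the start; the second
    eigenvector is then sought in its orthogonal. *)
Theorem bottom_exists : exists (l1 l2 s : R) u1 u2,
  [/\ bottom l1 l2 u1 u2, s ^+ 2 = 1 & forall p, u1 (refl p) = s * u1 p].
Proof.
have HS := hsmat_hilbert_schmidt L0 r0 Lr1.
have sym := @hsmat_sym R L r L0 r0.
have p0 := poisson_phi 0; have p1 := poisson_phi 1.
have c0 := pair_cont p0; have c1 := pair_cont p1.
have hatphi i j : hat (ph i) j = (i == j)%:R by exact: Imean_phi.
have Q0 : 0 < blim hsm (vec (ph 0)) (vec (ph 0)).
  rewrite (pair_blim L0 r0 Lr1 p0 p0); apply: (wdot_gt0_coef (i := 0) c0).
  by rewrite hatphi oner_neq0.
have [x [q [q0 lx xx Hx Mx]]] := hs_top_eigenvector HS sym (pair_l2 L0 r0 p0) Q0.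
have [u eu vu] := eigen_of_vec L0 r0 Lr1 lx q0 Hx.
have qi0 : 0 < q^-1 by rewrite invr_gt0.
have u0 : 0 < wdot u u.
  have : 0 < q^-1 * wdot u u by rewrite -(eigen_wdot eu eu) vu xx.
  by rewrite pmulr_rgt0.
have [v [s [ev v0 s1 vr]]] := eigen_parity eu u0.
have [k k0 nk] := vec_normalize qi0 ev v0.
pose u1 p := k * v p.
have e1 : eig q^-1 u1 := eigenZ k ev.
have cu1 := pair_cont e1; have lu1 := pair_l2 L0 r0 e1.
have n1 : 0 < wdot u1 u1.
  have : 0 < q^-1 * wdot u1 u1 by rewrite -(eigen_wdot e1 e1) nk.
  by rewrite pmulr_rgt0.
have var1 z f : poi z f -> q^-1 * wdot z z <= IM (fun p => f p * z p).
  move=> zf; rewrite mulrC ler_pdivrMr// [leRHS]mulrC.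
  rewrite -(pair_dot L0 r0 zf zf); have := Mx _ (pair_l2 L0 r0 zf).
  by rewrite (pair_blim L0 r0 Lr1 zf zf).
pose d i := dot (vec (ph i)) (vec u1).
have [t [g [tg t0 td]]] : exists t g, [/\ poi t g, 0 < wdot t t & dot (vec t) (vec u1) = 0].
  have [d0|d0] := eqVneq (d 0%N) 0.
    exists (ph 0), (fun p => kp 0 * ph 0 p); split; [exact: p0| |exact: d0].
    by apply: (wdot_gt0_coef (i := 0) c0); rewrite hatphi oner_neq0.
  have pt := poissonD (poissonZ (- d 1%N) p0) (poissonZ (d 0%N) p1).
  eexists; eexists; split; first exact: pt.
    have ct := pair_cont pt; apply: (wdot_gt0_coef (i := 1) ct).
    have cA : continuous (fun p => - d 1%N * ph 0 p) by cont.
    have cB : continuous (fun p => d 0%N * ph 1 p) by cont.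
    rewrite (coefD L0 r0 1 cA cB) (coefZ L0 r0 (- d 1%N) 1 c0) (coefZ L0 r0 (d 0%N) 1 c1).
    by rewrite !hatphi /= mulr0 add0r mulr1.
  rewrite dotC (eigen_wdot e1 pt) wdotC wdotDl//; [|by cont..].
  rewrite (wdotZl _ c0 cu1) (wdotZl _ c1 cu1).
  have dE i pi : poi (ph i) pi -> d i = q^-1 * wdot (ph i) u1.
    by move=> h; rewrite /d dotC (eigen_wdot e1 h) wdotC.
  rewrite (dE _ _ p0) (dE _ _ p1).
  by move: (wdot _ _) (wdot _ _) q^-1 => A B C; ring.
have Hu1 a : l2 a -> blim hsm a (vec u1) = q * dot a (vec u1).
  by move=> la; rewrite (eigen_blim L0 r0 Lr1 qi0 e1 la) invrK.
have Qt : 0 < blim hsm (vec t) (vec t) by rewrite (pair_blim L0 r0 Lr1 tg tg).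
have [y [q2 [q20 ly [yy yx] Hy My]]] :=
  hs_second_eigenvector HS sym lu1 nk Hu1 (pair_l2 L0 r0 tg) td Qt.
have [u2 e2 vu2] := eigen_of_vec L0 r0 Lr1 ly q20 Hy.
have qi20 : 0 < q2^-1 by rewrite invr_gt0.
have n2 : 0 < wdot u2 u2.
  have : 0 < q2^-1 * wdot u2 u2 by rewrite -(eigen_wdot e2 e2) vu2 yy.
  by rewrite pmulr_rgt0.
exists q^-1, q2^-1, s, u1, u2; split; [|exact: s1|]; last first.
  by move=> p; rewrite /u1 vr mulrCA.
have orth : wdot u1 u2 = 0.
  have : q2^-1 * wdot u2 u1 = 0 by rewrite -(eigen_wdot e2 e1) vu2 yx.
  by move/eqP; rewrite mulf_eq0 gt_eqF//= wdotC => /eqP.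
split; [|by split|by split|exact: orth|split; first exact: var1].
  rewrite qi0 /= -(ler_pM2r n2); apply: le_trans (var1 _ _ e2) _.
  by rewrite -(pair_dot L0 r0 e2 e2) (eigen_wdot e2 e2).
move=> z f zf uz; rewrite mulrC ler_pdivrMr// [leRHS]mulrC.
have vz : dot (vec z) (vec u1) = 0 by rewrite dotC (eigen_wdot e1 zf) uz mulr0.
rewrite -(pair_dot L0 r0 zf zf); have := My _ (pair_l2 L0 r0 zf) vz.
by rewrite (pair_blim L0 r0 Lr1 zf zf).
Qed.

End Bottom.

(** * Dirichlet eigenfunctions of the hyperbolic Laplacian *)

Section HyperbolicLaplacian.
Variable R : realType.
Implicit Types (u : R * R -> R) (p q : R * R).
Local Notation e1 := (@e1 R).
Local Notation e2 := (@e2 R).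

(** In dimension two the Laplacian is conformally covariant: the square root of
    the determinant of a conformal metric cancels the inverse metric. *)
Lemma conformal_flux u p (i : 'I_2) : unit_disk p ->
  Num.sqrt (\det (poincare_metric p)) *
    (\sum_(j < 2) invmx (poincare_metric p) i j * 'D_(coord_dir R j) u p) =
  'D_(coord_dir R i) u p.
Proof.
move=> dp; have a0 : 0 < 4 / (1 - sqnorm p) ^+ 2.
  by rewrite divr_gt0// exprn_gt0// subr_gt0.
rewrite /poincare_metric; move: (4 / _) a0 => a a0.
rewrite det_scalar sqrtr_sqr gtr0_norm// invmx_scalar (bigD1 i)//= mxE eqxx mulr1n.
rewrite big1 => [|j ji]; last by rewrite mxE eq_sym (negbTE ji) mulr0n mul0r.
by rewrite addr0 mulrA mulfV ?mul1r// gt_eqF.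
Qed.

Lemma unit_disk_open : open (@unit_disk R).
Proof.
have -> : @unit_disk R = (@sqnorm R) @^-1` [set t | t < 1] by [].
apply: open_comp => [p _|]; first exact: sqnorm_cont.
exact: open_lt.
Qed.

Lemma hyperbolic_laplacianE u p : unit_disk p -> hyperbolic_laplacian u p =
  ((1 - sqnorm p) ^+ 2 / 4) * ('D_e1 ('D_e1 u) p + 'D_e2 ('D_e2 u) p).
Proof.
move=> dp; rewrite /hyperbolic_laplacian /laplace_beltrami.
have nd : \forall q \near p, unit_disk q.
  exact: (open_nbhs_nbhs (conj unit_disk_open dp)).
have E (i : 'I_2) : 'D_(coord_dir R i) (fun q => Num.sqrt (\det (poincare_metric q)) *
    (\sum_(j < 2) invmx (poincare_metric q) i j * 'D_(coord_dir R j) u q)) p =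
    'D_(coord_dir R i) ('D_(coord_dir R i) u) p.
  by apply: near_eq_derive; apply: filterS nd => q dq; exact: conformal_flux.
rewrite big_ord_recl big_ord1 !E coord_dir0 coord_dir1//; congr (_ * _).
have s0 : 0 < 1 - sqnorm p by rewrite subr_gt0.
rewrite /poincare_metric det_scalar sqrtr_sqr gtr0_norm ?divr_gt0 ?exprn_gt0//.
by rewrite invf_div.
Qed.

End HyperbolicLaplacian.

Section Rectangle.
Variables (R : realType) (L r : R).
Hypotheses (L0 : 0 < L) (r0 : 0 < r).
Implicit Types (z f u : R * R -> R) (p q : R * R).
Local Notation Om := (open_rectangle L r).
Local Notation crect := (crect L r).
Local Notation e1 := (@e1 R).
Local Notation e2 := (@e2 R).

Lemma orect_open : open Om.
Proof.
have -> : Om = (fst @^-1` `]- L, L[) `&` (snd @^-1` `]- r, r[) by [].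
by apply: openI; apply: open_comp => [p _|]; [exact: contfst|exact: interval_open|exact: contsnd|exact: interval_open].
Qed.

Lemma orect_near p : Om p -> \forall q \near p, Om q.
Proof. by move=> op; exact: (open_nbhs_nbhs (conj orect_open op)). Qed.

Lemma orect_center : Om (0, 0).
Proof. by apply/orectP; rewrite /= !oppr_lt0 L0 r0. Qed.

Lemma crect_closed : closed crect.
Proof. by apply: compact_closed; [exact: norm_hausdorff|exact: crect_compact]. Qed.

Lemma closure_orect : closure Om = crect.
Proof.
apply/seteqP; split=> [p|p cp].
  move=> h; apply: crect_closed; move: p h; apply: closure_subset => q; exact: orect_crect.
move=> B Bp; pose g (t : R) : R * R := (t * p.1, t * p.2).
have cg : continuous g by apply: contpair; cont.
have g1 : g 1 = p by rewrite /g !mul1r -surjective_pairing.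
have nB : \forall t \near (1 : R), B (g t) by apply: (cg 1); rewrite g1.
have nB' : \forall t \near (1 : R)^'-, B (g t) by exact: cvg_within.
have nlt : \forall t \near (1 : R)^'-, t < 1 by exact: nbhs_left_lt.
have ngt (a : R) (a1 : a < 1) : \forall t \near (1 : R)^'-, a < t by exact: nbhs_left_gt.
have nall : \forall t \near (1 : R)^'-, [/\ B (g t), t < 1 & 0 < t].
  by near=> t; split; near: t => //; exact: ngt.
have [t [Bt t1 t0]] := @filter_ex _ _ (at_left_proper_filter (1 : R)) _ nall.
exists (g t); split; last exact: Bt.
apply/(orectP L r (g t)); rewrite /g /=.
have sc (l y : R) : 0 < l -> - l <= y <= l -> - l < t * y < l.
  move=> l0 /andP[y1 y2]; have h1 : t * y <= t * l by rewrite ler_pM2l.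
  have h2 : t * - l <= t * y by rewrite ler_pM2l.
  have h3 : t * l < l by rewrite gtr_pMl.
  by apply/andP; split; move: h1 h2; rewrite mulrN; lra.
by case: cp => c1 c2; split; exact: sc.
Unshelve. all: by end_near. Qed.

(** An eigenfunction is constrained on the closed rectangle only; clipping the
    argument yields a representative continuous on the plane. *)
Lemma within_crect u : {within crect, continuous u} -> continuous (fun p => u (cliprect L r p)).
Proof.
move=> /subspace_continuousP cu p.
have cp := cliprect_crect L0 r0 p.
apply: (cvg_trans _ (cu _ cp)) => B /= hB.
rewrite /within /= in hB.
have H : \forall q \near p, crect (cliprect L r q) -> B (u (cliprect L r q)).
  exact: (@cliprect_cont R L r p _ hB).
change (\forall q \near p, B (u (cliprect L r q))).
by apply: filterS H => q h; apply: h; exact: cliprect_crect.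
Qed.

Lemma neg_laplacian_eq z z' f : {in Om, z =1 z'} -> neg_laplacian L r z f -> neg_laplacian L r z' f.
Proof.
move=> zz [z1 [z11 [z2 [z22 H]]]]; exists z1, z11, z2, z22 => p op.
have [h1 h2 h3 h4 h5] := H p op.
have nz : \forall q \near p, z q = z' q.
  by apply: filterS (orect_near op) => q /mem_set; exact: zz.
by split=> //; exact: near_eq_is_derive nz _.
Qed.

Lemma neg_laplacian_derive z f p : neg_laplacian L r z f -> Om p ->
  'D_e1 ('D_e1 z) p + 'D_e2 ('D_e2 z) p = - f p.
Proof.
move=> [z1 [z11 [z2 [z22 H]]]] op.
have [h1 [_ d2] h3 [_ d4] <-] := H p op; rewrite -d2 -d4.
by congr (_ + _); apply: near_eq_derive; apply: filterS (orect_near op) => q /H[[_ a] _ [_ b] _ _]; rewrite ?a ?b.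
Qed.

Lemma neg_laplacian_of_C2 u : class_C 2 Om u ->
  neg_laplacian L r u (fun p => - ('D_e1 ('D_e1 u) p + 'D_e2 ('D_e2 u) p)).
Proof.
move=> [_ Cu]; have [d1 [_ c1]] := Cu ord0; have [d2 [_ c2]] := Cu ord_max.
have [d11 _] := c1 ord0; have [d22 _] := c2 ord_max.
rewrite coord_dir0 in d1 d11; rewrite coord_dir1// in d2 d22.
exists ('D_e1 u), ('D_e1 ('D_e1 u)), ('D_e2 u), ('D_e2 ('D_e2 u)) => p op.
by split; [exact/derivableP/d1|exact/derivableP/d11|exact/derivableP/d2|exact/derivableP/d22|rewrite opprK].
Qed.

End Rectangle.

Section Dirichlet.
Variables (R : realType) (L r : R).
Hypotheses (L0 : 0 < L) (r0 : 0 < r) (Lr1 : L ^+ 2 + r ^+ 2 < 1).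
Implicit Types (z f u : R * R -> R) (p q : R * R).
Local Notation Om := (open_rectangle L r).
Local Notation crect := (crect L r).
Local Notation w := (wt L r).

Let cw : continuous w := wt_cont L0 r0 Lr1.

Lemma crect_disk p : crect p -> unit_disk p.
Proof. by move=> hp; have := one_sub_sqnorm_gt0 L0 r0 Lr1 p; rewrite cliprectE// subr_gt0. Qed.

Lemma wtE p : crect p -> w p = 4 / (1 - sqnorm p) ^+ 2.
Proof. by move=> hp; rewrite /wt cliprectE. Qed.

Lemma wt_inv p : crect p -> (1 - sqnorm p) ^+ 2 / 4 = (w p)^-1.
Proof. by move=> hp; rewrite wtE// invf_div. Qed.

Lemma eigen_of_dirichlet mu u : dirichlet_eigenfunction Om mu u ->
  exists z, [/\ eigen L r mu z, 0 < wdot L r z z & {in Om, z =1 u}].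
Proof.
move=> [C2 cu bu eu [p0 op0 up0]]; rewrite (closure_orect L0 r0) in cu bu.
pose z p := u (cliprect L r p).
have zu : {in Om, z =1 u}.
  by move=> p /set_mem op; rewrite /z cliprectE//; exact: orect_crect.
have cz : continuous z by exact: within_crect.
have z0 : bdry0 L r z by move=> p hp np; rewrite /z cliprectE//; exact: bu.
exists z; split=> //; last first.
  by apply: (wdot_gt0 L0 r0 Lr1 cz op0); rewrite zu// inE.
split=> //; [|by cont|by move=> p hp np; rewrite z0// !mulr0].
have := neg_laplacian_of_C2 C2.
have uz : {in Om, u =1 z} by move=> p op; rewrite zu.
move=> /(neg_laplacian_eq uz) [z1 [z11 [z2 [z22 H]]]].
exists z1, z11, z2, z22 => p op; have [h1 h2 h3 h4 h5] := H p op.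
have cp := orect_crect op.
split=> //; rewrite h5 opprK zu ?inE//.
have := eu p op; rewrite (hyperbolic_laplacianE _ (crect_disk cp)) wt_inv//.
have := lt0r_neq0 (wt_gt0 L0 r0 Lr1 p); move: (w p) (_ + _) (u p) => a d v a0 h.
have -> : d = a * (a^-1 * d) by rewrite mulVKf.
by rewrite -[a^-1 * d]opprK h; ring.
Qed.

(** The sine series of z is a representative of class C^2 on the whole plane. *)
Lemma dirichlet_of_eigen mu z : eigen L r mu z -> 0 < wdot L r z z ->
  exists2 u, dirichlet_eigenfunction Om mu u & {in crect, u =1 z}.
Proof.
move=> ez z0; have sk := eigen_summ_kap L0 r0 Lr1 ez.
have nl := neg_laplacian_usr L0 r0 sk.
have zx := pair_expansion L0 r0 ez.
have cz := pair_cont ez.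
have sz := pair_summ L0 r0 ez.
have uz : {in crect, usr L r (coef L r z) =1 z} by move=> p /set_mem /zx ->.
exists (usr L r (coef L r z)) => //; split.
- exact: class_C2_usr.
- exact: continuous_subspaceT (usr_cont sz).
- by move=> p []; rewrite closure_orect// => cp np; exact: usr_bdry.
- move=> p op; have cp := orect_crect op.
  have [nz _ _ _ _] := ez.
  have nu : neg_laplacian L r (usr L r (coef L r z)) (fun p => mu * (w p * z p)).
    by apply: neg_laplacian_eq nz => q /set_mem /orect_crect /zx.
  rewrite (hyperbolic_laplacianE _ (crect_disk cp)) wt_inv// (neg_laplacian_derive nu op).
  rewrite uz ?inE//; have := lt0r_neq0 (wt_gt0 L0 r0 Lr1 p); move: (w p) (z p) => a v a0.
  by field.
- apply: contrapT => /forall2NP H.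
  have : wdot L r z z = 0.
    rewrite /wdot (eq_Imean L0 r0 (g := fun=> 0)) ?Imean_cst ?mulr0// => p hp.
    have -> : z p = 0; last by rewrite mulr0.
    rewrite zx//; have [//|/negP/negPn/eqP //] := H p.
    by move=> np; exact: usr_bdry.
  by move/eqP; rewrite gt_eqF.
Qed.

End Dirichlet.

(** * The fundamental gap *)

Section FundamentalGap.
Variables (R : realType) (L r : R).
Hypotheses (L0 : 0 < L) (r0 : 0 < r) (Lr1 : L ^+ 2 + r ^+ 2 < 1).
Implicit Types (z f u v : R * R -> R) (p q : R * R).
Local Notation Om := (open_rectangle L r).
Local Notation crect := (crect L r).
Local Notation w := (wt L r).
Local Notation IM := (Imean L r).
Local Notation W := (wdot L r).
Local Notation eig := (eigen L r).

Let cw : continuous w := wt_cont L0 r0 Lr1.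

Lemma wdot_vanish z u : (forall p, Om p -> z p = 0) -> bdry0 L r z -> W z u = 0.
Proof.
move=> z1 z0; rewrite /wdot (eq_Imean L0 r0 (g := fun=> 0)) ?Imean_cst ?mulr0// => p hp.
have -> : z p = 0; last by rewrite mulr0 mul0r.
by have [/z1|/z0->] := pselect (Om p).
Qed.

Lemma eigen_Imean mu z u : eig mu z -> continuous u ->
  IM (fun p => mu * (w p * z p) * u p) = mu * W z u.
Proof.
move=> ez cu; have cz := pair_cont ez.
have cc : continuous (fun p => w p * z p * u p) by cont.
rewrite -(@ImeanZ R L r _ mu cc); apply: (eq_Imean L0 r0) => p _.
exact/esym/mulrA.
Qed.

Lemma eigen_orth mu1 mu2 z1 z2 : eig mu1 z1 -> eig mu2 z2 -> mu1 * W z1 z2 = mu2 * W z1 z2.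
Proof.
move=> e1 e2; rewrite -(eigen_wdot L0 r0 Lr1 e1 e2) dotC.
by rewrite (eigen_wdot L0 r0 Lr1 e2 e1) (wdotC L0 r0).
Qed.

(** On the span of two eigenfunctions the Rayleigh quotient is at most the
    larger eigenvalue: the cross term vanishes if the eigenvalues differ, and
    fits if they agree. *)
Lemma rayleigh_two mu1 mu2 z1 z2 t a b : eig mu1 z1 -> eig mu2 z2 -> mu1 <= t -> mu2 <= t ->
  IM (fun p => (a * (mu1 * (w p * z1 p)) + b * (mu2 * (w p * z2 p))) * (a * z1 p + b * z2 p))
  <= t * W (fun p => a * z1 p + b * z2 p) (fun p => a * z1 p + b * z2 p).
Proof.
move=> e1 e2 t1 t2; have c1 := pair_cont e1; have c2 := pair_cont e2.
have o := eigen_orth e1 e2.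
have cz : continuous (fun p => a * z1 p + b * z2 p) by cont.
have f1 : continuous (fun p => mu1 * (w p * z1 p) * (a * z1 p + b * z2 p)) by cont.
have f2 : continuous (fun p => mu2 * (w p * z2 p) * (a * z1 p + b * z2 p)) by cont.
have F1 : continuous (fun p => a * (mu1 * (w p * z1 p) * (a * z1 p + b * z2 p))) by cont.
have F2 : continuous (fun p => b * (mu2 * (w p * z2 p) * (a * z1 p + b * z2 p))) by cont.
have -> : IM (fun p => (a * (mu1 * (w p * z1 p)) + b * (mu2 * (w p * z2 p))) * (a * z1 p + b * z2 p)) =
  a * (mu1 * W z1 (fun p => a * z1 p + b * z2 p)) + b * (mu2 * W z2 (fun p => a * z1 p + b * z2 p)).
  rewrite -(eigen_Imean e1 cz) -(eigen_Imean e2 cz).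
  rewrite -(@ImeanZ R L r _ a f1) -(@ImeanZ R L r _ b f2) -(@ImeanD R L r _ _ F1 F2).
  apply: (eq_Imean L0 r0) => p _.
  by move: (w p) (z1 p) (z2 p) => s x y; ring.
have ca : continuous (fun p => a * z1 p) by cont.
have cb : continuous (fun p => b * z2 p) by cont.
rewrite (wdot_expand L0 r0 Lr1 a b c1 c2) (wdotC L0 r0 z1 (fun p => _ + _)) (wdotC L0 r0 z2 (fun p => _ + _)).
rewrite (wdotDl L0 r0 Lr1 ca cb c1) (wdotDl L0 r0 Lr1 ca cb c2).
rewrite !(wdotZl L0 r0 Lr1 _ c1 c1) !(wdotZl L0 r0 Lr1 _ c2 c1) !(wdotZl L0 r0 Lr1 _ c1 c2) !(wdotZl L0 r0 Lr1 _ c2 c2).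
rewrite (wdotC L0 r0 z2 z1).
have W1 := wdot_ge0 L0 r0 Lr1 z1; have W2 := wdot_ge0 L0 r0 Lr1 z2.
have Wz := wdot_ge0 L0 r0 Lr1 (fun p => a * z1 p + b * z2 p).
rewrite (wdot_expand L0 r0 Lr1 a b c1 c2) in Wz.
move: o W1 W2 Wz; move: (W z1 z1) (W z1 z2) (W z2 z2) => A B C o A0 C0 Wz.
have [mm|mm] := eqVneq mu1 mu2.
  subst mu2; rewrite -subr_ge0; have h : 0 <= t - mu1 by rewrite subr_ge0.
  have := mulr_ge0 h Wz.
  by set X := (X in 0 <= X -> _); set Y := (Y in _ -> 0 <= Y); rewrite (_ : Y = X)// /X /Y; ring.
have B0 : B = 0.
  apply/eqP; move/eqP: o; rewrite -subr_eq0 -mulrBl mulf_eq0 subr_eq0.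
  by rewrite (negbTE mm).
rewrite B0 -subr_ge0.
have h1 : 0 <= (t - mu1) * (a ^+ 2 * A) by rewrite mulr_ge0 ?subr_ge0// mulr_ge0 ?sqr_ge0.
have h2 : 0 <= (t - mu2) * (b ^+ 2 * C) by rewrite mulr_ge0 ?subr_ge0// mulr_ge0 ?sqr_ge0.
have := addr_ge0 h1 h2.
by set X := (X in 0 <= X -> _); set Y := (Y in _ -> 0 <= Y); rewrite (_ : Y = X)// /X /Y; ring.
Qed.

(** The variational characterisation against all solutions of Poisson's
    equation identifies the first two Dirichlet eigenvalues with
    multiplicity: two independent eigenfunctions have a combination
    orthogonal to the ground state. *)
Theorem gap_of_bottom l1 l2 u1 u2 : bottom L r l1 l2 u1 u2 ->
  is_fundamental_gap Om (l2 - l1).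
Proof.
move=> [/andP[l10 l12] [e1 e2] [n1 n2] o [var1 var2]].
have [v1 d1 v1E] := dirichlet_of_eigen L0 r0 Lr1 e1 n1.
have [v2 d2 v2E] := dirichlet_of_eigen L0 r0 Lr1 e2 n2.
have c1 := pair_cont e1; have c2 := pair_cont e2.
have low mu v : dirichlet_eigenfunction Om mu v -> l1 <= mu.
  move=> /(eigen_of_dirichlet L0 r0 Lr1) [z [ez z0 _]].
  by rewrite -(ler_pM2r z0) -(eigen_Imean ez (pair_cont ez)); exact: var1 _ _ ez.
exists l1, l2; split=> //; split.
- exists (fun=> v1), (fun=> l1); split=> [c hc i|i]; last by split.
  have [_ _ _ _ [p op vp]] := d1.
  have := hc p op; rewrite big_ord1 => /eqP; rewrite mulf_eq0 (negbTE vp) orbF.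
  by rewrite (ord1 i) => /eqP.
- move=> t [v [mu [_ H]]]; have [dv mt] := H ord0.
  by apply: le_trans mt; exact: low dv.
- exists (fun i => if i == ord0 then v1 else v2), (fun i => if i == ord0 then l1 else l2).
  split=> [c hc|i]; last by case: eqP.
  have b1 : bdry0 L r u1 by case: e1.
  have b2 : bdry0 L r u2 by case: e2.
  pose z p := c ord0 * u1 p + c ord_max * u2 p.
  have zO p : Om p -> z p = 0.
    move=> op; rewrite -(hc p op) big_ord_recl big_ord1 /z /=.
    have cp := mem_set (orect_crect op); rewrite v1E// v2E//.
    by congr (_ + c _ * _); apply: val_inj.
  have zb : bdry0 L r z by move=> p cp np; rewrite /z b1// b2// !mulr0 addr0.
  have k1 : continuous (fun p => c ord0 * u1 p) by cont.
  have k2 : continuous (fun p => c ord_max * u2 p) by cont.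
  have h1 : c ord0 = 0.
    have := wdot_vanish u1 zO zb; rewrite (wdotDl L0 r0 Lr1 k1 k2 c1).
    rewrite (wdotZl L0 r0 Lr1 _ c1 c1) (wdotZl L0 r0 Lr1 _ c2 c1) (wdotC L0 r0 u2) o mulr0 addr0.
    by move/eqP; rewrite mulf_eq0 (gt_eqF n1) orbF => /eqP.
  have h2 : c ord_max = 0.
    have := wdot_vanish u2 zO zb; rewrite (wdotDl L0 r0 Lr1 k1 k2 c2).
    rewrite (wdotZl L0 r0 Lr1 _ c1 c2) (wdotZl L0 r0 Lr1 _ c2 c2) o mulr0 add0r.
    by move/eqP; rewrite mulf_eq0 (gt_eqF n2) orbF => /eqP.
  move=> i; have [->//|i0] := eqVneq i ord0.
  rewrite (_ : i = ord_max)//; apply: val_inj; case: i i0 => -[//|[|//]] hi //=.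
- move=> t [v [mu [ind H]]].
  have [dv1 t1] := H ord0; have [dv2 t2] := H ord_max.
  have [z1 [ez1 z10 z1v]] := eigen_of_dirichlet L0 r0 Lr1 dv1.
  have [z2 [ez2 z20 z2v]] := eigen_of_dirichlet L0 r0 Lr1 dv2.
  have cz1 := pair_cont ez1; have cz2 := pair_cont ez2.
  have [a [b [ab0 oab]]] : exists a b, (a != 0) || (b != 0) /\
      W u1 (fun p => a * z1 p + b * z2 p) = 0.
    have E a b : W u1 (fun p => a * z1 p + b * z2 p) = a * W u1 z1 + b * W u1 z2.
      have k1 : continuous (fun p => a * z1 p) by cont.
      have k2 : continuous (fun p => b * z2 p) by cont.
      rewrite !(wdotC L0 r0 u1) (wdotDl L0 r0 Lr1 k1 k2 c1).
      by rewrite (wdotZl L0 r0 Lr1 _ cz1 c1) (wdotZl L0 r0 Lr1 _ cz2 c1).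
    have [h|h] := eqVneq (W u1 z1) 0.
      by exists 1, 0; rewrite oner_neq0 E h; split=> //; ring.
    exists (W u1 z2), (- W u1 z1); split; first by apply/orP; right; rewrite oppr_eq0; exact: h.
    apply: (etrans (E _ _)); by move: (W u1 z1) (W u1 z2) => A B; ring.
  have pz := poissonD (poissonZ a ez1) (poissonZ b ez2).
  have zpos : 0 < W (fun p => a * z1 p + b * z2 p) (fun p => a * z1 p + b * z2 p).
    apply: contrapT => /negP; rewrite -leNgt => Wle.
    have cz := pair_cont pz.
    have zO p : Om p -> a * z1 p + b * z2 p = 0.
      move=> op; apply/eqP; apply: contraT => nz.
      by have := wdot_gt0 L0 r0 Lr1 cz op nz; rewrite ltNge Wle.
    have := ind (fun i => if i == ord0 then a else b).
    have hc p : Om p -> \sum_(i < 2) (if i == ord0 then a else b) * v i p = 0.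
      move=> op; rewrite big_ord_recl big_ord1 /= -[RHS](zO p op).
      rewrite z1v ?inE// z2v ?inE//; congr (_ + _ * v _ _); exact: val_inj.
    move=> /(_ hc) Hc; have := Hc ord0; have := Hc ord_max => /= b0 a0.
    by move: ab0; rewrite a0 b0 eqxx.
  rewrite -(ler_pM2r zpos); apply: le_trans (var2 _ _ pz oab) _.
  exact: rayleigh_two.
Qed.

End FundamentalGap.

(** * Concentration at the ends of the long axis *)

Section Axis.
Variables (R : realType) (L : R).
Hypothesis L0 : 0 < L.
Implicit Types (x t : R) (k p : nat).
Local Notation pi := (@trigo.pi R).
Local Notation a := (ax L).

(** The angular variable, which runs from 0 to pi along the axis. *)
Definition th x : R := a * (x + L).
(** Vanishes at the two ends of the axis only, where the density is largest. *)
Definition dep x : R := L ^+ 2 - x ^+ 2.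

Lemma th_cont : continuous th. Proof. by rewrite /th; cont. Qed.
Lemma dep_cont : continuous dep. Proof. by rewrite /dep; cont. Qed.

Lemma dep_ge0 x : - L <= x <= L -> 0 <= dep x.
Proof. by move=> /andP[h1 h2]; rewrite /dep subr_sqr mulr_ge0; lra. Qed.

Lemma th_unangle t : th (unangle L t) = t.
Proof. by rewrite /th /ax angleE// gt_eqF. Qed.

Lemma th_itv x : - L <= x <= L -> 0 <= th x <= pi.
Proof.
move=> /andP[h1 h2]; have a0 := ax_gt0 L0.
have -> : pi = a * (L + L).
  by rewrite /ax; move: (pi) => P; field; rewrite gt_eqF.
have s0 : 0 <= x + L by lra.
apply/andP; split; first by rewrite mulr_ge0// ltW.
by rewrite ler_wpM2l ?(ltW a0)//; lra.
Qed.

Lemma one_add_cos_ge0 t : 0 <= 1 + cos t.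
Proof. by have := cos_geN1 t; lra. Qed.

Let itv_compact : compact (fun x : R => - L <= x <= L).
Proof.
have -> : (fun x : R => is_true (- L <= x <= L)) = `[- L, L]%classic.
  by apply/funext => x; rewrite /= in_itv.
exact: segment_compact.
Qed.

(** On the axis 1 + cos vanishes at the right end only, where the depth is zero. *)
Lemma dep_le e : 0 < e -> exists2 A, 0 <= A &
  forall x, - L <= x <= L -> dep x <= e + A * (1 + cos (th x)).
Proof.
move=> e0; have c1 := th_cont.
have cg : continuous (fun x => 1 + cos (th x)) by cont.
apply: (compact_domination itv_compact dep_cont cg _ _ e0) => [x _|x hx h].
  exact: one_add_cos_ge0.
have : th x = pi.
  apply: (@cos_inj R); rewrite ?in_itv /= ?th_itv// ?pi_ge0 ?lexx//.
  by rewrite cospi; lra.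
have := pi_gt0 R; rewrite /dep /th /ax; move: (pi) => P P0 hP.
have : x = L.
  have : P * (x + L) = P * (2 * L).
    have L2 : 2 * L != 0 by rewrite mulf_neq0 ?gt_eqF.
    by apply: (mulIf (invr_neq0 L2)); rewrite mulfK// -[RHS]hP mulrAC.
  by move/(mulfI (lt0r_neq0 P0)); lra.
by move=> ->; rewrite subrr.
Qed.

(** The depth vanishes at the two ends only, where the sine is zero. *)
Lemma sin_sqr_le e : 0 < e -> exists2 A, 0 <= A &
  forall x, - L <= x <= L -> a ^+ 2 * sin (th x) ^+ 2 <= e + A * dep x.
Proof.
move=> e0; have c1 := th_cont.
have cf : continuous (fun x => a ^+ 2 * sin (th x) ^+ 2) by cont.
apply: (compact_domination itv_compact cf dep_cont _ _ e0) => [x|x hx /eqP].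
  exact: dep_ge0.
rewrite /dep subr_eq0 eq_sym eqf_sqr => /orP[/eqP ->|/eqP ->].
  have -> : th L = pi by rewrite /th /ax; move: (pi) => P; field; rewrite gt_eqF.
  by rewrite sinpi expr0n mulr0.
by rewrite /th addNr mulr0 sin0 expr0n mulr0.
Qed.

(** For large k the mass sits near the right end of the axis; the factor sine
    gives the boundary values and keeps the second derivative zero at the ends. *)
Definition trial k t : R := sin t * (1 - cos t) ^+ k.+1.
Definition trial1 k t : R := (1 - cos t) ^+ k.+1 * (k.+1%:R + k.+2%:R * cos t).
Definition trial2 k t : R :=
  sin t * (1 - cos t) ^+ k * (k.+1%:R * (k.+1%:R + k.+2%:R * cos t) - k.+2%:R * (1 - cos t)).

Lemma trial_cont k : continuous (trial k).
Proof. by rewrite /trial; cont. Qed.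
Lemma trial2_cont k : continuous (trial2 k).
Proof. by rewrite /trial2; cont. Qed.

Let sin_sqr t : sin t ^+ 2 = (1 - cos t) * (1 + cos t).
Proof.
by have := cos2Dsin2 t; move: (sin t) (cos t) => s c h; rewrite -subr_sqr expr1n -h addrC addKr.
Qed.

Let der1c t : is_derive t 1 (fun t => 1 - cos t) (sin t).
Proof. by apply: (derE (derB (dercst 1 t 1) (dercos t))); rewrite sub0r opprK. Qed.

Lemma trial_derive k t : is_derive t 1 (trial k) (trial1 k t).
Proof.
apply: (derE (derM (dersin t) (derpow k.+1 (der1c t)))).
rewrite /= (_ : sin t * (k.+1%:R * (1 - cos t) ^+ k * sin t) =
  k.+1%:R * (1 - cos t) ^+ k * sin t ^+ 2); last by ring.
rewrite sin_sqr /trial1 exprS -natr1 -[k.+2%:R]natr1 -[k.+1%:R]natr1.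
by move: ((1 - cos t) ^+ k) (cos t) (k%:R) => X c n; ring.
Qed.

Lemma trial1_derive k t : is_derive t 1 (trial1 k) (trial2 k t).
Proof.
have d2 : is_derive t 1 (fun t => k.+1%:R + k.+2%:R * cos t) (k.+2%:R * (- sin t)).
  by apply: (derE (derD (dercst k.+1%:R t 1) (derZ k.+2%:R (dercos t)))); rewrite add0r.
apply: (derE (derM (derpow k.+1 (der1c t)) d2)).
rewrite /trial2 /= exprS; move: ((1 - cos t) ^+ k) (k.+1%:R) (k.+2%:R) => X n m; ring.
Qed.

Definition J p : R := mean (fun t => sin t ^+ 2 * (1 - cos t) ^+ p).

Lemma J_cont p : continuous (fun t : R => sin t ^+ 2 * (1 - cos t) ^+ p).
Proof. by cont. Qed.

Lemma J_gt0 p : 0 < J p.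
Proof.
have h0 t : 0 <= sin t ^+ 2 * (1 - cos t) ^+ p.
  by rewrite mulr_ge0 ?sqr_ge0// exprn_ge0// subr_ge0 cos_le1.
rewrite lt_def; apply/andP; split; last by apply: mean_ge0 => t _; exact: h0.
apply/eqP => J0.
have pp := pi_gt0 R; have hp : 0 < pi / 2 < pi.
  by apply/andP; split; [rewrite divr_gt0|rewrite ltr_pdivrMr// ltr_pMr// ltr1n].
have := mean_eq0 (@J_cont p) (fun t _ => h0 t) J0 hp.
by rewrite sin_pihalf cos_pihalf subr0 !expr1n mulr1 => /eqP; rewrite oner_eq0.
Qed.

(** The mass of the trial functions concentrates at the right end of the
    interval: integrate the derivative of sin^3 (1 - cos)^p. *)
Lemma J_rec p : p.+3%:R * mean (fun t => (1 + cos t) * (sin t ^+ 2 * (1 - cos t) ^+ p)) = 3 * J p.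
Proof.
have c1 : continuous (fun t : R => (1 + cos t) * (sin t ^+ 2 * (1 - cos t) ^+ p)) by cont.
have c2 := @J_cont p.
have c3 : continuous (fun t : R => p.+3%:R * ((1 + cos t) * (sin t ^+ 2 * (1 - cos t) ^+ p))) by cont.
have c4 : continuous (fun t : R => 3 * (sin t ^+ 2 * (1 - cos t) ^+ p)) by cont.
apply/eqP; rewrite -subr_eq0 -(meanZ _ c1) -(meanZ _ c2) -(meanB c3 c4).
pose G t := sin t ^+ 3 * (1 - cos t) ^+ p.
have dG t : 0 <= t <= pi -> is_derive t 1 G (p.+3%:R * ((1 + cos t) * (sin t ^+ 2 * (1 - cos t) ^+ p)) - 3 * (sin t ^+ 2 * (1 - cos t) ^+ p)); last first.
  have c5 : continuous (fun t : R => p.+3%:R * ((1 + cos t) * (sin t ^+ 2 * (1 - cos t) ^+ p)) - 3 * (sin t ^+ 2 * (1 - cos t) ^+ p)) by cont.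
  by rewrite (mean_FTC c5 dG) /G sinpi sin0 !expr0n !mul0r subrr mulr0.
move=> _; apply: (derE (derM (derpow 3 (dersin t)) (derpow p (der1c t)))).
rewrite /= (_ : sin t ^+ 3 * (p%:R * (1 - cos t) ^+ p.-1 * sin t) =
  sin t ^+ 2 * (p%:R * (1 - cos t) ^+ p.-1 * ((1 - cos t) * (1 + cos t)))); last first.
  by rewrite -sin_sqr; ring.
have -> : p%:R * (1 - cos t) ^+ p.-1 * ((1 - cos t) * (1 + cos t)) = p%:R * (1 - cos t) ^+ p * (1 + cos t).
  case: p {c1 c2 c3 c4 G} => [|m]; first by rewrite !mul0r.
  by rewrite /= exprSr; ring.
rewrite -[p.+3%:R]natr1 -[p.+2%:R]natr1 -[p.+1%:R]natr1.
by move: ((1 - cos t) ^+ p) (cos t) (sin t) (p%:R) => X c s n; ring.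
Qed.

Lemma trial_sqr k t : trial k t ^+ 2 = sin t ^+ 2 * (1 - cos t) ^+ (k.+1 * 2).
Proof. by rewrite /trial exprMn exprM. Qed.

Lemma trial_gt0 k : 0 < mean (fun t => trial k t ^+ 2).
Proof. by rewrite (eq_mean (g := fun t => sin t ^+ 2 * (1 - cos t) ^+ (k.+1 * 2))) ?J_gt0// => t _; rewrite trial_sqr. Qed.

(** The depth is at most a small constant plus a multiple of 1 + cos, whose mean
    against the square of the trial function is 3 / (2 k + 5) by the recursion. *)
Lemma trial_concentrates (d : R) : 0 < d -> exists k,
  mean (fun t => dep (unangle L t) * trial k t ^+ 2) <= d * mean (fun t => trial k t ^+ 2).
Proof.
move=> d0; have d2 : 0 < d / 2 by rewrite divr_gt0.
have [A A0 HA] := dep_le d2.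
pose k := Num.truncn (3 * A / (d / 2)); exists k.
have ck := @trial_cont k; have cd := dep_cont.
have cu : continuous (unangle L) := @unangle_cont R L.
have cdu : continuous (fun t => dep (unangle L t)) by apply: (contcomp (f := unangle L)).
have c0 : continuous (fun t => trial k t ^+ 2) by cont.
have c1 : continuous (fun t => dep (unangle L t) * trial k t ^+ 2) by cont.
have c2 : continuous (fun t => (1 + cos t) * trial k t ^+ 2) by cont.
have c3 : continuous (fun t => d / 2 * trial k t ^+ 2) by cont.
have c4 : continuous (fun t => A * ((1 + cos t) * trial k t ^+ 2)) by cont.
have c5 : continuous (fun t => d / 2 * trial k t ^+ 2 + A * ((1 + cos t) * trial k t ^+ 2)) by cont.
apply: (@le_trans _ _ (mean (fun t => d / 2 * trial k t ^+ 2 + A * ((1 + cos t) * trial k t ^+ 2)))).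
  apply: (ler_mean c1 c5) => t ht.
  have h := HA _ (unangle_itv L0 ht); rewrite th_unangle in h.
  have := ler_wpM2r (sqr_ge0 (trial k t)) h.
  by move: (trial k t ^+ 2) (dep _) (1 + cos t) => X Y Z; rewrite mulrDl mulrA.
rewrite (meanD c3 c4) (meanZ _ c0) (meanZ _ c2).
have t0 := trial_gt0 k.
have Jr := J_rec (k.+1 * 2).
have E1 : mean (fun t => (1 + cos t) * (sin t ^+ 2 * (1 - cos t) ^+ (k.+1 * 2))) = mean (fun t => (1 + cos t) * trial k t ^+ 2).
  by apply: eq_mean => t _; rewrite trial_sqr.
have E2 : J (k.+1 * 2) = mean (fun t => trial k t ^+ 2).
  by apply: eq_mean => t _; rewrite trial_sqr.
rewrite E1 E2 in Jr.
have hk : 3 * A / (d / 2) <= (k.+1 * 2).+3%:R.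
  apply: (@le_trans _ _ k.+1%:R); first exact/ltW/truncnS_gt.
  by rewrite ler_nat -addn3 (leq_trans (leq_pmulr _ (ltn0Sn 1)))// leq_addr.
move: Jr hk t0; move: (mean (fun t => trial k t ^+ 2)) (mean _) ((k.+1 * 2).+3%:R : R) => M X N Jr hk M0.
have N0 : 0 <= N by apply: le_trans hk; rewrite divr_ge0 ?mulr_ge0// ltW.
have h1 : 3 * A <= d / 2 * N by rewrite [leRHS]mulrC -ler_pdivrMr.
have [->|An] := eqVneq A 0; first by rewrite mul0r addr0 ler_wpM2r ?(ltW M0)//; lra.
have Ap : 0 < A by rewrite lt_def An.
have Np : 0 < N.
  have : 0 < d / 2 * N by apply: lt_le_trans h1; rewrite mulr_gt0.
  by rewrite pmulr_rgt0.
have -> : X = 3 * M / N by rewrite -Jr mulrC mulKf// gt_eqF.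
have : A * (3 * M / N) <= d / 2 * M.
  rewrite mulrA ler_pdivrMr// (_ : A * (3 * M) = 3 * A * M); last by ring.
  by rewrite (mulrAC _ M) ler_wpM2r// ltW.
by lra.
Qed.

End Axis.

(** * The gap of a thin rectangle *)

Section WeightBounds.
Variable R : realType.

(** Used with A = 1 - x^2, h = y^2 and m = 1 - L^2, so that A - m is the depth
    and the last term the error of restricting the density to the axis. *)
Lemma conformal_upper (m A h : R) : 0 < m -> m <= A -> A <= 1 -> 0 <= h -> m / 2 <= A - h ->
  4 / (A - h) ^+ 2 <= 4 / m ^+ 2 * (1 - (A - m)) + 8 / (m / 2) ^+ 4 * h.
Proof.
move=> m0 mA A1 h0 hA; have A0 : 0 < A by exact: lt_le_trans mA.
have rho0 : 0 < m / 2 by rewrite divr_gt0.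
have B0 : 0 < A - h by exact: lt_le_trans hA.
have step1 : 4 / A ^+ 2 <= 4 / m ^+ 2 * (1 - (A - m)).
  pose q := m / A; have qA : m = q * A by rewrite /q divfK// gt_eqF.
  have q0 : 0 < q by rewrite divr_gt0.
  have q1 : q <= 1 by rewrite ler_pdivrMr// mul1r.
  have -> : 4 / A ^+ 2 = 4 / m ^+ 2 * q ^+ 2.
    by rewrite /q; field; rewrite ?gt_eqF.
  rewrite ler_wpM2l ?divr_ge0 ?sqr_ge0// -subr_ge0.
  have -> : 1 - (A - m) - q ^+ 2 = (1 - q) * (1 + q - A) by rewrite {1}qA; ring.
  by rewrite mulr_ge0; lra.
apply: le_trans (lerD step1 (lexx _)); rewrite -lerBlDl.
have -> : 4 / (A - h) ^+ 2 - 4 / A ^+ 2 = 4 * (A + (A - h)) / (A ^+ 2 * (A - h) ^+ 2) * h.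
  by field; rewrite ?(gt_eqF A0) ?(gt_eqF B0).
rewrite ler_wpM2r//; apply: ler_pM.
- by rewrite mulr_ge0//; lra.
- by rewrite invr_ge0 mulr_ge0 ?sqr_ge0.
- by lra.
rewrite lef_pV2 ?posrE ?mulr_gt0 ?exprn_gt0// -[4%N]/(2 + 2)%N exprD.
have p0 := ltW rho0; have hA' : m / 2 <= A by lra.
apply: ler_pM; rewrite ?sqr_ge0//.
  by rewrite lerXn2r ?nnegrE// ltW.
by rewrite lerXn2r ?nnegrE// ltW.
Qed.

Lemma conformal_lower (m A h : R) : 0 < m -> m <= A -> 0 <= h -> 0 < A - h ->
  4 / m ^+ 2 * (1 - 2 / m * (A - m)) <= 4 / (A - h) ^+ 2.
Proof.
move=> m0 mA h0 hA; have A0 : 0 < A by exact: lt_le_trans mA.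
apply: (@le_trans _ _ (4 / A ^+ 2)); last first.
  rewrite ler_pM2l// lef_pV2 ?posrE ?exprn_gt0// lerXn2r ?nnegrE ?(ltW A0) ?(ltW hA)//.
  by rewrite gerBl.
pose q := m / A.
have -> : 4 / A ^+ 2 = 4 / m ^+ 2 * q ^+ 2 by rewrite /q; field; rewrite ?gt_eqF.
rewrite ler_wpM2l ?divr_ge0 ?sqr_ge0//.
have h1 : (A - m) / A <= (A - m) / m.
  by rewrite ler_wpM2l ?subr_ge0// lef_pV2 ?posrE.
have h2 : (A - m) / A = 1 - q by rewrite /q; field; rewrite ?gt_eqF.
have -> : 2 / m * (A - m) = 2 * ((A - m) / m) by ring.
by have := sqr_ge0 (q - 1); rewrite h2 in h1; move: ((A - m) / m) h1 => X; lra.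
Qed.

End WeightBounds.

Section GapEstimate.
Variables (R : realType) (L r : R).
Hypotheses (L0 : 0 < L) (r0 : 0 < r) (Lr1 : L ^+ 2 + r ^+ 2 < 1).
Implicit Types (z f u U : R * R -> R) (p q : R * R).
Local Notation pi := (@trigo.pi R).
Local Notation Om := (open_rectangle L r).
Local Notation crect := (crect L r).
Local Notation w := (wt L r).
Local Notation IM := (Imean L r).
Local Notation W := (wdot L r).
Local Notation poi := (poisson L r).
Local Notation eig := (eigen L r).
Local Notation hat := (coef L r).
Local Notation a := (ax L).
Local Notation b := (ay r).
Local Notation th := (th L).
Local Notation dep := (dep L).
Local Notation e1 := (@e1 R).
Local Notation e2 := (@e2 R).
Local Notation m := (1 - L ^+ 2).

Let cw : continuous w := wt_cont L0 r0 Lr1.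
Let a0 : 0 < a := ax_gt0 L0.
Let cth : continuous th := @th_cont R L.
Let cth1 : continuous (fun p : R * R => th p.1).
Proof. by apply: (contcomp (f := fst)) => //; exact: contfst. Qed.

Lemma crect_sqr p : crect p -> p.1 ^+ 2 <= L ^+ 2 /\ p.2 ^+ 2 <= r ^+ 2.
Proof.
have sq (l y : R) : 0 < l -> - l <= y <= l -> y ^+ 2 <= l ^+ 2.
  by move=> l0 /andP[h1 h2]; rewrite -subr_ge0 subr_sqr mulr_ge0; lra.
by move=> [h1 h2]; split; exact: sq.
Qed.

Lemma wt_upper p : r ^+ 2 <= m / 2 -> crect p ->
  w p <= 4 / m ^+ 2 * (1 - dep p.1) + 8 / (m / 2) ^+ 4 * r ^+ 2.
Proof.
move=> rm hp; have [x2 y2] := crect_sqr hp; have r2 := sqr_ge0 r.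
have m0 : 0 < m by have := sqr_ge0 r; move: Lr1; lra.
have -> : dep p.1 = (1 - p.1 ^+ 2) - m by rewrite /dep; ring.
rewrite wtE// (_ : 1 - sqnorm p = (1 - p.1 ^+ 2) - p.2 ^+ 2); last by rewrite /sqnorm; ring.
have x0 := sqr_ge0 p.1; have y0 := sqr_ge0 p.2.
apply: (@le_trans _ _ (4 / m ^+ 2 * (1 - (1 - p.1 ^+ 2 - m)) + 8 / (m / 2) ^+ 4 * p.2 ^+ 2)).
  by apply: conformal_upper => //; lra.
by rewrite lerD2l ler_wpM2l// divr_ge0// exprn_ge0// divr_ge0// ltW.
Qed.

Lemma wt_lower p : crect p -> 4 / m ^+ 2 * (1 - 2 / m * dep p.1) <= w p.
Proof.
move=> hp; have [x2 y2] := crect_sqr hp; have r2 := sqr_ge0 r.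
have m0 : 0 < m by have := sqr_ge0 r; move: Lr1; lra.
have -> : dep p.1 = (1 - p.1 ^+ 2) - m by rewrite /dep; ring.
rewrite wtE// (_ : 1 - sqnorm p = (1 - p.1 ^+ 2) - p.2 ^+ 2); last by rewrite /sqnorm; ring.
have x0 := sqr_ge0 p.1; have y0 := sqr_ge0 p.2.
by apply: conformal_lower => //; move: Lr1; lra.
Qed.

Let th_der (x : R) : is_derive x 1 th a.
Proof.
by apply: (derE (derZ a (derD (derid x) (dercst L x 1)))); rewrite addr0 mulr1.
Qed.

(** The difference of the integrands is, on every horizontal line, the
    derivative of sin * cos * U^2 in the angular variable, which vanishes at
    both ends. *)
Lemma angular_ibp U Ux : continuous U -> continuous Ux ->
  (forall p, is_derive p e1 U (Ux p)) ->
  IM (fun p => 2 * a * (sin (th p.1) * Ux p) * (cos (th p.1) * U p) +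
               a ^+ 2 * (cos (th p.1) * U p) ^+ 2) =
  IM (fun p => a ^+ 2 * (sin (th p.1) ^+ 2 * U p ^+ 2)).
Proof.
move=> cU cUx dU; pose T p := th p.1.
have cT : continuous T by exact: cth1.
have cF : continuous (fun p => 2 * a * (sin (T p) * Ux p) * (cos (T p) * U p) + a ^+ 2 * (cos (T p) * U p) ^+ 2) by cont.
have cG : continuous (fun p => a ^+ 2 * (sin (T p) ^+ 2 * U p ^+ 2)) by cont.
apply/eqP; rewrite -subr_eq0 -(ImeanB L0 r0 cF cG); apply/eqP.
rewrite /Imean (eq_mean (g := fun=> 0)) ?mean_cst ?mulr0// => y _.
set y' := unangle r y.
pose H t := a ^+ 2 * (sin t * cos t * U (unangle L t, y') ^+ 2).
have du (t : R) : is_derive t 1 (unangle L) (a^-1).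
  apply: (derE (derZ L (derB (derZ (2 / pi) (derid t)) (dercst 1 t 1)))).
  by rewrite /ax mulr1 subr0 invf_div; move: (pi) (pi_gt0 R) => P P0; field; rewrite gt_eqF.
have dUt (t : R) : is_derive t 1 (fun t => U (unangle L t, y')) (Ux (unangle L t, y') * a^-1).
  have /is_derive_e1 h := dU (unangle L t, y').
  exact: (dercomp (f := fun s => U (s, y')) (g := unangle L) h (du t)).
pose D p := 2 * a * (sin (T p) * Ux p) * (cos (T p) * U p) + a ^+ 2 * (cos (T p) * U p) ^+ 2 - a ^+ 2 * (sin (T p) ^+ 2 * U p ^+ 2).
have cD : continuous D by exact: contB.
have ci : continuous (fun t => D (unangle L t, y')).
  by apply: (contcomp (f := fun t => (unangle L t, y'))) => //; apply: contpair; [exact: unangle_cont|exact: contcst].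
have dH (t : R) : 0 <= t <= pi -> is_derive t 1 H (D (unangle L t, y')).
  move=> _; apply: (derE (derZ (a ^+ 2) (derM (derM (dersin t) (dercos t)) (derpow 2 (dUt t))))).
  rewrite /D /T /= th_unangle// expr1.
  have := lt0r_neq0 a0; move: (ax L) (sin t) (cos t) (U _) (Ux _) => A s c V V' An.
  by field.
rewrite (mean_FTC ci dH) /H sinpi sin0.
by rewrite !mul0r !mulr0 subrr mulr0.
Qed.

(** The derivative of the product brings in the term with Ux.  It vanishes on
    the boundary: on the vertical sides the sine does, and on the horizontal
    ones U is zero, so its tangential derivative is zero. *)
Lemma poisson_angular l U Ux : eig l U -> continuous Ux ->
  (forall p, is_derive p e1 U (Ux p)) ->
  poi (fun p => cos (th p.1) * U p)
    (fun p => cos (th p.1) * (l * (w p * U p)) + 2 * a * (sin (th p.1) * Ux p) + a ^+ 2 * (cos (th p.1) * U p)).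
Proof.
move=> eU cUx dU; have cU := pair_cont eU.
have [[z1 [z11 [z2 [z22 H]]]] _ _ U0 _] := eU.
have cf : continuous (fun p => cos (th p.1) * (l * (w p * U p)) + 2 * a * (sin (th p.1) * Ux p) + a ^+ 2 * (cos (th p.1) * U p)).
  by move: cth1; set T := (fun p => th p.1) => cT; have : continuous (fun p => cos (T p) * (l * (w p * U p)) + 2 * a * (sin (T p) * Ux p) + a ^+ 2 * (cos (T p) * U p)) by cont.
have cz : continuous (fun p => cos (th p.1) * U p).
  by move: cth1; set T := (fun p => th p.1) => cT; have : continuous (fun p => cos (T p) * U p) by cont.
split=> //.
- exists (fun p => cos (th p.1) * z1 p - a * (sin (th p.1) * U p)),
    (fun p => cos (th p.1) * z11 p - 2 * a * (sin (th p.1) * z1 p) - a ^+ 2 * (cos (th p.1) * U p)),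
    (fun p => cos (th p.1) * z2 p), (fun p => cos (th p.1) * z22 p) => p op.
  have [h1 h2 h3 h4 h5] := H p op.
  have E : z1 p = Ux p by have [_ <-] := h1; have [_ ->] := dU p.
  have dc : is_derive p e1 (fun p => cos (th p.1)) (- sin (th p.1) * a).
    by apply/is_derive_e1; exact: (dercomp (f := @cos R) (g := th) (dercos _) (th_der _)).
  have ds : is_derive p e1 (fun p => sin (th p.1)) (cos (th p.1) * a).
    by apply/is_derive_e1; exact: (dercomp (f := @sin R) (g := th) (dersin _) (th_der _)).
  have dc2 : is_derive p e2 (fun p => cos (th p.1)) 0.
    by apply/is_derive_e2; exact: (dercst (cos (th p.1)) p.2 1).
  split.
  + by apply: (derE (derM dc h1)); ring.
  + by apply: (derE (derB (derM dc h2) (derZ a (derM ds h1)))); ring.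
  + by apply: (derE (derM dc2 h3)); ring.
  + by apply: (derE (derM dc2 h4)); ring.
  + have -> : z22 p = - (l * (w p * U p)) - z11 p by rewrite -h5; ring.
    by rewrite -E; move: (w p) (cos (th p.1)) (sin (th p.1)) (U p) (z1 p) (z11 p) => X c s V V1 V2; ring.
- by move=> p hp np; rewrite U0// mulr0.
- move=> p hp np; rewrite U0// !mulr0 add0r addr0.
  suff -> : sin (th p.1) * Ux p = 0 by rewrite mulr0.
  have [h|h] := pselect (- L < p.1 < L); last first.
    have : (p.1 == - L) || (p.1 == L).
      have [/andP[x1 x2] _] := hp; apply: contrapT => /negP; rewrite negb_or => /andP[n1 n2].
      by apply: h; rewrite !lt_neqAle x1 x2 eq_sym n1 n2.
    move=> /orP[/eqP ->|/eqP ->]; first by rewrite /th addNr mulr0 sin0 mul0r.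
    have -> : th L = pi by rewrite /th /ax; move: (pi) => P; field; rewrite gt_eqF.
    by rewrite sinpi mul0r.
  have /is_derive_e1 d := dU p.
  have d0 : is_derive p.1 1 (fun t => U (t, p.2)) 0.
    apply: (near_eq_is_derive (f := fun _ : R => 0 : R)).
    have : \forall t \near p.1, t \in `]- L, L[ by apply: near_in_itvoo; rewrite in_itv.
    apply: filterS => t; rewrite in_itv /= => ht; apply/esym/U0.
      by have [_ h2] := hp; split=> //=; case/andP: ht => *; rewrite !ltW.
    by move=> /orectP[_ /= h2]; apply: np; apply/orectP.
  by have [_ <-] := d; have [_ ->] := d0; rewrite mulr0.
Qed.

(** The trial function of the second eigenvalue is the ground state multiplied
    by the cosine of the angular variable: it has the opposite parity, and
    the gap is at most the ratio of the two angular moments. *)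
Theorem gap_rayleigh l1 l2 s u1 u2 : bottom L r l1 l2 u1 u2 -> s ^+ 2 = 1 ->
  (forall p, u1 (refl p) = s * u1 p) ->
  (l2 - l1) * W (fun p => cos (th p.1) * u1 p) (fun p => cos (th p.1) * u1 p) <=
  IM (fun p => a ^+ 2 * (sin (th p.1) ^+ 2 * u1 p ^+ 2)).
Proof.
move=> [_ [eu1 _] _ _ [_ var2]] s1 par.
have sk := eigen_summ_kap L0 r0 Lr1 eu1; have sc := pair_summ L0 r0 eu1.
pose U := usr L r (hat u1).
have UE p : crect p -> u1 p = U p by exact: (pair_expansion L0 r0 eu1).
have cu := pair_cont eu1; have cU : continuous U := usr_cont sc.
have eU : eig l1 U.
  have [nl _ _ b1 _] := eu1.
  have bU : bdry0 L r U by exact: usr_bdry.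
  split=> //; [|by cont|by move=> p hp np; rewrite bU// !mulr0].
  have uU : {in Om, u1 =1 U} by move=> p /set_mem /orect_crect; exact: UE.
  have [z1 [z11 [z2 [z22 H]]]] := neg_laplacian_eq uU nl.
  exists z1, z11, z2, z22 => p op; have [h1 h2 h3 h4 h5] := H p op.
  by split=> //; rewrite h5 (UE _ (orect_crect op)).
pose Ux := tser L r false true (d1c L true (hat u1)).
have sd := summ_d1c L0 true sk.
have cUx : continuous Ux by exact: tser_cont.
have dU p : is_derive p e1 U (Ux p) by exact: (tser_derive1 r true p sc sd).
pose v p := cos (th p.1) * U p.
have pv := poisson_angular eU cUx dU.
have cv : continuous v := pair_cont pv.
have o : W u1 v = 0.
  pose h p := w p * u1 p * (cos (th p.1) * u1 p).
  have : IM h = 0.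
    apply: Imean_odd => [|p].
      by rewrite /h; move: cth1; set T := (fun p => th p.1) => cT; have : continuous (fun p => w p * u1 p * (cos (T p) * u1 p)) by cont.
    rewrite /h wt_refl par.
    have -> : cos (th (refl p).1) = - cos (th p.1).
      have -> : th (refl p).1 = - th p.1 + pi.
        by rewrite /refl /th /ax /=; move: (pi) => P; field; rewrite gt_eqF.
      by rewrite cosDpi cosN.
    have ss : s * s = 1 by rewrite -expr2.
    move: (w p) (u1 p) (cos _) => x y c.
    transitivity (s * s * - (x * y * (c * y))); first by ring.
    by rewrite ss mul1r.
  move=> <-; apply: (eq_Imean L0 r0) => p hp.
  by rewrite /v /h -(UE p hp).
have := var2 _ _ pv o.
(* The part of the energy of v beyond l1 times its weighted mass. *)
pose X p := 2 * a * (sin (th p.1) * Ux p) * (cos (th p.1) * U p) + a ^+ 2 * (cos (th p.1) * U p) ^+ 2.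
have cX : continuous X.
  by rewrite /X; move: cth1; set T := (fun p => th p.1) => cT; have : continuous (fun p => 2 * a * (sin (T p) * Ux p) * (cos (T p) * U p) + a ^+ 2 * (cos (T p) * U p) ^+ 2) by cont.
have cY : continuous (fun p => w p * v p * v p) by cont.
have cZ : continuous (fun p => l1 * (w p * v p * v p)) by cont.
have -> : IM (fun p => (cos (th p.1) * (l1 * (w p * U p)) + 2 * a * (sin (th p.1) * Ux p) + a ^+ 2 * (cos (th p.1) * U p)) * (cos (th p.1) * U p)) =
    l1 * W v v + IM X.
  rewrite /wdot -(@ImeanZ R L r _ l1 cY) -(@ImeanD R L r _ _ cZ cX).
  apply: (eq_Imean L0 r0) => p _; rewrite /X /v.
  by move: (w p) (U p) (Ux p) (cos _) (sin _) => x y y' c t; ring.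
rewrite (angular_ibp cU cUx dU) -/v.
have -> : W (fun p => cos (th p.1) * u1 p) (fun p => cos (th p.1) * u1 p) = W v v.
  by apply: (eq_Imean L0 r0) => p hp; rewrite /v (UE p hp).
have -> : IM (fun p => a ^+ 2 * (sin (th p.1) ^+ 2 * u1 p ^+ 2)) = IM (fun p => a ^+ 2 * (sin (th p.1) ^+ 2 * U p ^+ 2)).
  by apply: (eq_Imean L0 r0) => p hp; rewrite (UE p hp).
by move: (W v v) (IM _) => A B; lra.
Qed.

(** Every Laplace eigenvalue is at least b^2. *)
Lemma transversal_bound z f : poi z f -> b ^+ 2 * IM (fun p => z p ^+ 2) <= IM (fun p => f p * z p).
Proof.
move=> zf; have cz := pair_cont zf; have sc := pair_summ L0 r0 zf.
have -> : IM (fun p => z p ^+ 2) = ssum (fun i => hat z i * hat z i).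
  rewrite -(Imean_mul_usr L0 r0 cz sc); apply: (eq_Imean L0 r0) => p hp.
  by rewrite expr2; exact: (congr1 (fun t => z p * t) (pair_expansion L0 r0 zf hp)).
have ss : summ (fun i => hat z i * hat z i) by exact: summ_mul_coef.
rewrite -(pair_dot L0 r0 zf zf) -(ssumZ _ ss); apply: ler_ssum.
- exact: summZ.
- exact: summ_sqr_mul (pair_l2 L0 r0 zf) (pair_l2 L0 r0 zf).
move=> i; rewrite /vec; have := sk_sqr r L0 i; move: (sk L r i) (hat z i) => s t st.
rewrite (_ : s * t * (s * t) = s ^+ 2 * (t * t)); last by ring.
rewrite ler_wpM2r -?expr2 ?sqr_ge0// st /kap.
apply: (@le_trans _ _ ((fn R i * b) ^+ 2)); last by rewrite lerDr sqr_ge0.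
have b0 : 0 <= b by rewrite ltW// ay_gt0.
have f1 := fn_ge1 R i; have f0 : 0 <= fn R i by exact: le_trans f1.
by rewrite lerXn2r ?nnegrE//; [exact: mulr_ge0|exact: ler_peMl].
Qed.

End GapEstimate.

Section GroundState.
Variables (R : realType) (L r : R).
Hypotheses (L0 : 0 < L) (r0 : 0 < r) (Lr1 : L ^+ 2 + r ^+ 2 < 1).
Implicit Types (z f u U : R * R -> R) (p q : R * R) (t : R) (k : nat).
Local Notation pi := (@trigo.pi R).
Local Notation Om := (open_rectangle L r).
Local Notation crect := (crect L r).
Local Notation w := (wt L r).
Local Notation IM := (Imean L r).
Local Notation W := (wdot L r).
Local Notation poi := (poisson L r).
Local Notation a := (ax L).
Local Notation b := (ay r).
Local Notation th := (th L).
Local Notation dep := (dep L).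
Local Notation m := (1 - L ^+ 2).

Let cw : continuous w := wt_cont L0 r0 Lr1.
Let cth : continuous th := @th_cont R L.
Let cdep : continuous dep := @dep_cont R L.

Lemma bdry_cases p : crect p -> ~ Om p ->
  (p.1 = - L \/ p.1 = L) \/ (p.2 = - r \/ p.2 = r).
Proof.
move=> [/andP[x1 x2] /andP[y1 y2]] np.
have [->|n1] := eqVneq p.1 (- L); first by left; left.
have [->|n2] := eqVneq p.1 L; first by left; right.
have [->|n3] := eqVneq p.2 (- r); first by right; left.
have [->|n4] := eqVneq p.2 r; first by right; right.
case: np; apply/orectP.
by rewrite !lt_neqAle x1 x2 y1 y2 n2 n4 (eq_sym (- L)) n1 (eq_sym (- r)) n3.
Qed.

Definition sine_y (y : R) : R := sin (b * (y + r)).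

Lemma sine_y_cont : continuous sine_y. Proof. by rewrite /sine_y; cont. Qed.

Lemma th_end x : x = - L \/ x = L -> sin (th x) = 0.
Proof.
case=> ->; first by rewrite /th addNr mulr0 sin0.
have -> : th L = pi by rewrite /th /ax; move: (pi) => P; field; rewrite gt_eqF.
exact: sinpi.
Qed.

Lemma sine_y_end y : y = - r \/ y = r -> sine_y y = 0.
Proof.
case=> ->; first by rewrite /sine_y addNr mulr0 sin0.
rewrite /sine_y (_ : b * (r + r) = pi) ?sinpi//.
by rewrite /ay; move: (pi) => P; field; rewrite gt_eqF.
Qed.

Lemma trial_poisson k :
  poi (fun p => trial k (th p.1) * sine_y p.2)
    (fun p => (b ^+ 2 * trial k (th p.1) - a ^+ 2 * trial2 k (th p.1)) * sine_y p.2).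
Proof.
have ct := @trial_cont R k; have ct2 := @trial2_cont R k; have cs := sine_y_cont.
have ct1 : continuous (fun p : R * R => trial k (th p.1)).
  by apply: (contcomp (f := fun p : R * R => th p.1)) => //; apply: (contcomp (f := fst)) => //; exact: contfst.
have ct21 : continuous (fun p : R * R => trial2 k (th p.1)).
  by apply: (contcomp (f := fun p : R * R => th p.1)) => //; apply: (contcomp (f := fst)) => //; exact: contfst.
have cs1 : continuous (fun p : R * R => sine_y p.2).
  by apply: (contcomp (f := snd)) => //; exact: contsnd.
have thd (x : R) : is_derive x 1 th a.
  by apply: (derE (derZ a (derD (derid x) (dercst L x 1)))); rewrite addr0 mulr1.
have ang (y : R) : is_derive y 1 (fun y => b * (y + r)) b.
  by apply: (derE (derZ b (derD (derid y) (dercst r y 1)))); rewrite addr0 mulr1.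
split.
- exists (fun p => trial1 k (th p.1) * a * sine_y p.2),
    (fun p => trial2 k (th p.1) * a * a * sine_y p.2),
    (fun p => trial k (th p.1) * (b * cos (b * (p.2 + r)))),
    (fun p => trial k (th p.1) * (b * (- sin (b * (p.2 + r)) * b))) => p _.
  split.
  + apply/is_derive_e1.
    have := derM (dercomp (f := trial k) (g := th) (trial_derive k _) (thd p.1)) (dercst (sine_y p.2) p.1 1).
    by move/derE; apply; ring.
  + apply/is_derive_e1.
    have := derM (derM (dercomp (f := trial1 k) (g := th) (trial1_derive k _) (thd p.1)) (dercst a p.1 1)) (dercst (sine_y p.2) p.1 1).
    by move/derE; apply; ring.
  + apply/is_derive_e2.
    have := derZ (trial k (th p.1)) (dercomp (f := @sin R) (g := fun y => b * (y + r)) (dersin _) (ang p.2)).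
    by move/derE; apply; ring.
  + apply/is_derive_e2.
    have := derZ (trial k (th p.1)) (derZ b (dercomp (f := @cos R) (g := fun y => b * (y + r)) (dercos _) (ang p.2))).
    by move/derE; apply; ring.
  + by rewrite /sine_y; move: (trial k _) (trial2 k _) (sin _) => X Y s; ring.
- by move: ct1 cs1; set F := (fun p => trial _ _) => cF cS; exact: contM.
- move: ct1 ct21 cs1; set F := (fun p => trial _ _); set G := (fun p => trial2 _ _) => cF cG cS.
  have cA : continuous (fun p => b ^+ 2 * F p - a ^+ 2 * G p) by cont.
  exact: contM cA cS.
- move=> p hp np; have [h|h] := bdry_cases hp np; last by rewrite sine_y_end// mulr0.
  by rewrite /trial th_end// !mul0r.
- move=> p hp np; have [h|h] := bdry_cases hp np; last by rewrite sine_y_end// mulr0.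
  by rewrite /trial /trial2 th_end// !mul0r !mulr0 subrr mul0r.
Qed.

(** The Rayleigh quotient of a product of the trial function in x and the first
    sine in y, with the density bounded below by its value on the axis. *)
Lemma ground_upper l1 k : 0 < l1 ->
  (forall z f, poi z f -> l1 * W z z <= IM (fun p => f p * z p)) ->
  l1 * (4 / m ^+ 2 * (mean (fun t => trial k t ^+ 2) -
     2 / m * mean (fun t => dep (unangle L t) * trial k t ^+ 2))) <=
  b ^+ 2 * mean (fun t => trial k t ^+ 2) + `|a ^+ 2 * mean (fun t => trial2 k t * trial k t)|.
Proof.
move=> l0 var1; have := var1 _ _ (trial_poisson k).
have ct := @trial_cont R k; have ct2 := @trial2_cont R k; have cs := sine_y_cont.
have cu : continuous (unangle L) := @unangle_cont R L.
pose S := mean (fun y => sine_y (unangle r y) ^+ 2).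
have S0 : 0 < S.
  have -> : S = J R 0; last exact: J_gt0.
  apply: eq_mean => y _; rewrite expr0 mulr1 /sine_y /ay angleE// gt_eqF//.
pose G x := (b ^+ 2 * trial k (th x) - a ^+ 2 * trial2 k (th x)) * trial k (th x).
pose H x := 4 / m ^+ 2 * (1 - 2 / m * dep x) * trial k (th x) ^+ 2.
have ctt : continuous (fun x => trial k (th x)) by apply: (contcomp (f := th)).
have ctt2 : continuous (fun x => trial2 k (th x)) by apply: (contcomp (f := th)).
have cG : continuous G by rewrite /G; move: ctt ctt2; set F := (fun x => trial _ _); set F2 := (fun x => trial2 _ _) => cF cF2; have : continuous (fun x => (b ^+ 2 * F x - a ^+ 2 * F2 x) * F x) by cont.
have cH : continuous H by rewrite /H; move: ctt; set F := (fun x => trial _ _) => cF; have : continuous (fun x => 4 / m ^+ 2 * (1 - 2 / m * dep x) * F x ^+ 2) by cont.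
have cs2 : continuous (fun y => sine_y y ^+ 2) by cont.
have cdu : continuous (fun t => dep (unangle L t)) by apply: (contcomp (f := unangle L)).
have k1 : continuous (fun t => trial k t ^+ 2) by cont.
have k2 : continuous (fun t => trial2 k t * trial k t) by exact: contM ct2 ct.
have k3 : continuous (fun t => dep (unangle L t) * trial k t ^+ 2) by cont.
have k4 : continuous (fun t => b ^+ 2 * trial k t ^+ 2) by cont.
have k5 : continuous (fun t => a ^+ 2 * (trial2 k t * trial k t)) by cont.
have k6 : continuous (fun t => 2 / m * (dep (unangle L t) * trial k t ^+ 2)) by cont.
have k7 : continuous (fun t => trial k t ^+ 2 - 2 / m * (dep (unangle L t) * trial k t ^+ 2)) by cont.
have -> : IM (fun p => (b ^+ 2 * trial k (th p.1) - a ^+ 2 * trial2 k (th p.1)) * sine_y p.2 * (trial k (th p.1) * sine_y p.2)) =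
    (b ^+ 2 * mean (fun t => trial k t ^+ 2) - a ^+ 2 * mean (fun t => trial2 k t * trial k t)) * S.
  transitivity (IM (fun p => G p.1 * sine_y p.2 ^+ 2)).
    apply: (eq_Imean L0 r0) => p _; rewrite /G; move: (trial k _) (trial2 k _) (sine_y _) => X Y s; ring.
  rewrite (Imean_prod L r cG cs2); congr (_ * _).
  rewrite -(meanZ _ k1) -(meanZ _ k2) -(meanB k4 k5).
  by apply: eq_mean => t _; rewrite /G (th_unangle L0); move: (trial k t) (trial2 k t) => X Y; ring.
have WH : (4 / m ^+ 2 * (mean (fun t => trial k t ^+ 2) - 2 / m * mean (fun t => dep (unangle L t) * trial k t ^+ 2))) * S <=
    W (fun p => trial k (th p.1) * sine_y p.2) (fun p => trial k (th p.1) * sine_y p.2).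
  have -> : (4 / m ^+ 2 * (mean (fun t => trial k t ^+ 2) - 2 / m * mean (fun t => dep (unangle L t) * trial k t ^+ 2))) * S =
      IM (fun p => H p.1 * sine_y p.2 ^+ 2).
    rewrite (Imean_prod L r cH cs2); congr (_ * _).
    rewrite -(meanZ _ k3) -(meanB k1 k6) -(meanZ _ k7).
    by apply: eq_mean => t _; rewrite /H (th_unangle L0); move: (trial k t) (dep _) => X Y; ring.
  have cz := pair_cont (trial_poisson k).
  have q1 : continuous (fun p : R * R => H p.1 * sine_y p.2 ^+ 2).
    exact: contM (contcomp cH (@contfst R)) (contcomp cs2 (@contsnd R)).
  move: cz; set z := (fun p => trial _ _ * _) => cz.
  have q2 : continuous (fun p => w p * z p * z p) by cont.
  apply: (ler_Imean L0 r0 q1 q2) => p hp; rewrite /H /z.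
  have := wt_lower L0 r0 Lr1 hp; move: (4 / m ^+ 2 * _) (w p) (trial k _) (sine_y _) => X Y T s XY.
  rewrite (_ : X * T ^+ 2 * s ^+ 2 = X * (T * s) ^+ 2); last by ring.
  rewrite (_ : Y * (T * s) * (T * s) = Y * (T * s) ^+ 2); last by ring.
  by rewrite ler_wpM2r ?sqr_ge0.
move: WH; move: (4 / m ^+ 2 * _) (W _ _) (b ^+ 2 * _) (a ^+ 2 * _) => X Y Z V XY h.
have h1 : l1 * X * S <= (Z - V) * S.
  by apply: le_trans h; rewrite -mulrA ler_wpM2l// ltW.
rewrite ler_pM2r// in h1; apply: (le_trans h1).
by rewrite lerD2l -normrN ler_norm.
Qed.

End GroundState.

(** Here l is the first eigenvalue, P the mass of the ground state and Q its
    mean depth, M and N the same for the trial function, beta = b^2 the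
    transversal eigenvalue, w0 the density at the ends of the axis, c the error
    of restricting it to the axis, and E the axial energy of the trial function.
    Both bounds of l compare it with beta / w0, and their discrepancy is the
    bound of Q / P. *)
Lemma depth_algebra (R : realType) (l P Q M N beta w0 c E cK d : R) :
  0 < l -> 0 < P -> 0 < M -> 0 < beta -> 0 < w0 -> 0 <= c -> c <= w0 -> 0 <= Q -> 0 <= E -> 0 <= cK ->
  N <= d * M -> beta * P <= l * (w0 * (P - Q) + c * P) ->
  l * (w0 * (M - cK * N)) <= beta * M + E ->
  Q <= P * (cK * d + c / w0 + 2 * E / (M * beta)).
Proof.
move=> l0 P0 M0 be0 w00 c0 cw Q0 E0 cK0 Nd h1 h2.
have lw : 0 < l * w0 by rewrite mulr_gt0.
have h3 : l * w0 * (1 - cK * d) * M <= beta * M + E.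
  apply: le_trans h2; rewrite -!mulrA ler_pM2l// ler_pM2l// mulrBl mul1r lerD2l lerN2 -mulrA ler_wpM2l//.
have h4 : l * w0 * (1 - cK * d) - E / M <= beta.
  rewrite lerBlDr -(ler_pM2r M0); apply: le_trans h3 _.
  by rewrite mulrDl divfK// gt_eqF.
have h5 : beta <= 2 * (l * w0).
  rewrite -(ler_pM2r P0); apply: le_trans h1 _.
  rewrite (_ : 2 * (l * w0) * P = l * (2 * w0 * P)); last by ring.
  rewrite ler_pM2l//; have := mulr_ge0 (ltW w00) Q0; have := ler_wpM2r (ltW P0) cw.
  by clear -P0; lra.
have h6 : (l * w0)^-1 <= 2 / beta.
  by rewrite ler_pdivlMr// mulrC ler_pdivrMr.
have h7 : l * w0 * Q <= P * (l * w0 * (cK * d) + l * c + E / M).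
  have := ler_wpM2r (ltW P0) h4; move: (E / M) h1 => X.
  by move: (cK * d) => Y; lra.
have h8 : Q <= P * (cK * d + c / w0 + E / M * (l * w0)^-1).
  rewrite -(ler_pM2l lw); apply: le_trans h7 _; rewrite le_eqVlt; apply/orP; left; apply/eqP.
  by field; rewrite !gt_eqF.
apply: le_trans h8 _; rewrite ler_pM2l// lerD2l.
rewrite (_ : 2 * E / (M * beta) = E / M * (2 / beta)); last by field; rewrite !gt_eqF.
by rewrite ler_wpM2l// divr_ge0// ltW.
Qed.

(** Here P is the mass of the ground state, S the mean of sin^2 against it, and
    Wv the weighted mass of cos theta * u1; if S is at most half of P, the
    weighted mass is at least 2 P. *)
Lemma gap_algebra (R : realType) (g P S Wv e a2 : R) : 0 < P -> 0 < a2 -> 0 <= g -> 4 * (P - S) <= Wv ->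
  g * Wv <= a2 * S -> a2 * S <= e * P -> e <= a2 / 2 -> g <= e / 2.
Proof.
move=> P0 a0 g0 h1 h2 h3 h4.
have SP : S <= P / 2.
  rewrite -(ler_pM2l a0); apply: le_trans h3 _.
  rewrite (_ : a2 * (P / 2) = a2 / 2 * P); last by ring.
  by rewrite ler_pM2r.
have h5 : g * (2 * P) <= e * P.
  apply: le_trans (le_trans h2 h3); rewrite ler_wpM2l//; apply: le_trans h1; lra.
by rewrite mulrA ler_pM2r// in h5; rewrite ler_pdivlMr.
Qed.

Section GapBound.
Variables (R : realType) (L r : R).
Hypotheses (L0 : 0 < L) (r0 : 0 < r) (Lr1 : L ^+ 2 + r ^+ 2 < 1).
Implicit Types (p : R * R) (t : R).
Local Notation pi := (@trigo.pi R).
Local Notation crect := (crect L r).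
Local Notation w := (wt L r).
Local Notation IM := (Imean L r).
Local Notation W := (wdot L r).
Local Notation a := (ax L).
Local Notation b := (ay r).
Local Notation th := (th L).
Local Notation dep := (dep L).
Local Notation m := (1 - L ^+ 2).
Local Notation w0 := (4 / m ^+ 2).
Local Notation C := (8 / (m / 2) ^+ 4).

Lemma gap_bound l1 l2 s u1 u2 (A e d : R) k : bottom L r l1 l2 u1 u2 ->
  s ^+ 2 = 1 -> (forall p, u1 (refl p) = s * u1 p) ->
  r ^+ 2 <= m / 2 -> C * r ^+ 2 <= w0 -> 0 <= A ->
  (forall x : R, - L <= x <= L -> a ^+ 2 * sin (th x) ^+ 2 <= e / 2 + A * dep x) ->
  mean (fun t => dep (unangle L t) * trial k t ^+ 2) <= d * mean (fun t => trial k t ^+ 2) ->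
  A * (2 / m * d + C * r ^+ 2 / w0 +
    2 * `|a ^+ 2 * mean (fun t => trial2 k t * trial k t)| / (mean (fun t => trial k t ^+ 2) * b ^+ 2)) <= e / 2 ->
  e <= a ^+ 2 / 2 -> l2 - l1 <= e / 2.
Proof.
move=> B s1 par rm Cr A0 HA HN Hd ea.
have [/andP[l10 l12] [eu1 eu2] [n1 _] _ [var1 var2]] := B.
have cw : continuous w := wt_cont L0 r0 Lr1.
have m0 : 0 < m by have := sqr_ge0 r; move: Lr1; lra.
have w00 : 0 < w0 by rewrite divr_gt0// exprn_gt0.
have C0 : 0 <= C by rewrite divr_ge0// exprn_ge0// divr_ge0// ltW.
have cu := pair_cont eu1.
have cT : continuous (fun p : R * R => th p.1) by exact: contcomp (@th_cont R L) (@contfst R).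
have cD : continuous (fun p : R * R => dep p.1) by exact: contcomp (@dep_cont R L) (@contfst R).
pose T p := th p.1; pose D p := dep p.1.
have {}cT : continuous T by []; have {}cD : continuous D by [].
have cu2 : continuous (fun p => u1 p ^+ 2) by cont.
have cDu : continuous (fun p => D p * u1 p ^+ 2) by cont.
pose P := IM (fun p => u1 p ^+ 2); pose Q := IM (fun p => D p * u1 p ^+ 2).
have D0 p : crect p -> 0 <= D p by move=> [h _]; exact: dep_ge0.
have Q0 : 0 <= Q.
  by apply: (Imean_ge0 L0 r0) => p hp; rewrite mulr_ge0 ?sqr_ge0// D0.
have P0' : 0 <= P by apply: (Imean_ge0 L0 r0) => p _; exact: sqr_ge0.
have WP : W u1 u1 <= w0 * (P - Q) + C * r ^+ 2 * P.
  have k1 : continuous (fun p => u1 p ^+ 2 - D p * u1 p ^+ 2) by cont.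
  have k2 : continuous (fun p => w0 * (u1 p ^+ 2 - D p * u1 p ^+ 2)) by cont.
  have k3 : continuous (fun p => C * r ^+ 2 * u1 p ^+ 2) by cont.
  have k4 : continuous (fun p => w0 * (u1 p ^+ 2 - D p * u1 p ^+ 2) + C * r ^+ 2 * u1 p ^+ 2) by exact: contD.
  have k5 : continuous (fun p => w p * u1 p * u1 p) by cont.
  rewrite /P /Q -(ImeanB L0 r0 cu2 cDu) -(@ImeanZ R L r _ w0 k1) -(@ImeanZ R L r _ (C * r ^+ 2) cu2).
  rewrite -(@ImeanD R L r _ _ k2 k3); apply: (ler_Imean L0 r0 k5 k4) => p hp.
  have := wt_upper L0 r0 Lr1 rm hp; rewrite -/(D p).
  move: (w p) (D p) (u1 p) w0 (C * r ^+ 2) => x y v X Y h.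
  have := ler_wpM2r (sqr_ge0 v) h.
  rewrite (_ : x * v * v = x * v ^+ 2); last by ring.
  by rewrite (_ : X * (v ^+ 2 - y * v ^+ 2) + Y * v ^+ 2 = (X * (1 - y) + Y) * v ^+ 2); last by ring.
have P0 : 0 < P.
  rewrite lt_def P0' andbT; apply/eqP => Pz; move: WP; rewrite Pz mulr0 addr0 sub0r mulrN.
  have := mulr_ge0 (ltW w00) Q0; move: n1; move: (W u1 u1) (w0 * Q) => X Y; lra.
have b0 : 0 < b ^+ 2 by rewrite exprn_gt0// ay_gt0.
have M0 := trial_gt0 R k.
have bP : b ^+ 2 * P <= l1 * (w0 * (P - Q) + C * r ^+ 2 * P).
  apply: le_trans (transversal_bound L0 r0 eu1) _.
  by rewrite (eigen_Imean L0 r0 Lr1 eu1 cu) ler_pM2l.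
have gu := ground_upper L0 r0 Lr1 k l10 var1.
have QP := depth_algebra l10 P0 M0 b0 w00 (mulr_ge0 C0 (sqr_ge0 r)) Cr Q0 (normr_ge0 _)
  (divr_ge0 (ler0n _ 2) (ltW m0)) HN bP gu.
pose S := IM (fun p => sin (T p) ^+ 2 * u1 p ^+ 2).
have cS : continuous (fun p => sin (T p) ^+ 2 * u1 p ^+ 2) by cont.
have gr := gap_rayleigh L0 r0 Lr1 B s1 par.
rewrite (@ImeanZ R L r _ (a ^+ 2) cS) -/S in gr.
have aS : a ^+ 2 * S <= e * P.
  have k1 : continuous (fun p => a ^+ 2 * (sin (T p) ^+ 2 * u1 p ^+ 2)) by cont.
  have k2 : continuous (fun p => e / 2 * u1 p ^+ 2) by cont.
  have k3 : continuous (fun p => A * (D p * u1 p ^+ 2)) by cont.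
  have k4 : continuous (fun p => e / 2 * u1 p ^+ 2 + A * (D p * u1 p ^+ 2)) by exact: contD.
  apply: (@le_trans _ _ (e / 2 * P + A * Q)).
    rewrite /S /P /Q -(@ImeanZ R L r _ (a ^+ 2) cS) -(@ImeanZ R L r _ (e / 2) cu2) -(@ImeanZ R L r _ A cDu).
    rewrite -(@ImeanD R L r _ _ k2 k3); apply: (ler_Imean L0 r0 k1 k4) => p [hp _].
    have := HA _ hp; rewrite -/(T p) -/(D p); move: (sin (T p)) (D p) (u1 p) (a ^+ 2) => x y v X h.
    have := ler_wpM2r (sqr_ge0 v) h.
    rewrite (_ : X * (x ^+ 2 * v ^+ 2) = X * x ^+ 2 * v ^+ 2); last by ring.
    by rewrite (_ : e / 2 * v ^+ 2 + A * (y * v ^+ 2) = (e / 2 + A * y) * v ^+ 2); last by ring.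
  rewrite (_ : e * P = e / 2 * P + e / 2 * P); last by field.
  rewrite lerD2l; apply: le_trans (ler_wpM2l A0 QP) _.
  by rewrite mulrCA mulrC ler_pM2r.
apply: (gap_algebra P0 (exprn_gt0 2 (ax_gt0 L0)) _ _ gr aS ea); first by rewrite subr_ge0.
pose v p := cos (T p) * u1 p; have cv : continuous v by rewrite /v; cont.
have -> : P - S = IM (fun p => v p ^+ 2); last exact: wdot_ge L0 r0 Lr1 _ cv.
rewrite /P /S -(ImeanB L0 r0 cu2 cS); apply: (eq_Imean L0 r0) => p _.
rewrite /v; have := cos2Dsin2 (T p); move: (cos (T p)) (sin (T p)) (u1 p) => c t y h.
have -> : t ^+ 2 = 1 - c ^+ 2 by rewrite -h addrC addKr.
by ring.
Qed.

End GapBound.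

(** The constants are chosen in the order e2, A, d, k, rho: the compactness
    constant A is known before the trial function is selected, and the trial
    function before r is taken small; none of them depends on r. *)
Theorem gap_small (R : realType) (L : R) : 0 < L -> L < 1 -> forall e : R, 0 < e ->
  exists2 rho : R, 0 < rho & forall r, 0 < r -> r < rho ->
  L ^+ 2 + r ^+ 2 < 1 /\ forall l1 l2 s u1 u2, bottom L r l1 l2 u1 u2 -> s ^+ 2 = 1 ->
    (forall p, u1 (refl p) = s * u1 p) -> l2 - l1 < e.
Proof.
move=> L0 L1 e e0.
have m0 : 0 < 1 - L ^+ 2 by rewrite subr_gt0 expr_lt1// ltW.
have w00 : 0 < 4 / (1 - L ^+ 2) ^+ 2 by rewrite divr_gt0// exprn_gt0.
have C0 : 0 < 8 / ((1 - L ^+ 2) / 2) ^+ 4 by rewrite divr_gt0// exprn_gt0// divr_gt0.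
have cK0 : 0 < 2 / (1 - L ^+ 2) by rewrite divr_gt0.
have a0 : 0 < ax L ^+ 2 / 2 by rewrite divr_gt0// exprn_gt0// ax_gt0.
pose e2 := Num.min e (ax L ^+ 2 / 2).
have e20 : 0 < e2 by rewrite lt_min e0 a0.
have e2h : 0 < e2 / 2 by rewrite divr_gt0.
have [A A0 HA] := sin_sqr_le L0 e2h.
have A1 : 0 < A + 1 by rewrite ltr_wpDl.
pose d := e2 / 4 / (A + 1) / (2 / (1 - L ^+ 2)).
have d0 : 0 < d by rewrite /d !divr_gt0.
have [k Hk] := trial_concentrates L0 d0.
have M0 := trial_gt0 R k.
pose E := `|ax L ^+ 2 * mean (fun t => trial2 k t * trial k t)|.
pose C' := 8 / ((1 - L ^+ 2) / 2) ^+ 4 / (4 / (1 - L ^+ 2) ^+ 2) +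
  8 * E / (mean (fun t => trial k t ^+ 2) * trigo.pi ^+ 2).
have C'0 : 0 <= C'.
  apply: addr_ge0; first exact: divr_ge0 (ltW C0) (ltW w00).
  by apply: divr_ge0; [exact: mulr_ge0 (ler0n _ 8) (normr_ge0 _)|exact: mulr_ge0 (ltW M0) (sqr_ge0 _)].
have C'1 : 0 < C' + 1 by rewrite ltr_wpDl.
pose rho := Num.min (Num.min ((1 - L ^+ 2) / 2) (4 / (1 - L ^+ 2) ^+ 2 / (8 / ((1 - L ^+ 2) / 2) ^+ 4)))
  (e2 / 4 / (A + 1) / (C' + 1)).
have rho0 : 0 < rho.
  rewrite !lt_min (divr_gt0 w00 C0) !divr_gt0//; exact: divr_gt0.
exists (Num.min 1 rho); first by rewrite lt_min ltr01.
move=> r r0; rewrite lt_min => /andP[r1 rr].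
have : r ^+ 2 <= rho.
  apply: (@le_trans _ _ r); last exact: ltW.
  by rewrite expr2 ler_piMl// ltW.
rewrite !le_min => /andP[/andP[h1 h2] h3].
have Lr1 : L ^+ 2 + r ^+ 2 < 1 by move: h1 m0; lra.
split=> // l1 l2 s u1 u2 B s1 par.
have e2e : e2 / 2 < e.
  have : e2 <= e by rewrite ge_min lexx.
  by move: e20; lra.
apply: le_lt_trans e2e.
have h2' : 8 / ((1 - L ^+ 2) / 2) ^+ 4 * r ^+ 2 <= 4 / (1 - L ^+ 2) ^+ 2.
  by rewrite mulrC -ler_pdivlMr.
apply: (gap_bound L0 r0 Lr1 B s1 par h1 h2' A0 HA Hk); last by rewrite ge_min lexx orbT.
rewrite -/E.
have -> : 2 / (1 - L ^+ 2) * d + 8 / ((1 - L ^+ 2) / 2) ^+ 4 * r ^+ 2 / (4 / (1 - L ^+ 2) ^+ 2) +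
   2 * E / (mean (fun t => trial k t ^+ 2) * ay r ^+ 2) = e2 / 4 / (A + 1) + C' * r ^+ 2.
  rewrite /C' /d mulrDl /ay; move: M0 w00 C0 cK0 (pi_gt0 R).
  move: (mean _) (4 / _) (8 / _) (2 / _) (trigo.pi) => M X Y Z P M0 X0 Y0 Z0 P0.
  by field; rewrite !gt_eqF.
have h4 : A * (e2 / 4 / (A + 1)) <= e2 / 4.
  by rewrite mulrCA ler_piMr ?ler_pdivrMr ?mul1r ?lerDl// divr_ge0// ltW.
have h5 : A * (C' * r ^+ 2) <= e2 / 4.
  have : (A + 1) * ((C' + 1) * r ^+ 2) <= e2 / 4.
    by move: h3; rewrite ler_pdivlMr// ler_pdivlMr// mulrC (mulrC (r ^+ 2)).
  apply: le_trans; have r2 := sqr_ge0 r; move: (r ^+ 2) r2 => q q0.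
  have c1 : C' * q <= (C' + 1) * q by rewrite ler_wpM2r// lerDl.
  by apply: ler_pM => //; [exact: mulr_ge0|rewrite lerDl].
by rewrite mulrDr; move: h4 h5; lra.
Qed.

(** * Rectangles as domains of the hyperbolic plane *)

Section RectangleDomain.
Variables (R : realType) (L r : R).
Hypotheses (L0 : 0 < L) (r0 : 0 < r) (Lr1 : L ^+ 2 + r ^+ 2 < 1).
Implicit Types (p : R * R) (t : R).
Local Notation Om := (open_rectangle L r).

Lemma orect_euclidean_convex : euclidean_convex Om.
Proof.
move=> p q l; rewrite !inE => /orectP[/andP[a1 a2] /andP[a3 a4]] /orectP[/andP[b1 b2] /andP[b3 b4]].
apply/orectP; have l0 : 0 <= l%:num by []; have l1 : l%:num <= 1 by [].
have E (x y c : R) : x < c -> y < c -> l%:num * x + (1 - l%:num) * y < c.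
  move=> xc yc; move: (l%:num) l0 l1 => k k0 k1.
  have [->|k2] := eqVneq k 0; first by rewrite mul0r add0r subr0 mul1r.
  have k3 : 0 < k by rewrite lt_def k2.
  have h1 : k * x < k * c by rewrite ltr_pM2l.
  have h2 : (1 - k) * y <= (1 - k) * c by rewrite ler_wpM2l ?subr_ge0// ltW.
  by lra.
have F (x y c : R) : - c < x -> - c < y -> - c < l%:num * x + (1 - l%:num) * y.
  move=> xc yc; have x1 : - x < c by rewrite ltrNl.
  have y1 : - y < c by rewrite ltrNl.
  have := E _ _ _ x1 y1.
  by move: (l%:num) => k h; lra.
by split; apply/andP; split; [exact: F|exact: E|exact: F|exact: E].
Qed.

Lemma orect_scale p t : Om p -> 0 <= t <= 1 -> Om (t * p.1, t * p.2).
Proof.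
move=> /orectP[h1 h2] /andP[t0 t1].
have sc (c y : R) : 0 < c -> - c < y < c -> - c < t * y < c.
  move=> c0 /andP[y1 y2].
  have [->|t2] := eqVneq t 0; first by rewrite mul0r oppr_lt0 c0.
  have t3 : 0 < t by rewrite lt_def t2.
  have g1 : t * y < t * c by rewrite ltr_pM2l.
  have g2 : t * - c < t * y by rewrite ltr_pM2l.
  have g3 : t * c <= c by rewrite ler_piMl// ltW.
  by apply/andP; split; move: g1 g2; rewrite ?mulrN; lra.
by apply/orectP; split; exact: sc.
Qed.

(** A union of segments that issue from the center. *)
Lemma orect_connected : connected Om.
Proof.
pose A p := (fun t => (t * p.1, t * p.2)) @` `[0, 1]%classic.
have -> : Om = \bigcup_(p in Om) A p.
  apply/seteqP; split=> [p op|q [p op [t /= ht <-]]].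
    by exists p => //; exists 1 => /=; rewrite ?in_itv /= ?ler01 ?lexx// !mul1r -surjective_pairing.
  by apply: orect_scale => //; move: ht; rewrite in_itv.
apply: bigcup_connected => [|p op].
  by exists (0, 0) => p _; exists 0 => /=; rewrite ?in_itv /= ?ler01 ?lexx// !mul0r.
apply: connected_continuous_connected; first exact: segment_connected.
by apply: continuous_subspaceT; apply: contpair; cont.
Qed.

Lemma orect_domain : bounded_hyperbolic_domain Om.
Proof.
split; [exact: orect_open|exact: orect_connected|by exists (0, 0); exact: orect_center|].
by rewrite closure_orect// => p; exact: crect_disk.
Qed.

End RectangleDomain.

Theorem mainTheorem7 (R : realType) :
  (forall L : R, 0 < L -> L < 1 ->
     exists Gamma : R -> R,
       (forall r : R, 0 < r -> L ^+ 2 + r ^+ 2 < 1 ->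
          is_fundamental_gap (open_rectangle L r) (Gamma r)) /\
       Gamma r @[r --> 0^'+] --> (0 : R)) /\
  (forall eps : R, 0 < eps ->
     exists (Omega : set (R * R)) (gamma : R),
       [/\ bounded_hyperbolic_domain Omega,
           euclidean_convex Omega,
           is_fundamental_gap Omega gamma &
           gamma < eps]).
Proof.
split=> [L L0 L1|eps eps0].
  pose good r (g : R) := 0 < r -> L ^+ 2 + r ^+ 2 < 1 -> exists (l1 l2 s : R) u1 u2,
    [/\ bottom L r l1 l2 u1 u2, s ^+ 2 = 1, forall p, u1 (refl p) = s * u1 p & g = l2 - l1].
  (* The choice keeps the two eigenfunctions: the limit needs the parity of the
     ground state, which the gap alone does not record. *)
  have /choice[Gamma HG] : forall r, exists g, good r g.
    move=> r; have [r0|r0] := pselect (0 < r); last by exists 0.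
    have [Lr1|Lr1] := pselect (L ^+ 2 + r ^+ 2 < 1); last by exists 0.
    have [l1 [l2 [s [u1 [u2 [B s1 par]]]]]] := bottom_exists L0 r0 Lr1.
    by exists (l2 - l1) => _ _; exists l1, l2, s, u1, u2.
  exists Gamma; split=> [r r0 Lr1|].
    have [l1 [l2 [s [u1 [u2 [B _ _ ->]]]]]] := HG r r0 Lr1.
    exact: gap_of_bottom B.
  apply/cvgrPdist_lt => e e0; have [rho rho0 Hrho] := gap_small L0 L1 e0.
  near=> r; have r0 : 0 < r by near: r; exact: nbhs_right_gt.
  have rr : r < rho by near: r; exact: nbhs_right_lt.
  have [Lr1 small] := Hrho r r0 rr.
  have [l1 [l2 [s [u1 [u2 [B s1 par ->]]]]]] := HG r r0 Lr1.
  have [/andP[_ l12] _ _ _ _] := B.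
  by rewrite sub0r normrN ger0_norm ?subr_ge0//; exact: small B s1 par.
have L0 : 0 < 2^-1 :> R by rewrite invr_gt0.
have L1 : 2^-1 < 1 :> R by rewrite invf_lt1// ltr1n.
have [rho rho0 Hrho] := gap_small L0 L1 eps0.
have r0 : 0 < rho / 2 by rewrite divr_gt0.
have [|Lr1 small] := Hrho (rho / 2) r0; first by lra.
have [l1 [l2 [s [u1 [u2 [B s1 par]]]]]] := bottom_exists L0 r0 Lr1.
exists (open_rectangle 2^-1 (rho / 2)), (l2 - l1); split.
- exact: orect_domain.
- exact: orect_euclidean_convex.
- exact: gap_of_bottom B.
- exact: small B s1 par.
Unshelve. all: by end_near. Qed.
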